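(* For any two integers $p$ and $q$ and all $i,j\in\mathbb{Z}$, the rational Khovanov homology groups of the Kanenobu knots $K(p,q)$ and $K(p+q,0)$ are isomorphic: \[ \mathcal{H}^{i,j}(K(p,q)) \cong \mathcal{H}^{i,j}(K(p+q,0)). \]
   Context: Kanenobu knots. Let $D$ be the standard reduced alternating $4$-crossing diagram of the figure-eight knot $4_1$: its crossings are $a,b,c,d$; two edges join $a$ and $b$ and bound a bigon, two edges join $c$ and $d$ and bound a bigon, and there is exactly one edge joining each of the pairs $ac$, $ad$, $bc$, $bd$. Draw $D$ in the left half-plane so that its unbounded face is the triangle with vertices $a,b,c$, bounded by one of the edges $ab$, the edge $bc$ and the edge $ca$. Let $D^*$ be the mirror image of $D$ under reflection in the vertical axis (reflection of $\mathbb{R}^3$ in the plane through this axis perpendicular to the projection plane). Isotope so that each of the three outer edges $ca$, $bc$, $ab$ has a portion running next to the axis, facing its mirror image. Now (1) form the connected sum along $ca$: replace the two facing arcs of $ca$ and its mirror image by two parallel arcs crossing the axis; (2) twist the two facing arcs of $bc$ and its mirror image around each other by $p$ half twists, giving $|p|$ crossings stacked along the axis; (3) do the same for the outer edge $ab$ and its mirror image with $q$ half twists. In both twist regions the two strands are antiparallel; the twist crossings are positive crossings if the number of half twists is positive, negative crossings if it is negative. The resulting diagram, with $8+|p|+|q|$ crossings, is the standard diagram of $K(p,q)$. One has $K(0,0)\approx 4_1\#4_1$, $K(p,q)\approx K(q,p)$, the mirror image of $K(p,q)$ is $K(-p,-q)$, and the Jones polynomial of $K(p,q)$ is $(-t)^{p+q}\bigl((t^{-2}-t^{-1}+1-t+t^2)^2-1\bigr)+1$.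 $\mathcal{H}^{i,j}(L)$ denotes the rational Khovanov homology of an oriented link $L$ in homological degree $i$ and quantum degree $j$, normalized so that $\sum_{i,j}(-1)^i q^j\dim\mathcal{H}^{i,j}(L)=(q^{-1}+q)V(L)|_{\sqrt{t}=-q}$, where $V$ is the Jones polynomial with $V(\text{unknot})=1$ and $t^{-1}V(L_+)-tV(L_-)=(t^{1/2}-t^{-1/2})V(L_0)$. *)

(* Defs.v *)
From HB Require Import structures.
From mathcomp Require Import all_boot all_order all_algebra.
From mathcomp Require Import generic_quotient ring_quotient.

Set Implicit Arguments.
Unset Strict Implicit.
Unset Printing Implicit Defensive.

Import GRing.Theory.
Local Open Scope ring_scope.
Local Open Scope quotient_scope.

(* [Quotient.quot] is the quotient as an additive group; only the
   scaling is added here. *)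
Section QuotientSpace.

Variables (K : fieldType) (V : vectType K) (U : {vspace V}).

Definition submod_of_vspace : submodClosed V := pred_of_vspace U.

Definition quotient_space : Type := Quotient.quot submod_of_vspace.

HB.instance Definition _ := GRing.Zmodule.on quotient_space.
HB.instance Definition _ := EqQuotient.on quotient_space.

Definition quotient_scale (a : K) (x : quotient_space) : quotient_space :=
  \pi_quotient_space (a *: repr x).

Lemma quotient_scale_pi (a : K) (v : V) :
  quotient_scale a (\pi_quotient_space v) = \pi_quotient_space (a *: v).
Proof.
apply/eqP; rewrite -Quotient.idealrBE -scalerBr rpredZ //=.
by have /eqP := reprK (\pi_quotient_space v); rewrite -Quotient.idealrBE.
Qed.

Lemma quotient_pi_add (v w : V) :
  \pi_quotient_space (v + w)
  = \pi_quotient_space v + \pi_quotient_space w :> quotient_space.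
Proof. exact: Quotient.pi_add. Qed.

Lemma quotient_pi_surj (x : quotient_space) :
  exists v : V, x = \pi_quotient_space v.
Proof. by exists (repr x); rewrite reprK. Qed.

Fact quotient_scalerA a b x :
  quotient_scale a (quotient_scale b x) = quotient_scale (a * b) x.
Proof.
by have [v ->] := quotient_pi_surj x; rewrite !quotient_scale_pi scalerA.
Qed.

Fact quotient_scale1r : left_id 1 quotient_scale.
Proof.
by move=> x; have [v ->] := quotient_pi_surj x; rewrite quotient_scale_pi scale1r.
Qed.

Fact quotient_scalerDr : right_distributive quotient_scale +%R.
Proof.
move=> a x y; have [v ->] := quotient_pi_surj x.
have [w ->] := quotient_pi_surj y.
by rewrite -quotient_pi_add !quotient_scale_pi scalerDr quotient_pi_add.
Qed.

Fact quotient_scalerDl x : {morph quotient_scale^~ x : a b / a + b}.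
Proof.
move=> a b; have [v ->] := quotient_pi_surj x.
by rewrite !quotient_scale_pi scalerDl quotient_pi_add.
Qed.

HB.instance Definition _ := GRing.Zmodule_isLmodule.Build K quotient_space
  quotient_scalerA quotient_scale1r quotient_scalerDr quotient_scalerDl.

End QuotientSpace.

(* A planar diagram code.  [e0] is the incoming under-edge, and [e0], [e1],
   [e2], [e3] are the edges met counterclockwise around the crossing.  So the
   under-strand runs from [e0] to [e2]; the over-strand runs from [e3] to [e1]
   at a positive crossing and from [e1] to [e3] at a negative one.  A diagram is
   a list of crossings over the type [E] of its edges; each edge is to occur
   exactly once as an incoming and once as an outgoing edge (an edge that does
   not occur is a crossingless circle). *)
Record crossing (E : Type) :=
  Crossing { positive : bool; e0 : E; e1 : E; e2 : E; e3 : E }.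

Section Khovanov.

Variables (E : finType) (D : seq (crossing E)).

Definition xing (k : 'I_(size D)) : crossing E := tnth (in_tuple D) k.

(* [true] marks the 1-smoothed crossings.  The 0-smoothing is the oriented one
   at a positive crossing. *)
Definition state := {ffun 'I_(size D) -> bool}.

Definition smoothing (b : bool) (c : crossing E) : seq (E * E) :=
  if b then [:: (e0 c, e3 c); (e1 c, e2 c)]
  else [:: (e0 c, e1 c); (e2 c, e3 c)].

Definition joined (s : state) : rel E := fun e f =>
  [exists k, ((e, f) \in smoothing (s k) (xing k))
          || ((f, e) \in smoothing (s k) (xing k))].

Definition same_circle (s : state) : rel E := connect (joined s).

(* The basis of the Khovanov complex: a state with a generator v+ ([true]) or
   v- ([false]) of A = <v+, v-> = Q[X]/(X^2), v+ = 1, v- = X, on each of its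
   circles.  A labelling of the circles is encoded as a labelling of the edges
   that is constant along circles. *)
Definition enhanced : finType :=
  {y : state * {ffun E -> bool} |
    [forall e, forall f, joined y.1 e f ==> (y.2 e == y.2 f)]}.

Definition est (y : enhanced) : state := (val y).1.
Definition elab (y : enhanced) : {ffun E -> bool} := (val y).2.

Definition npos : nat := count (@positive E) D.
Definition nneg : nat := count (fun c => ~~ positive c) D.
Definition height (s : state) : nat := #|[pred k | s k]|.

(* Each circle is represented by the root of its class. *)
Definition label_degree (y : enhanced) : int :=
  \sum_(e in roots (joined (est y))) (if elab y e then 1 else - 1).

Definition hdegree (y : enhanced) : int := (height (est y))%:Z - nneg%:Z.
Definition qdegree (y : enhanced) : int :=
  label_degree y + (height (est y))%:Z + npos%:Z - nneg%:Z *+ 2.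

(* [mulA a b c] is the coefficient of v_c in v_a v_b; [comulA c a b] is the
   coefficient of v_a (x) v_b in Delta(v_c), where
   Delta(v+) = v+ (x) v- + v- (x) v+ and Delta(v-) = v- (x) v-. *)
Definition mulA (a b c : bool) : rat :=
  (if c then a && b else a (+) b)%:R.
Definition comulA (c a b : bool) : rat :=
  (if c then a (+) b else ~~ a && ~~ b)%:R.

Definition flip (s : state) (k : 'I_(size D)) : state :=
  [ffun l => if l == k then true else s l].

(* The matrix entry, from [y] to [y'], of the edge map at crossing [k]: the two
   arcs of the 0-smoothing pass through [e0] and [e2], and so do those of the
   1-smoothing; the labels of the other circles do not change. *)
Definition edge_map (k : 'I_(size D)) (y y' : enhanced) : rat :=
  let a := e0 (xing k) in
  let b := e2 (xing k) in
  let x := elab y in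
  let x' := elab y' in
  if [forall e, (~~ same_circle (est y) a e && ~~ same_circle (est y) b e)
                  ==> (x' e == x e)]
  then if same_circle (est y) a b then comulA (x a) (x' a) (x' b)
       else mulA (x a) (x b) (x' a)
  else 0.

Definition diff_coef (y y' : enhanced) : rat :=
  \sum_(k | ~~ est y k && (est y' == flip (est y) k))
    (-1) ^+ #|[pred l : 'I_(size D) | (l < k)%N && est y l]| * edge_map k y y'.

Definition bigraded (i j : int) : finType :=
  {y : enhanced | (hdegree y == i) && (qdegree y == j)}.

Definition chain (i j : int) : vectType rat := {ffun bigraded i j -> rat^o}.

(* The differential C^{i,j} -> C^{i',j}, to be used with i' = i + 1: leaving i'
   free avoids a cast between C^{(i-1)+1,j} and C^{i,j}. *)
Definition diff_fun (i i' j : int) (f : chain i j) : chain i' j :=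
  [ffun y' => \sum_y f y * diff_coef (val y) (val y')].

Fact diff_fun_is_linear i i' j : linear (@diff_fun i i' j).
Proof.
move=> a f g; apply/ffunP=> y'; rewrite !ffunE scaler_sumr -big_split /=.
by apply: eq_bigr => y _; rewrite !ffunE mulrDl scalerAl.
Qed.

HB.instance Definition _ i i' j := GRing.isLinear.Build rat (chain i j)
  (chain i' j) _ (@diff_fun i i' j) (@diff_fun_is_linear i i' j).

Definition diff (i i' j : int) : 'Hom(chain i j, chain i' j) :=
  linfun (@diff_fun i i' j).

Definition cycles (i j : int) : {vspace chain i j} := lker (diff i (i + 1) j).
Definition boundaries (i j : int) : {vspace chain i j} :=
  limg (diff (i - 1) i j).

Definition boundaries_in_cycles (i j : int) : {vspace subvs_of (cycles i j)} :=
  (linfun vsval @^-1: boundaries i j)%VS.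

Definition khovanov (i j : int) : lmodType rat :=
  quotient_space (boundaries_in_cycles i j).

End Khovanov.

(* The edges of the standard diagram of K(p,q), with m = |p| and n = |q|.
   [CAa] and [CAc] are the two edges crossing the axis that replace the edge ca
   and its mirror image, the former ending at a and at a*, the latter at c and
   at c*.  For the other edges the boolean is the side of the axis ([false] for
   D, [true] for its mirror image).  [AB] is the inner edge ab; [CD1] and [CD2]
   are the edges cd next to the triangles acd and bcd, respectively.  [BC s k] and
   [ABo s k], on side [s], come from the edge bc and the outer edge ab, cut at the
   twist crossings and numbered along the axis from top to bottom.  From top to
   bottom the axis meets [CAa], the [ABo] twists, the [BC] twists and [CAc]. *)
Inductive kedge (m n : nat) :=
| CAa | CAc
| AB of bool | AD of bool | BD of bool | CD1 of bool | CD2 of bool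
| BC of bool & 'I_m.+1
| ABo of bool & 'I_n.+1.

Arguments CAa {m n}.
Arguments CAc {m n}.
Arguments AB {m n}.
Arguments AD {m n}.
Arguments BD {m n}.
Arguments CD1 {m n}.
Arguments CD2 {m n}.
Arguments BC {m n}.
Arguments ABo {m n}.

Section KedgeFinite.

Variables m n : nat.

Let code : Type := (bool + (bool + (bool + (bool + (bool + (bool +
  (bool * 'I_m.+1 + bool * 'I_n.+1)))))))%type.

Definition kedge_encode (e : kedge m n) : code :=
  match e with
  | CAa => inl false
  | CAc => inl true
  | AB s => inr (inl s)
  | AD s => inr (inr (inl s))
  | BD s => inr (inr (inr (inl s)))
  | CD1 s => inr (inr (inr (inr (inl s))))
  | CD2 s => inr (inr (inr (inr (inr (inl s)))))
  | BC s k => inr (inr (inr (inr (inr (inr (inl (s, k)))))))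
  | ABo s k => inr (inr (inr (inr (inr (inr (inr (s, k)))))))
  end.

Definition kedge_decode (x : code) : kedge m n :=
  match x with
  | inl false => CAa
  | inl true => CAc
  | inr (inl s) => AB s
  | inr (inr (inl s)) => AD s
  | inr (inr (inr (inl s))) => BD s
  | inr (inr (inr (inr (inl s)))) => CD1 s
  | inr (inr (inr (inr (inr (inl s))))) => CD2 s
  | inr (inr (inr (inr (inr (inr (inl (s, k))))))) => BC s k
  | inr (inr (inr (inr (inr (inr (inr (s, k))))))) => ABo s k
  end.

Fact kedge_encodeK : cancel kedge_encode kedge_decode.
Proof. by case. Qed.

HB.instance Definition _ := Finite.copy (kedge m n) (can_type kedge_encodeK).

End KedgeFinite.

(* The same crossing after reversing the under-strand (if [u]) and the
   over-strand (if [o]). *)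
Definition reorient (E : Type) (u o : bool) (c : crossing E) : crossing E :=
  let c' :=
    if u then Crossing (~~ positive c) (e2 c) (e3 c) (e0 c) (e1 c) else c in
  if o then Crossing (~~ positive c') (e0 c') (e1 c') (e2 c') (e3 c') else c'.

(* The image of a crossing under the reflection of the plane in the axis, [r]
   being the reflection of the edges, with both strands then reversed.  The
   reflection makes the cyclic order clockwise and changes the sign; reversing
   both strands makes the image of [e2] the incoming under-edge. *)
Definition reflect_reverse (E : Type) (r : E -> E) (c : crossing E) :
    crossing E :=
  Crossing (~~ positive c) (r (e2 c)) (r (e1 c)) (r (e0 c)) (r (e3 c)).

(* The [h] crossings of [h] half twists, positive if [pos] and negative
   otherwise, stacked on the axis.  Crossing [k] has ends L k (upper left), R k
   (upper right), L k.+1 (lower left) and R k.+1 (lower right); its strands join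
   L k to R k.+1 and L k.+1 to R k.  They are antiparallel: L 0 runs
   downwards if [down] and upwards otherwise, R 0 runs the opposite way, and
   these directions alternate with [k].  The two cases for each sign differ by
   the reversal of both strands. *)
Definition twists (E : Type) (pos down : bool) (L R : nat -> E) (h : nat) :
    seq (crossing E) :=
  [seq (let dir := down (+) odd k in
        if pos then
          if dir then Crossing true (L k.+1) (R k.+1) (R k) (L k)
          else Crossing true (R k) (L k) (L k.+1) (R k.+1)
        else
          if dir then Crossing false (L k) (L k.+1) (R k.+1) (R k)
          else Crossing false (R k.+1) (R k) (L k) (L k.+1))
  | k <- iota 0 h].

Section Kanenobu.

Variables p q : int.

Let m := `|p|%N.
Let n := `|q|%N.

Definition kanenobu_edge : finType := kedge m n.

Let bc (s : bool) (k : nat) : kanenobu_edge := BC s (inord k).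
Let abo (s : bool) (k : nat) : kanenobu_edge := ABo s (inord k).

Definition reflect_edge (e : kanenobu_edge) : kanenobu_edge :=
  match e with
  | CAa => CAa
  | CAc => CAc
  | AB s => AB (~~ s)
  | AD s => AD (~~ s)
  | BD s => BD (~~ s)
  | CD1 s => CD1 (~~ s)
  | CD2 s => CD2 (~~ s)
  | BC s k => BC (~~ s) k
  | ABo s k => ABo (~~ s) k
  end.

(* Cutting D at ca, bc and the outer edge ab leaves three strands, which for p
   and q even are traversed as follows:
     S1 = ca -> a -> AB -> b -> bc,
     S2 = bc -> c -> CD1 -> d -> BD -> b -> outer ab,
     S3 = outer ab -> a -> AD -> d -> CD2 -> c -> ca.
   An odd number of half twists changes the way these strands are connected:
   with S1 traversed as above, S2 is reversed if and only if p is odd, and S3 if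
   and only if p + q is odd.  The strands of the mirror image are always
   traversed in the direction opposite to the reflected one. *)
Let rev2 : bool := odd m.
Let rev3 : bool := odd m (+) odd n.

(* The crossings a, b, c, d of D.  Which of the two alternating diagrams is
   taken for D does not matter: exchanging over and under in D turns K(p,q) into
   the mirror image of K(-p,-q). *)
Definition figure_eight_half : seq (crossing kanenobu_edge) :=
  [:: reorient rev3 false
        (Crossing false (abo false 0) CAa (AD false) (AB false));
      reorient false rev2
        (Crossing false (AB false) (BD false) (bc false 0) (abo false n));
      reorient rev3 rev2
        (Crossing true (CD2 false) (CD1 false) CAc (bc false m));
      reorient rev2 rev3
        (Crossing true (CD1 false) (CD2 false) (BD false) (AD false))].

Definition kanenobu : seq (crossing kanenobu_edge) :=
  figure_eight_half
  ++ [seq reflect_reverse reflect_edge c | c <- figure_eight_half]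
  ++ twists (0 < p) true (bc false) (bc true) m
  ++ twists (0 < q) rev3 (abo false) (abo true) n.

End Kanenobu.

(* Main.v *)
(* Smoothing the lowest crossing of a twist region of K(p,q) vertically deletes it,
   while smoothing it horizontally gives a diagram of the two-component unlink:
   the eight fixed crossings cancel in pairs and the other twists are curls.  Both
   components of the unlink run into the same arc of the vertical smoothing, so
   that the saddle map identifies their actions, and this forces its rank to be
   two, whatever the knot.  Hence, up to a summand of the size of the homology of
   the unknot, one more half twist shifts the homology by (1,2), in either of the
   two regions and for both signs; so its dimensions depend on p + q only.

   The complexes are compared inside the ring Q[x_e]/(x_e^2) over all edges e.
   With the source-sink orientation of the edges, the circles of a state are the
   orbits of a permutation s, and the tensor power indexed by them consists of
   the F with x_e F = x_(s e) F: changing a smoothing composes s with a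
   transposition, a splitting circle is an inclusion, and merging the circles
   through e and f is the multiplication by x_e + x_f. *)
Require Import Defs.
From HB Require Import structures.
From mathcomp Require Import all_boot all_order all_fingroup all_algebra.
From mathcomp Require Import generic_quotient ring_quotient zify ring.

Set Implicit Arguments.
Unset Strict Implicit.
Unset Printing Implicit Defensive.

Import GRing.Theory.
Local Open Scope ring_scope.

(** * Circles as orbits of a permutation *)

(** Why the rank is two whatever the knot: composed with the reverse saddle, the saddle from or to
    the unlink is multiplication by x_g + x_h, where [g] and [h] mark the two components; and it is
    linear over these variables, which agree on the vertical smoothing. On a module free of rank one
    over Q[x_g, x_h]/(x_g^2, x_h^2) this fixes kernel and image. Freeness enters only through x_g
    x_h z not being a boundary, since multiplying by x_g or x_h brings the other classes to this
    one. The unlink is reached by Reidemeister moves on complexes, which have to respect the action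
    of the marks. A mark on a circle that a move removes is carried away beforehand; passing a
    crossing [c] only changes a sign, as x_{c.1} + x_{c.2} is null-homotopic. The bidegree of the
    generator is such that, in normalised degrees, the two correction terms of the recurrence are
    the homology of the unknot, once in place and once shifted along with the rest. So the dimension
    minus that of the unknot shifts exactly. Twists are only added away from zero: K(p,q) and
    K(p+q,0) are both compared with K(0,0). *)

Section EdgePolynomials.

Variable E : finType.
Implicit Types (s : {perm E}) (c d : E * E) (a b e f : E) (A B : {set E}).

(* The ring Q[x_e | e : E]/(x_e^2); the value at [A] is the coefficient of the
   product of the x_e with [e] outside [A]. *)
Definition edge_poly : vectType rat := {ffun {set E} -> rat^o}.
Implicit Types F G : edge_poly.

(** Sets list the absent variables: multiplying by x_e takes [e] out of the set, and no monomial of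
    the product lacks x_e. *)
Definition mulx e F : edge_poly :=
  [ffun A : {set E} => if e \in A then 0 else F (e |: A)].

Fact mulx_is_linear e : linear (mulx e).
Proof.
move=> k F G; apply/ffunP => A; rewrite !ffunE.
by case: ifP; rewrite ?scaler0 ?addr0.
Qed.

HB.instance Definition _ e :=
  GRing.isLinear.Build rat edge_poly edge_poly _ (mulx e) (mulx_is_linear e).

Lemma mulxC a b F : mulx a (mulx b F) = mulx b (mulx a F).
Proof.
apply/ffunP => A; rewrite !ffunE !in_setU1 setUCA.
have [->|nab] := eqVneq a b; first by [].
by case: (a \in A); case: (b \in A).
Qed.

Lemma mulxx a F : mulx a (mulx a F) = 0.
Proof. by apply/ffunP => A; rewrite !ffunE setU11; case: ifP. Qed.

(* The circles of a state are the orbits of a permutation, and the tensor power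
   of Q[x]/(x^2) indexed by the orbits is embedded in [edge_poly] by iterated
   comultiplication.  Then splitting a circle is an inclusion, and merging two
   circles is the multiplication by the sum of two variables. *)
Definition circular s F := forall e, mulx (s e) F = mulx e F.

Lemma circular_porbit s F a b :
  circular s F -> a \in porbit s b -> mulx a F = mulx b F.
Proof.
move=> cF /porbitP[k ->]; elim: k => [|k IH]; first by rewrite perm1.
by rewrite expgSr permM cF.
Qed.

Lemma porbit_trans s a b f :
  a \in porbit s b -> b \in porbit s f -> a \in porbit s f.
Proof. by rewrite -!eq_porbit_mem => /eqP -> /eqP ->. Qed.

Lemma porbit_step s a b : a \in porbit s b -> s a \in porbit s b.
Proof. by apply: porbit_trans; have := mem_porbit s 1 a; rewrite expg1. Qed.

Lemma porbit_ind s (P : pred E) a :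
  P a -> (forall e, P e -> P (s e)) -> forall b, b \in porbit s a -> P b.
Proof.
move=> Pa Ps b /porbitP[k ->]; elim: k => [|k IH]; first by rewrite perm1.
by rewrite expgSr permM Ps.
Qed.

(** A smoothing joins the two edges entering a crossing to the two leaving it. Composing with the
    transposition of the entering edges [c.1] and [c.2] exchanges their successors, which gives the
    other smoothing. *)
Definition toggle (c : E * E) s : {perm E} := (tperm c.1 c.2 * s)%g.

Lemma toggleK c s : toggle c (toggle c s) = s.
Proof. by rewrite /toggle mulgA tperm2 mul1g. Qed.

Lemma toggleE c s e : toggle c s e = s (tperm c.1 c.2 e).
Proof. by rewrite permM. Qed.

Lemma toggleD c s e : e != c.1 -> e != c.2 -> toggle c s e = s e.
Proof. by move=> n1 n2; rewrite toggleE tpermD // eq_sym. Qed.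

Definition touches s c e := (e \in porbit s c.1) || (e \in porbit s c.2).

(** Following the new circle from [f], one leaves the old circle of [f] only at [c.1] or [c.2], and
    from there on stays on the old circles of these two edges. *)
Lemma porbit_toggle s c e f :
  e \in porbit (toggle c s) f ->
  (e \in porbit s f) || touches s c e && touches s c f.
Proof.
move: e; apply: porbit_ind; first by rewrite porbit_id.
have step e : touches s c e -> touches s c (s e).
  by case/orP => /porbit_step h; rewrite /touches h ?orbT.
have t1 : touches s c c.1 by rewrite /touches porbit_id.
have t2 : touches s c c.2 by rewrite /touches porbit_id orbT.
have sub e : touches s c e -> e \in porbit s f -> touches s c f.
  by rewrite (porbit_sym _ e) => te fe; case/orP: te => te;
     rewrite /touches (porbit_trans fe te) ?orbT.
move=> e; rewrite toggleE; case: tpermP => [->|->|_ _].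
- by case/orP => [/(sub _ t1) ->|/andP[_ ->]]; rewrite step ?orbT.
- by case/orP => [/(sub _ t2) ->|/andP[_ ->]]; rewrite step ?orbT.
- by case/orP => [/porbit_step->//|/andP[/step-> ->]]; rewrite orbT.
Qed.

Lemma touches_toggle s c e : touches (toggle c s) c e -> touches s c e.
Proof.
by case/orP => /porbit_toggle /orP[h|/andP[//]]; rewrite /touches h ?orbT.
Qed.

Lemma porbit_toggle_out s c e f :
  e \in porbit s f -> ~~ touches s c f -> e \in porbit (toggle c s) f.
Proof.
rewrite -{1}(toggleK c s) => /porbit_toggle /orP[//|/andP[_]].
by move/touches_toggle => ->.
Qed.

Lemma porbits_toggle s c : c.1 != c.2 ->
  #|porbits (toggle c s)|%:Z
  = #|porbits s|%:Z + (if c.1 \in porbit s c.2 then 1 else - 1).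
Proof.
move=> nc; have := porbits_mul_tperm s c.1 c.2; rewrite /= -/(toggle c s) nc.
by case: (c.1 \in _) => /=; lia.
Qed.

(* Since the circles are oriented, the number of circles always changes. *)
Lemma porbit_toggle_neq s c : c.1 != c.2 ->
  (c.1 \in porbit (toggle c s) c.2) = (c.1 \notin porbit s c.2).
Proof.
move=> nc; have := porbits_toggle (toggle c s) nc.
rewrite toggleK porbits_toggle //.
by do 2![case: (c.1 \in _)]; lia.
Qed.

(** On Q[x]/(x^2), comultiplication after multiplication is the product with Delta(1), the sum of
    the two variables; this is the merge as seen after embedding both sides by comultiplication. *)
Definition saddle s c F : edge_poly :=
  if c.1 \in porbit s c.2 then F else mulx c.1 F + mulx c.2 F.

Fact saddle_is_linear s c : linear (saddle s c).
Proof.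
move=> k F G; rewrite /saddle; case: ifP => // _.
by rewrite !linearP scalerDr addrACA.
Qed.

HB.instance Definition _ s c :=
  GRing.isLinear.Build rat edge_poly edge_poly _ (saddle s c)
    (saddle_is_linear s c).

Lemma mulx_saddle s c e F :
  mulx e (saddle s c F) = saddle s c (mulx e F).
Proof. by rewrite /saddle; case: ifP; rewrite ?linearD /= ?(mulxC e). Qed.

(** A split starts from one circle, where both variables act alike already; for a merge, x_{c.1} and
    x_{c.2} agree on multiples of their sum because their squares vanish. *)
Lemma saddle_eq s c F : circular s F ->
  mulx c.1 (saddle s c F) = mulx c.2 (saddle s c F).
Proof.
rewrite /saddle => cF; case: ifP => [|_]; first exact: circular_porbit.
by rewrite !linearD /= !mulxx mulxC addr0 add0r.
Qed.

Lemma circular_mulx s e F : circular s F -> circular s (mulx e F).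
Proof. by move=> cF f; rewrite mulxC cF mulxC. Qed.

Lemma circularD s F G : circular s F -> circular s G -> circular s (F + G).
Proof. by move=> cF cG e; rewrite !linearD /= cF cG. Qed.

Lemma circular_toggle s c F :
  circular s F -> mulx c.1 F = mulx c.2 F -> circular (toggle c s) F.
Proof. by move=> cF eF e; rewrite toggleE; case: tpermP => [->|->|_ _]; rewrite cF. Qed.

Lemma circular_saddle s c F :
  circular s F -> circular (toggle c s) (saddle s c F).
Proof.
move=> cF; apply: circular_toggle; last exact: saddle_eq.
by rewrite /saddle; case: ifP => // _; apply: circularD; apply: circular_mulx.
Qed.

(** Exactly one of the two saddles is a split, and that one is the identity. *)
Lemma saddleK s c F : c.1 != c.2 ->
  saddle (toggle c s) c (saddle s c F) = mulx c.1 F + mulx c.2 F.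
Proof. by move=> nc; rewrite /saddle porbit_toggle_neq //; case: (c.1 \in _). Qed.

Definition disjoint_chords (c d : E * E) :=
  [&& c.1 != d.1, c.1 != d.2, c.2 != d.1 & c.2 != d.2].

Lemma toggle_commute c d s : disjoint_chords c d ->
  toggle c (toggle d s) = toggle d (toggle c s).
Proof.
case/and4P => n1 n2 n3 n4; apply/permP => e; rewrite !toggleE; congr (s _).
case: (tpermP c.1 c.2 e) => [->|->|/eqP ec1 /eqP ec2].
- by rewrite (@tpermD _ d.1 d.2 c.1) ?tpermL ?(@tpermD _ d.1) // eq_sym.
- by rewrite (@tpermD _ d.1 d.2 c.2) ?tpermR ?(@tpermD _ d.1) // eq_sym.
case: (tpermP d.1 d.2 e) => [_|_|_ _]; [by rewrite tpermD|by rewrite tpermD|].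
by rewrite tpermD // eq_sym.
Qed.

Lemma saddle_commute s c d F :
  c.1 != c.2 -> d.1 != d.2 -> disjoint_chords c d -> circular s F ->
  saddle (toggle c s) d (saddle s c F) = saddle (toggle d s) c (saddle s d F).
Proof.
move=> nc nd dis cF; have eF a b : a \in porbit s b -> mulx a F = mulx b F
  by apply: circular_porbit.
(* Both orders end in the same state, so the numbers of circles agree. This leaves six of the
   sixteen cases, three of which are immediate. *)
have := porbits_toggle (toggle d s) nc.
rewrite (toggle_commute _ dis) !porbits_toggle // /saddle.
have [hc|hc] := boolP (c.1 \in porbit s c.2);
have [hd|hd] := boolP (d.1 \in porbit s d.2);
have [hc'|hc'] := boolP (c.1 \in porbit (toggle d s) c.2);
have [hd'|hd'] := boolP (d.1 \in porbit (toggle c s) d.2) => //; try lia.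
(* Two splits followed by two merges: the chords interleave on one circle, whose variables all act
   alike. *)
- move=> _; rewrite (eF _ _ hc) (eF _ _ hd).
  have: touches s c d.2 by apply: contraNT hd'; apply: porbit_toggle_out.
  by case/orP => /eF ->; rewrite ?(eF _ _ hc).
(* Two merges followed by two splits: the chords join the same two circles. *)
- move=> _; case/orP: (porbit_toggle hd') => [|/andP[]]; first by rewrite (negPf hd).
  by case/orP => h1; case/orP => h2; rewrite (eF _ _ h1) (eF _ _ h2) 1?addrC //;
     case/negP: hd; apply: porbit_trans h1 _; rewrite porbit_sym.
move=> _; rewrite !linearD /= addrACA.
by rewrite ![mulx d.1 (mulx _ _)]mulxC ![mulx d.2 (mulx _ _)]mulxC.
Qed.

(** A circle labelled v+ has one mark and contributes 1; one labelled v- has no mark and contributes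
    -1. The sum is twice the number of marks minus the number of circles. *)
Definition poly_degree s j F :=
  forall A, F A != 0 -> (2 * #|A|)%:Z - #|porbits s|%:Z = j.

Lemma poly_degree_mulx s j e F :
  poly_degree s j F -> poly_degree s (j - 2) (mulx e F).
Proof.
move=> dF A; rewrite ffunE; case: ifPn => [_|eA /dF]; first by rewrite eqxx.
by rewrite cardsU1 eA; lia.
Qed.

Lemma poly_degreeD s j F G :
  poly_degree s j F -> poly_degree s j G -> poly_degree s j (F + G).
Proof.
move=> dF dG A; rewrite ffunE; have [->|/dF//] := eqVneq (F A) 0.
by rewrite add0r => /dG.
Qed.

Lemma poly_degree_saddle s c j F : c.1 != c.2 ->
  poly_degree s j F -> poly_degree (toggle c s) (j - 1) (saddle s c F).
Proof.
move=> nc dF A; rewrite porbits_toggle // /saddle; case: ifP => [_ /dF|_]; first lia.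
by move/(poly_degreeD (poly_degree_mulx dF) (poly_degree_mulx dF)); lia.
Qed.

(** Homogeneity and circularity are both phrased as the vanishing of linear maps, which makes
    [state_space] an intersection of kernels. *)
Definition degree_defect s (j : int) F : edge_poly :=
  [ffun A : {set E} => if (2 * #|A|)%:Z - #|porbits s|%:Z == j then 0 else F A].

Fact degree_defect_is_linear s j : linear (degree_defect s j).
Proof.
move=> k F G; apply/ffunP => A; rewrite !ffunE.
by case: ifP; rewrite ?scaler0 ?addr0.
Qed.

HB.instance Definition _ s j :=
  GRing.isLinear.Build rat edge_poly edge_poly _ (degree_defect s j)
    (degree_defect_is_linear s j).

Definition circular_defect s e F : edge_poly := mulx (s e) F - mulx e F.

Fact circular_defect_is_linear s e : linear (circular_defect s e).
Proof. by move=> k F G; rewrite /circular_defect !(linearP (mulx _)) scalerBr opprD addrACA. Qed.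

HB.instance Definition _ s e :=
  GRing.isLinear.Build rat edge_poly edge_poly _ (circular_defect s e)
    (circular_defect_is_linear s e).

Definition state_space s (j : int) : {vspace edge_poly} :=
  (lker (linfun (degree_defect s j)) :&:
   \bigcap_e lker (linfun (circular_defect s e)))%VS.

Lemma state_spaceP s j F :
  reflect (circular s F /\ poly_degree s j F) (F \in state_space s j).
Proof.
rewrite memv_cap memv_ker lfunE; apply: (iffP andP) => [[dF cF]|[cF dF]].
  split=> [e|A].
    move: cF; rewrite memvE => /subv_bigcapP/(_ e isT); rewrite -memvE memv_ker.
    by rewrite lfunE subr_eq0 => /eqP.
  move/eqP/ffunP/(_ A): dF; rewrite !ffunE; case: eqP => // _ ->.
  by rewrite eqxx.
split; last first.
  rewrite memvE; apply/subv_bigcapP => e _; rewrite -memvE memv_ker lfunE.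
  by rewrite subr_eq0 cF.
apply/eqP/ffunP => A; rewrite !ffunE; case: eqP => // nj.
by apply/eqP; apply: contraT => /dF.
Qed.

End EdgePolynomials.

(** * The cube of a chord diagram *)

Section ChordComplex.

Variable E : finType.
Implicit Types (s : {perm E}) (c d : E * E) (D : seq (E * E)) (a b e : E).
Implicit Types (F G : edge_poly E) (i j : int).

Fixpoint wf_chords D :=
  if D is c :: D' then [&& c.1 != c.2, all (disjoint_chords c) D' & wf_chords D']
  else true.

(** The ambient space depends on the chords alone; states and degrees enter only through the
    subspaces [chains], so maps between different smoothings need no casts. The first component is
    the 0-smoothing of the head chord. *)
Fixpoint cube D : vectType rat :=
  if D is _ :: D' then (cube D' * cube D')%type : vectType rat else edge_poly E.

Fixpoint lift (L : edge_poly E -> edge_poly E) D : cube D -> cube D :=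
  if D is c :: D' return cube D -> cube D
  then fun f => (lift L f.1, lift L f.2) else L.

Fixpoint cube_saddle s c D : cube D -> cube D :=
  if D is d :: D' return cube D -> cube D
  then fun f => (cube_saddle s c f.1, cube_saddle (toggle d s) c f.2)
  else saddle s c.

(** An iterated mapping cone. Saddles commute with the differential without sign, so the minus sign
    of the cone makes the square vanish. *)
Fixpoint dif s D : cube D -> cube D :=
  if D is c :: D' return cube D -> cube D
  then fun f => (dif s f.1, cube_saddle s c f.1 - dif (toggle c s) f.2)
  else fun=> 0.

Fact lift_is_linear (L : {linear edge_poly E -> edge_poly E}) D : linear (@lift L D).
Proof.
elim: D => [|c D IH] k f g /=; first exact: linearP.
by congr (_, _); apply: IH.
Qed.

HB.instance Definition _ (L : {linear edge_poly E -> edge_poly E}) D :=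
  GRing.isLinear.Build rat (cube D) (cube D) _ (@lift L D) (@lift_is_linear L D).

Fact cube_saddle_is_linear s c D : linear (@cube_saddle s c D).
Proof.
elim: D s => [|d D IH] s k f g /=; first exact: linearP.
by congr (_, _); apply: IH.
Qed.

HB.instance Definition _ s c D :=
  GRing.isLinear.Build rat (cube D) (cube D) _ (@cube_saddle s c D)
    (@cube_saddle_is_linear s c D).

Fact dif_is_linear s D : linear (@dif s D).
Proof.
elim: D s => [|c D IH] s k f g /=; first by rewrite scaler0 addr0.
congr (_, _); first exact: IH.
rewrite [cube_saddle _ _ _](linearP (@cube_saddle s c D) k f.1 g.1).
by rewrite [dif _ _](IH _ k f.2 g.2) opprD addrACA -scalerBr.
Qed.

HB.instance Definition _ s D :=
  GRing.isLinear.Build rat (cube D) (cube D) _ (@dif s D) (@dif_is_linear s D).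

Definition cube_mul e D : cube D -> cube D := @lift (mulx e) D.

HB.instance Definition _ e D := GRing.Linear.on (@cube_mul e D).

(** The degrees are not normalised by the signs of crossings: [i] is the height, and [j] is the
    label degree plus the height. *)
Fixpoint chains s D i j : {vspace cube D} :=
  if D is c :: D' return {vspace cube D} then
    ((linfun fst @^-1: chains s D' i j)
     :&: (linfun snd @^-1: chains (toggle c s) D' (i - 1) (j - 1)))%VS
  else if i == 0 then state_space s j else 0%VS.


Lemma memv_chains_cons s c D i j (f : cube (c :: D)) :
  (f \in chains s (c :: D) i j)
  = (f.1 \in chains s D i j) && (f.2 \in chains (toggle c s) D (i - 1) (j - 1)).
Proof. by rewrite memv_cap -!memv_preim !lfunE. Qed.

Lemma memv_chains_nil s i j F :
  (F \in chains s [::] i j) = if i == 0 then F \in state_space s j else F == 0.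
Proof. by rewrite /=; case: eqP => // _; rewrite memv0. Qed.

Section Lift.

Variables (L : {linear edge_poly E -> edge_poly E}) (P : pred (E * E)).
Variable (Q : {perm E} -> {perm E} -> Prop).
Hypothesis Q_toggle : forall c s t, P c -> Q s t -> Q (toggle c s) (toggle c t).

(** [Q] relates the states of source and target, for instance by one fixed toggle, and persists when
    a chord allowed by [P] is toggled in both; an operator on coefficients then has to be examined
    at single states only. *)
Lemma lift_chains k s t D i j (f : cube D) :
  (forall s t j F, Q s t -> F \in state_space s j -> L F \in state_space t (j + k)) ->
  all P D -> Q s t -> f \in chains s D i j -> lift L f \in chains t D i (j + k).
Proof.
move=> QL; elim: D s t i j f => [|c D IH] s t i j f /=.
  move=> _ Qst; rewrite -!/(chains _ [::] _ _) !memv_chains_nil.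
  by case: eqP => [_|_ /eqP ->]; [apply: QL | rewrite linear0].
case/andP => Pc PD Qst; rewrite -!/(chains _ (c :: D) _ _) !memv_chains_cons /=.
case/andP => f1 f2; rewrite (IH s) //= addrAC.
by apply: IH f2 => //; apply: Q_toggle.
Qed.

Hypothesis Q_saddle : forall c s t F, P c -> Q s t ->
  saddle t c (L F) = L (saddle s c F).

Lemma cube_saddle_lift c s t D (f : cube D) : P c -> all P D -> Q s t ->
  cube_saddle t c (lift L f) = lift L (cube_saddle s c f).
Proof.
move=> Pc; elim: D s t f => [|d D IH] s t f /=; first by move=> *; apply: Q_saddle.
by case/andP => Pd PD Qst; congr (_, _); apply: IH => //; apply: Q_toggle.
Qed.

Lemma dif_lift s t D (f : cube D) : all P D -> Q s t ->
  dif t (lift L f) = lift L (dif s f).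
Proof.
elim: D s t f => [|c D IH] s t f /=; first by rewrite linear0.
case/andP => Pc PD Qst; congr (_, _); first exact: IH.
rewrite (cube_saddle_lift (s := s)) // (IH _ _ _ PD (Q_toggle Pc Qst)).
by rewrite [RHS](linearB (@lift L D)).
Qed.

End Lift.

Lemma cube_mul_chains e s D i j (f : cube D) :
  f \in chains s D i j -> cube_mul e f \in chains s D i (j - 2).
Proof.
apply: (@lift_chains _ xpredT eq) => //; [by move=> d s1 t1 _ ->| |exact: all_predT].
move=> s1 t k F <- /state_spaceP[cF dF]; apply/state_spaceP.
by split; [apply: circular_mulx|apply: poly_degree_mulx].
Qed.

Lemma cube_saddle_mul e s c D (f : cube D) :
  cube_saddle s c (cube_mul e f) = cube_mul e (cube_saddle s c f).
Proof.
apply: (@cube_saddle_lift _ xpredT eq) => //; [by move=> d s1 t1 _ ->| |exact: all_predT].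
by move=> d s1 t F _ <-; rewrite /= mulx_saddle.
Qed.

Lemma dif_mul e s D (f : cube D) : dif s (cube_mul e f) = cube_mul e (dif s f).
Proof.
apply: (@dif_lift _ xpredT eq) => //; [by move=> d s1 t1 _ ->| |exact: all_predT].
by move=> d s1 t F _ <-; rewrite /= mulx_saddle.
Qed.

Lemma cube_mulC a b D (f : cube D) :
  cube_mul a (cube_mul b f) = cube_mul b (cube_mul a f).
Proof.
by elim: D f => [|c D IH] f /=; [apply: mulxC | congr (_, _); apply: IH].
Qed.

Lemma cube_mulxx a D (f : cube D) : cube_mul a (cube_mul a f) = 0.
Proof.
by elim: D f => [|c D IH] f /=; [apply: mulxx | congr (_, _); apply: IH].
Qed.

Lemma cube_saddle_chains s c D i j (f : cube D) :
  wf_chords (c :: D) -> f \in chains s D i j ->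
  cube_saddle s c f \in chains (toggle c s) D i (j - 1).
Proof.
case/and3P => nc; elim: D s i j f => [|d D IH] s i j f.
  move=> _ _; rewrite !memv_chains_nil; case: eqP => [_|_ /eqP ->]; last first.
    by rewrite linear0.
  case/state_spaceP => cF dF; apply/state_spaceP.
  by split; [apply: circular_saddle|apply: poly_degree_saddle].
case/andP => cd cD /and3P[nd dD wD]; rewrite !memv_chains_cons /=.
by case/andP => f1 f2; rewrite IH //= -toggle_commute // IH.
Qed.

Lemma cube_saddle_commute s c d D i j (f : cube D) :
  wf_chords [:: c, d & D] -> f \in chains s D i j ->
  cube_saddle (toggle c s) d (cube_saddle s c f)
  = cube_saddle (toggle d s) c (cube_saddle s d f).
Proof.
case/and3P => nc /andP[cd cD] /and3P[nd dD wD].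
elim: D cD dD wD s i j f => [|e D IH].
  move=> _ _ _ s i j f; rewrite memv_chains_nil; case: ifP => _.
    by case/state_spaceP => cF _; apply: saddle_commute.
  by move/eqP => ->; rewrite !linear0.
case/andP => ce cD /andP[de dD] /and3P[ne eD wD] s i j f.
rewrite memv_chains_cons => /andP[f1 f2] /=; congr (_, _); first exact: (IH _ _ _ _ i j).
rewrite -!(toggle_commute s ce) -!(toggle_commute s de).
exact: IH f2.
Qed.

Lemma dif_saddle s c D i j (f : cube D) :
  wf_chords (c :: D) -> f \in chains s D i j ->
  dif (toggle c s) (cube_saddle s c f) = cube_saddle s c (dif s f).
Proof.
elim: D s i j f => [|d D IH] s i j f; first by rewrite /= linear0.
move=> wf; case/and3P: (wf) => nc /andP[cd cD] /and3P[nd dD wD].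
rewrite memv_chains_cons => /andP[f1 f2] /=.
have wf' : wf_chords (c :: D) by apply/and3P.
congr (_, _); first exact: (IH _ i j).
rewrite (cube_saddle_commute wf f1) -(toggle_commute s cd) (IH _ _ _ _ wf' f2).
by rewrite [RHS](linearB (@cube_saddle (toggle d s) c D)).
Qed.

Lemma dif_dif s D i j (f : cube D) :
  wf_chords D -> f \in chains s D i j -> dif s (dif s f) = 0.
Proof.
elim: D s i j f => // c D IH s i j f wf.
rewrite memv_chains_cons => /andP[f1 f2] /=; have /and3P[_ _ wD] := wf.
congr (_, _); first exact: IH f1.
rewrite (linearB (@dif (toggle c s) D)) /= (dif_saddle wf f1) (IH _ _ _ _ wD f2).
by rewrite subr0 subrr.
Qed.

Lemma dif_chains s D i j (f : cube D) :
  wf_chords D -> f \in chains s D i j -> dif s f \in chains s D (i + 1) j.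
Proof.
elim: D s i j f => [|c D IH] s i j f wf; first by rewrite mem0v.
have /and3P[_ _ wD] := wf.
rewrite !memv_chains_cons => /andP[f1 f2] /=; rewrite IH //= addrK.
apply: rpredB; first exact: cube_saddle_chains.
by rewrite -[i in chains _ _ i _](subrK 1); apply: IH.
Qed.

Lemma cube_saddleK s c D (f : cube D) :
  c.1 != c.2 -> all (disjoint_chords c) D ->
  cube_saddle (toggle c s) c (cube_saddle s c f) = cube_mul c.1 f + cube_mul c.2 f.
Proof.
move=> nc; elim: D s f => [|d D IH] s f /=; first by move=> _; apply: saddleK.
case/andP => cd cD; congr (_, _); first exact: IH.
by rewrite -toggle_commute // IH.
Qed.

(** No chord of [D] ends at [e], so the successor of [e] is the same in all states, and the two
    variables act alike on the whole complex. *)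
Lemma cube_mul_succ s e D i j (f : cube D) :
  all (fun c => (e != c.1) && (e != c.2)) D -> f \in chains s D i j ->
  cube_mul (s e) f = cube_mul e f.
Proof.
elim: D s i j f => [|c D IH] s i j f.
  move=> _; rewrite memv_chains_nil; case: ifP => _; last by move/eqP ->; rewrite !linear0.
  by case/state_spaceP => cF _; apply: cF.
case/andP => /andP[e1 e2] eD; rewrite memv_chains_cons => /andP[f1 f2] /=.
by congr (_, _); [apply: (IH _ i j) | rewrite -(toggleD s e1 e2); apply: IH f2].
Qed.

End ChordComplex.

(** * Chord diagrams with the homology of an unlink *)

Section UnlinkHomology.

Variable E : finType.
Implicit Types (s t : {perm E}) (c d : E * E) (D : seq (E * E)) (a b e g h : E).
Implicit Types (i j : int).

(* The homology is that of a two-component unlink: free of rank one over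
   Q[x_g, x_h]/(x_g^2, x_h^2), with a generator in bidegree (i0, j0). *)
Definition unlink_homology s D g h i0 j0 : Prop :=
  exists2 z : cube D, z \in chains s D i0 j0 /\ dif s z = 0 &
    (forall i j (w : cube D), w \in chains s D i j -> dif s w = 0 ->
       exists k0 k1 k2 k3 : rat, exists2 u, u \in chains s D (i - 1) j &
         w = k0 *: z + k1 *: cube_mul g z + k2 *: cube_mul h z
             + k3 *: cube_mul g (cube_mul h z) + dif s u /\
         [/\ (k0 != 0 -> i = i0 /\ j = j0),
             (k1 != 0 -> i = i0 /\ j = j0 - 2),
             (k2 != 0 -> i = i0 /\ j = j0 - 2)
           & (k3 != 0 -> i = i0 /\ j = j0 - 4)]) /\
    (forall u, u \in chains s D (i0 - 1) (j0 - 4) ->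
       dif s u <> cube_mul g (cube_mul h z)).

Section Transport.

Variables (s t : {perm E}) (D D' : seq (E * E)) (T : {linear cube D -> cube D'}).
Variables (m n : int) (k : rat) (g h : E).
Hypothesis k_neq0 : k != 0.
Hypothesis T_chains : forall i j f,
  f \in chains s D i j -> T f \in chains t D' (i + m) (j + n).
Hypothesis T_mulg : forall f, T (cube_mul g f) = cube_mul g (T f).
Hypothesis T_mulh : forall f, T (cube_mul h f) = cube_mul h (T f).
Hypothesis T_dif : forall i j f,
  f \in chains s D i j -> dif t (T f) = k *: T (dif s f).
Hypothesis T_surj : forall i j w, w \in chains t D' i j -> dif t w = 0 ->
  exists w' u, [/\ w' \in chains s D (i - m) (j - n), dif s w' = 0,
                   u \in chains t D' (i - 1) j & w = T w' + dif t u].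
Hypothesis T_inj : forall i j w u, w \in chains s D i j -> dif s w = 0 ->
  u \in chains t D' (i + m - 1) (j + n) -> T w = dif t u ->
  exists2 u', u' \in chains s D (i - 1) j & w = dif s u'.

(** [T] is a chain map up to the factor [k], is bijective on homology by [T_surj] and [T_inj], and
    respects both variables. The factor is -1 when [T] raises the height by one, the cone negating
    the differential of its second component. *)
Lemma unlink_homology_transport i0 j0 :
  unlink_homology s D g h i0 j0 -> unlink_homology t D' g h (i0 + m) (j0 + n).
Proof.
case=> z [zC dz] [gen nb]; exists (T z).
  by split; [apply: T_chains | rewrite (T_dif zC) dz linear0 scaler0].
split=> [i j w wC dw|u uC].
  have [w' [u [w'C dw' uC ->]]] := T_surj wC dw.
  have [k0 [k1 [k2 [k3 [u' u'C [-> [h0 h1 h2 h3]]]]]]] := gen _ _ _ w'C dw'.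
  exists k0, k1, k2, k3, (k^-1 *: T u' + u).
    apply: rpredD uC; apply: rpredZ; have := T_chains u'C.
    by rewrite addrAC !subrK.
  split; last by split=> [/h0|/h1|/h2|/h3] [/eqP hi /eqP hj];
    move: hi hj; rewrite !subr_eq => /eqP -> /eqP ->; rewrite // addrAC.
  rewrite !(linearD T) !(linearZZ T) !T_mulg !T_mulh.
  rewrite [dif t (_ *: _ + _)](linearP (@dif E t D')) /= (T_dif u'C).
  by rewrite scalerA mulVf // scale1r addrA.
move=> du; rewrite -T_mulh -T_mulg in du.
have zzC : cube_mul g (cube_mul h z) \in chains s D i0 (j0 - 4).
  have := cube_mul_chains g (cube_mul_chains h zC).
  by rewrite -addrA -opprD.
have uC' : u \in chains t D' (i0 + m - 1) (j0 - 4 + n) by rewrite [j0 - 4 + n]addrAC.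
have zz0 : dif s (cube_mul g (cube_mul h z)) = 0 by rewrite !dif_mul dz !linear0.
have [u' u'C eu] := T_inj zzC zz0 uC' (esym du).
by apply: (nb _ u'C); rewrite -eu.
Qed.

End Transport.

Lemma toggle_swap a b s : toggle (a, b) s = toggle (b, a) s.
Proof. by rewrite /toggle tpermC. Qed.

Lemma cube_saddle_swap s a b D (f : cube D) :
  cube_saddle s (a, b) f = cube_saddle s (b, a) f.
Proof.
elim: D s f => [|c D IH] s f /=; first by rewrite /saddle /= porbit_sym addrC.
by rewrite !IH.
Qed.

Lemma unlink_homology_swap s a b D g h i0 j0 :
  unlink_homology s ((a, b) :: D) g h i0 j0 ->
  unlink_homology s ((b, a) :: D) g h i0 j0.
Proof.
have eC i j : chains s ((a, b) :: D) i j = chains s ((b, a) :: D) i j.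
  by rewrite /= toggle_swap.
have ed f : dif s (f : cube ((a, b) :: D)) = dif s (f : cube ((b, a) :: D)).
  by rewrite /= toggle_swap cube_saddle_swap.
case=> z [zC dz] [gen nb]; exists z; first by rewrite -eC -ed.
split=> [i j w|u]; rewrite -eC -!ed; last exact: nb.
move=> wC dw; have [k0 [k1 [k2 [k3 [u uC H]]]]] := gen _ _ _ wC dw.
by exists k0, k1, k2, k3, u; rewrite -?eC -?ed.
Qed.

Lemma unlink_homologyC s D g h i0 j0 :
  unlink_homology s D g h i0 j0 -> unlink_homology s D h g i0 j0.
Proof.
case=> z zC [gen nb]; exists z => //; split=> [i j w wC dw|u uC].
  have [k0 [k1 [k2 [k3 [u uC [-> [? ? ? ?]]]]]]] := gen _ _ _ wC dw.
  exists k0, k2, k1, k3, u => //; split; last by split.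
  by rewrite cube_mulC [X in X + _ + _]addrAC.
by rewrite cube_mulC; apply: nb.
Qed.

(** On homology the variable of [g'] is [k] times that of [g], so the same generator serves and the
    coefficients that involve [g] are divided by [k]. *)
Lemma unlink_homology_homotopic k s D g g' h i0 j0 : k != 0 ->
  (forall i j w, w \in chains s D i j -> dif s w = 0 ->
     exists2 u, u \in chains s D (i - 1) (j - 2) &
       cube_mul g' w = k *: cube_mul g w + dif s u) ->
  unlink_homology s D g h i0 j0 -> unlink_homology s D g' h i0 j0.
Proof.
move=> k0 hom [z [zC dz] [gen nb]]; exists z => //.
have [u1 u1C eg'] := hom _ _ _ zC dz.
have eg : cube_mul g z = k^-1 *: cube_mul g' z - dif s (k^-1 *: u1).
  rewrite eg' linearZZ scalerDr scalerA mulVf // scale1r.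
  by rewrite addrK.
split=> [i j w wC dw|u uC du].
  have [l0 [l1 [l2 [l3 [u uC [-> [h0 h1 h2 h3]]]]]]] := gen _ _ _ wC dw.
  exists l0, (l1 / k), l2, (l3 / k),
    (u - (l1 / k) *: u1 - (l3 / k) *: cube_mul h u1).
    apply: rpredB; first apply: rpredB => //.
    - have [->|/h1[-> ->]] := eqVneq l1 0; first by rewrite mul0r scale0r mem0v.
      exact: rpredZ.
    - have [->|/h3[-> ->]] := eqVneq l3 0; first by rewrite mul0r scale0r mem0v.
      apply: rpredZ; have := cube_mul_chains h u1C.
      by rewrite -addrA -opprD.
  split.
    rewrite [cube_mul g (cube_mul h z)]cube_mulC eg.
    rewrite !(linearB (@dif E s D)) !(linearZZ (@dif E s D)) /= dif_mul.
    rewrite !(linearB (@cube_mul E h D)) !(linearZZ (@cube_mul E h D)) /=.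
    rewrite !scalerBr !scalerA (cube_mulC h).
    set x0 := _ *: z; set x1 := _ *: cube_mul g' z; set x2 := _ *: cube_mul h z.
    set x3 := _ *: cube_mul g' _; set y1 := _ *: dif s u1; set y3 := _ *: cube_mul h _.
    by rewrite !addrA [LHS](ACl (1*2*4*5*7*3*6)%AC).
  split=> //; rewrite mulf_eq0 invr_eq0 (negPf k0) orbF; [exact: h1|exact: h3].
have u1C' := cube_mul_chains h u1C; rewrite -addrA -opprD in u1C'.
apply: (nb (k^-1 *: u - k^-1 *: cube_mul h u1)).
  by apply: rpredB; apply: rpredZ.
rewrite [cube_mul g (cube_mul h z)]cube_mulC eg.
rewrite !(linearB (@dif E s D)) !(linearZZ (@dif E s D)) /= dif_mul.
rewrite !(linearB (@cube_mul E h D)) !(linearZZ (@cube_mul E h D)) /=.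
by rewrite du (cube_mulC h).
Qed.

(** The reverse saddle, from the 1-smoothing back to the 0-smoothing, is a homotopy from x_{c.1} +
    x_{c.2} to 0, because two successive saddles multiply by this sum. A mark that passes a crossing
    thus changes the sign of its action. *)
Lemma unlink_homology_pass_head s c D h i0 j0 : wf_chords (c :: D) ->
  unlink_homology s (c :: D) c.1 h i0 j0 -> unlink_homology s (c :: D) c.2 h i0 j0.
Proof.
move=> wf; have /and3P[nc dc wD] := wf; apply: (unlink_homology_homotopic (k := -1)) => //.
move=> i j [w0 w1]; rewrite memv_chains_cons => /andP[/= w0C w1C] [dw0 dw1].
exists (cube_saddle (toggle c s) c w1, 0).
  rewrite memv_chains_cons mem0v andbT /=.
  have := cube_saddle_chains (s := toggle c s) wf w1C.
  by rewrite toggleK -addrA -opprD.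
move/eqP: dw1; rewrite subr_eq0 => /eqP dw1.
have saddle2 t (f : cube D) := cube_saddleK t f nc dc.
have e1 := saddle2 (toggle c s) w1; have e2 := dif_saddle wf w1C.
rewrite toggleK in e1 e2.
rewrite /= linear0 subr0 scaleN1r; congr (_, _).
  by rewrite e2 -dw1 saddle2 addKr.
by rewrite e1 addKr.
Qed.

End UnlinkHomology.

(** * Independence of the order of the chords *)

Section Reordering.

Variable E : finType.
Implicit Types (s t : {perm E}) (c d : E * E) (D : seq (E * E)) (a b e g h : E).
Implicit Types (i j : int).

Definition endpoints D : seq E := flatten [seq [:: c.1; c.2] | c <- D].

Lemma all_disjoint_chords c D :
  all (disjoint_chords c) D = (c.1 \notin endpoints D) && (c.2 \notin endpoints D).
Proof.
elim: D => //= d D ->; rewrite !inE !negb_or /disjoint_chords -!andbA.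
by do !bool_congr.
Qed.

Lemma wf_chordsE D : wf_chords D = uniq (endpoints D).
Proof.
elim: D => //= c D ->; rewrite all_disjoint_chords inE negb_or -!andbA.
by do !bool_congr.
Qed.

Lemma perm_wf_chords D D' : perm_eq D D' -> wf_chords D = wf_chords D'.
Proof.
by move=> pD; rewrite !wf_chordsE; apply/perm_uniq/perm_flatten/perm_map.
Qed.

(** Compatibility with the saddles at further chords is included because it is what extends an
    isomorphism over one more cone. *)
Record cube_iso D D' (T : cube D -> cube D') (T' : cube D' -> cube D) : Prop :=
  CubeIso {
  iso_linear : linear T;
  iso_can : cancel T T';
  iso_can' : cancel T' T;
  iso_chains : forall s i j f, (T f \in chains s D' i j) = (f \in chains s D i j);
  iso_dif : forall s f, dif s (T f) = T (dif s f);
  iso_saddle : forall s c f, all (disjoint_chords c) D ->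
    cube_saddle s c (T f) = T (cube_saddle s c f);
  iso_mul : forall e f, cube_mul e (T f) = T (cube_mul e f) }.

Lemma cube_iso_refl D : @cube_iso D D id id.
Proof. by []. Qed.

Lemma cube_iso_trans D D' D'' T T' U U' : perm_eq D D' ->
  @cube_iso D D' T T' -> @cube_iso D' D'' U U' -> cube_iso (U \o T) (T' \o U').
Proof.
move=> pD [lT cT cT' mT dT sT xT] [lU cU cU' mU dU sU xU]; split.
- by move=> k f g /=; rewrite lT lU.
- by move=> f /=; rewrite cU.
- by move=> f /=; rewrite cT'.
- by move=> s i j f; rewrite /= mU mT.
- by move=> s f; rewrite /= dU dT.
- by move=> s c f cD; rewrite /= sU ?sT // -(perm_all _ pD).
- by move=> e f; rewrite /= xU xT.
Qed.

Lemma cube_iso_sym D D' T T' : perm_eq D D' ->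
  @cube_iso D D' T T' -> cube_iso T' T.
Proof.
move=> pD [lT cT cT' mT dT sT xT]; split=> //.
- by move=> k f g; apply: (can_inj cT); rewrite cT' lT !cT'.
- by move=> s i j f; rewrite -mT cT'.
- by move=> s f; apply: (can_inj cT); rewrite -dT !cT'.
- by move=> s c f cD; apply: (can_inj cT); rewrite -sT ?(perm_all _ pD) // !cT'.
- by move=> e f; apply: (can_inj cT); rewrite -xT !cT'.
Qed.

Lemma cube_iso_cons c D D' T T' : all (disjoint_chords c) D ->
  @cube_iso D D' T T' ->
  @cube_iso (c :: D) (c :: D') (fun f => (T f.1, T f.2)) (fun f => (T' f.1, T' f.2)).
Proof.
move=> cD [lT cT cT' mT dT sT xT]; split.
- by move=> k f g; rewrite /= !lT.
- by case=> f g; rewrite /= !cT.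
- by case=> f g; rewrite /= !cT'.
- by move=> s i j f; rewrite !memv_chains_cons /= !mT.
- move=> s f /=; rewrite !dT sT //; congr (_, _).
  have TD x y : T (x - y) = T x - T y by rewrite -scaleN1r addrC lT scaleN1r addrC.
  by rewrite TD.
- by move=> s d f /andP[_ dD]; rewrite /= !sT.
- by move=> e f; rewrite /cube_mul /=; congr (_, _); apply: xT.
Qed.

(** The two orders of forming the cones differ by a sign where both chords are 1-smoothed. *)
Definition cube_swap c d D (f : cube [:: c, d & D]) : cube [:: d, c & D] :=
  ((f.1.1, f.2.1), (f.1.2, - f.2.2)).

Lemma cube_iso_swap c d D : disjoint_chords c d ->
  cube_iso (@cube_swap c d D) (@cube_swap d c D).
Proof.
move=> cd; split.
- by move=> k f g; congr ((_, _), (_, _)); rewrite /= opprD scalerN.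
- by case=> [[? ?] [? ?]]; rewrite /cube_swap /= opprK.
- by case=> [[? ?] [? ?]]; rewrite /cube_swap /= opprK.
- move=> s i j f; rewrite !memv_chains_cons /= memvN toggle_commute // -!andbA.
  by do !bool_congr.
- move=> s f; rewrite /cube_swap /= !(linearN (@dif E _ D)) /= toggle_commute //.
  congr ((_, _), (_, _)).
  set P := cube_saddle _ d f.2.1; set Q := cube_saddle _ c f.1.2; set X := dif _ f.2.2.
  change (P - (Q - - X) = - (Q - (P - X))).
  by rewrite opprK opprD addrA opprB addrAC.
- move=> s e f _; rewrite /cube_swap /= (toggle_commute _ cd).
  by rewrite (linearN (@cube_saddle E _ _ D)).
- move=> e f; congr ((_, _), (_, _)).
  by rewrite [LHS](linearN (@cube_mul E e D)).
Qed.

Lemma cube_iso_rot c D1 D2 : wf_chords (D1 ++ c :: D2) ->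
  exists T T', @cube_iso (D1 ++ c :: D2) (c :: D1 ++ D2) T T'.
Proof.
elim: D1 => [|d D1 IH] /=; first by do 2!exists id; apply: cube_iso_refl.
case/and3P => nd; rewrite all_cat /= => /and3P[dD1 dc dD2] wD.
have [T [T' iT]] := IH wD.
have dD : all (disjoint_chords d) (D1 ++ c :: D2) by rewrite all_cat /= dD1 dc.
have iso1 := cube_iso_cons dD iT.
have iso2 := @cube_iso_swap d c (D1 ++ D2) dc.
do 2!eexists; apply: (cube_iso_trans _ iso1 iso2).
by rewrite perm_cons -cat1s perm_catCA.
Qed.

Lemma perm_cube_iso D D' : wf_chords D -> perm_eq D D' ->
  exists T T', @cube_iso D D' T T'.
Proof.
elim: D D' => [|c D IH] D' wD.
  by rewrite perm_sym => /perm_nilP ->; do 2!exists id; apply: cube_iso_refl.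
move=> pD; have cD' : c \in D' by rewrite -(perm_mem pD) mem_head.
case/splitPr: {D'} cD' pD => D1 D2; rewrite -[c :: D2]cat1s perm_sym perm_catCA /=.
rewrite perm_cons perm_sym => pD; have /and3P[_ cD wD'] := wD.
have [T [T' iT]] := IH _ wD' pD.
have wD2 : wf_chords (D1 ++ c :: D2).
  rewrite (@perm_wf_chords _ (c :: D)) // -[c :: D2]cat1s perm_catCA /=.
  by rewrite perm_cons perm_sym.
have [U [U' iU]] := cube_iso_rot wD2.
have iU' : @cube_iso (c :: D1 ++ D2) (D1 ++ c :: D2) U' U.
  by apply: cube_iso_sym iU; rewrite -[c :: D2]cat1s perm_catCA.
do 2!eexists; apply: (cube_iso_trans _ (cube_iso_cons cD iT) iU').
by rewrite perm_cons.
Qed.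

Lemma unlink_homology_iso s D D' T T' g h i0 j0 : @cube_iso D D' T T' ->
  unlink_homology s D g h i0 j0 -> unlink_homology s D' g h i0 j0.
Proof.
case=> lT cT cT' mT dT _ xT.
pose L : {linear cube D -> cube D'} :=
  HB.pack T (GRing.isLinear.Build rat (cube D) (cube D') _ T lT).
have LE f : L f = T f by [].
move=> H; rewrite -[i0]addr0 -[j0]addr0.
apply: (unlink_homology_transport (T := L) (k := 1)) H => //.
- by move=> i j f; rewrite !addr0 LE mT.
- by move=> i j f _; rewrite !LE dT scale1r.
- move=> i j w wC dw; exists (T' w), 0; rewrite !subr0 -mT cT' linear0 addr0 mem0v.
  by split=> //; apply: (can_inj cT); rewrite -dT cT' dw -[RHS]LE linear0.
- move=> i j w u wC dw; rewrite !addr0 LE => uC e; exists (T' u).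
    by rewrite -mT cT'.
  by apply: (can_inj cT); rewrite -dT cT'.
Qed.

Lemma unlink_homology_perm s D D' g h i0 j0 : wf_chords D -> perm_eq D D' ->
  unlink_homology s D g h i0 j0 -> unlink_homology s D' g h i0 j0.
Proof.
move=> wD pD; have [T [T' iT]] := perm_cube_iso wD pD.
exact: unlink_homology_iso iT.
Qed.

Lemma unlink_homology_pass s c D g g' h i0 j0 : wf_chords D -> c \in D ->
  (c == (g, g')) || (c == (g', g)) ->
  unlink_homology s D g h i0 j0 -> unlink_homology s D g' h i0 j0.
Proof.
move=> wD cD cg H; have pD := perm_to_rem cD.
have wD' : wf_chords (c :: rem c D) by rewrite -(perm_wf_chords pD).
have {H} := unlink_homology_perm wD pD H.
move=> H; apply: (unlink_homology_perm wD'); first by rewrite perm_sym.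
case/orP: cg => /eqP ec; last first.
  rewrite ec in wD' H *; apply: unlink_homology_swap.
  apply: (@unlink_homology_pass_head _ _ (g, g')).
    move: wD'; rewrite /= eq_sym => /and3P[-> dD ->]; rewrite andbT /=.
    by apply: sub_all dD => d /and4P[*]; apply/and4P.
  exact: unlink_homology_swap.
rewrite ec in wD' H *; exact: (unlink_homology_pass_head wD').
Qed.

Definition avoids D e := all (fun c => (e != c.1) && (e != c.2)) D.

Lemma unlink_homology_succ s D g h i0 j0 : avoids D g ->
  unlink_homology s D (s g) h i0 j0 <-> unlink_homology s D g h i0 j0.
Proof.
move=> gD; split; apply: (unlink_homology_homotopic (k := 1)) => // i j w wC _;
by exists 0; rewrite ?mem0v // linear0 addr0 scale1r (cube_mul_succ gD wC).
Qed.

End Reordering.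

(** * Reidemeister moves *)

Section CircleOperators.

Variables (E : finType) (O : {set E}).
Implicit Types (s t : {perm E}) (c d : E * E) (D : seq (E * E)).
Implicit Types (A B : {set E}) (F G : edge_poly E) (a b e f g x y : E).

(* An element supported on a circle [O] is [w * P + x * Q] with [w] and [x] the
   images of v+ and v-.  [circle_unit] sends the merge of [O] with another
   circle to its [P]-part, and [circle_trace a k] keeps [Q] and sets [P] to
   [k * x_a * Q]. *)
Definition circle_unit F : edge_poly E :=
  [ffun A : {set E} => if #|A :&: O| == 1%N then F (A :\: O) else 0].

Definition circle_trace a (k : rat) F : edge_poly E :=
  [ffun A : {set E} => if #|A :&: O| == 0%N then F A
                       else if #|A :&: O| == 1%N then k * mulx a F (A :\: O)
                       else 0].

Fact circle_unit_is_linear : linear circle_unit.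
Proof.
move=> k F G; apply/ffunP => A; rewrite !ffunE.
by case: ifP; rewrite ?scaler0 ?addr0.
Qed.

HB.instance Definition _ :=
  GRing.isLinear.Build rat (edge_poly E) (edge_poly E) _ circle_unit
    circle_unit_is_linear.

Fact circle_trace_is_linear a k : linear (circle_trace a k).
Proof.
move=> l F G; apply/ffunP => A; rewrite !ffunE; case: ifP => // _.
case: ifP => _; last by rewrite scaler0 addr0.
case: ifP => _; first by rewrite mulr0 scaler0 addr0.
by rewrite mulrDr; congr (_ + _); rewrite mulrCA.
Qed.

HB.instance Definition _ a k :=
  GRing.isLinear.Build rat (edge_poly E) (edge_poly E) _ (circle_trace a k)
    (circle_trace_is_linear a k).

(** An element constant on [O] vanishes in the third case, so identities between such elements are
    checked in the first two. *)
Variant circle_spec A : Prop :=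
| CircleNone of A :&: O = set0
| CircleOne x B of x \in O & B :&: O = set0 & A = x |: B
| CircleMany x y B of x \in O & y \in O & x \notin B & y \in B & A = x |: B.

Lemma circleP A : circle_spec A.
Proof.
case: (set_0Vmem (A :&: O)) => [h|[x]]; first by constructor.
rewrite inE => /andP[xA xO]; pose B := A :\ x.
have eA : A = x |: B by rewrite setD1K.
case: (set_0Vmem (B :&: O)) => [h|[y]]; first exact: CircleOne eA.
rewrite inE => /andP[yB yO]; apply: (CircleMany xO yO _ yB eA).
by rewrite !inE eqxx.
Qed.

Lemma circle1_notin x B : x \in O -> B :&: O = set0 -> x \notin B.
Proof.
by move=> xO B0; apply/negP => xB; have := in_set0 x; rewrite -B0 inE xB xO.
Qed.

Lemma circle1I x B : x \in O -> B :&: O = set0 -> (x |: B) :&: O = [set x].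
Proof.
move=> xO B0; rewrite setIUl B0 setU0; apply/setIidPl.
by rewrite sub1set.
Qed.

Lemma circle0D B : B :&: O = set0 -> B :\: O = B.
Proof. by move=> B0; apply/setDidPl; rewrite -setI_eq0 B0. Qed.

Lemma circle1D x B : x \in O -> B :&: O = set0 -> (x |: B) :\: O = B.
Proof.
move=> xO B0; rewrite setDUl (circle0D B0).
have -> : [set x] :\: O = set0 by apply/eqP; rewrite setD_eq0 sub1set.
by rewrite set0U.
Qed.

Lemma circle2_card x y B : x \in O -> y \in O -> x \notin B -> y \in B ->
  (1 < #|(x |: B) :&: O|)%N.
Proof.
move=> xO yO xB yB; apply: (@leq_trans #|[set x; y]|).
  by rewrite cards2; case: eqP xB => // ->; rewrite yB.
by apply: subset_leq_card; apply/subsetP => z; rewrite !inE => /orP[]/eqP ->;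
  rewrite ?eqxx ?yB ?xO ?yO ?orbT.
Qed.

Lemma circle_unit0 F A : A :&: O = set0 -> circle_unit F A = 0.
Proof. by move=> A0; rewrite ffunE A0 cards0. Qed.

Lemma circle_unit1 F x B : x \in O -> B :&: O = set0 -> circle_unit F (x |: B) = F B.
Proof. by move=> xO B0; rewrite ffunE circle1I // cards1 eqxx circle1D. Qed.

Lemma circle_unit2 F x y B : x \in O -> y \in O -> x \notin B -> y \in B ->
  circle_unit F (x |: B) = 0.
Proof.
move=> xO yO xB yB; rewrite ffunE; have := circle2_card xO yO xB yB.
by case: #|_| => [|[|]].
Qed.

Lemma circle_trace0 a k F A : A :&: O = set0 -> circle_trace a k F A = F A.
Proof. by move=> A0; rewrite ffunE A0 cards0. Qed.

Lemma circle_trace1 a k F x B : x \in O -> B :&: O = set0 ->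
  circle_trace a k F (x |: B) = k * mulx a F B.
Proof. by move=> xO B0; rewrite ffunE circle1I // cards1 circle1D. Qed.

Lemma circle_trace2 a k F x y B : x \in O -> y \in O -> x \notin B -> y \in B ->
  circle_trace a k F (x |: B) = 0.
Proof.
move=> xO yO xB yB; rewrite ffunE; have := circle2_card xO yO xB yB.
by case: #|_| => [|[|]].
Qed.

Definition circle_constant F := forall x y, x \in O -> y \in O -> mulx x F = mulx y F.

Lemma circle_constantE F x y B : circle_constant F -> x \in O -> y \in O ->
  B :&: O = set0 -> F (x |: B) = F (y |: B).
Proof.
move=> cF xO yO B0; have /ffunP/(_ B) := cF _ _ xO yO; rewrite !ffunE.
by rewrite !ifN ?(circle1_notin _ B0).
Qed.

Lemma circle_constant2 F x y B : circle_constant F -> x \in O -> y \in O ->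
  x \notin B -> y \in B -> F (x |: B) = 0.
Proof.
move=> cF xO yO xB yB; have /ffunP/(_ B) := cF _ _ xO yO; rewrite !ffunE.
by rewrite ifN // yB.
Qed.

Lemma circle_constantI F :
  (forall x y B, x \in O -> y \in O -> B :&: O = set0 -> F (x |: B) = F (y |: B)) ->
  (forall x y B, x \in O -> y \in O -> x \notin B -> y \in B -> F (x |: B) = 0) ->
  circle_constant F.
Proof.
move=> F1 F2.
have aux x y B : x \in O -> y \in O -> x \notin B -> y \in B -> mulx x F B = mulx y F B.
  by move=> xO yO xB yB; rewrite !ffunE (negPf xB) yB; apply: (F2 _ y).
move=> x y xO yO; apply/ffunP => B.
have [xB|xB] := boolP (x \in B); have [yB|yB] := boolP (y \in B).
- by rewrite !ffunE xB yB.
- by rewrite (aux y x).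
- exact: aux.
rewrite !ffunE (negPf xB) (negPf yB); case: (set_0Vmem (B :&: O)) => [B0|[z]].
  exact: F1.
rewrite inE => /andP[zB zO].
by rewrite (F2 x z) // (F2 y z).
Qed.

Lemma circle_unit_constant F : circle_constant (circle_unit F).
Proof.
apply: circle_constantI => [x y B xO yO B0|x y B xO yO]; last exact: circle_unit2.
by rewrite !circle_unit1.
Qed.

Lemma circle_trace_constant a k F : circle_constant (circle_trace a k F).
Proof.
apply: circle_constantI => [x y B xO yO B0|x y B xO yO]; last exact: circle_trace2.
by rewrite !circle_trace1.
Qed.

Lemma circle_ext F G : circle_constant F -> circle_constant G ->
  (forall B, B :&: O = set0 -> F B = G B) ->
  (forall x B, x \in O -> B :&: O = set0 -> F (x |: B) = G (x |: B)) -> F = G.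
Proof.
move=> cF cG e0 e1; apply/ffunP => A.
case: (circleP A) => [/e0 //|x B xO B0 ->|x y B xO yO xB yB ->]; first exact: e1.
by rewrite (circle_constant2 cF xO yO) // (circle_constant2 cG xO yO).
Qed.

Lemma circle_constantD F G :
  circle_constant F -> circle_constant G -> circle_constant (F + G).
Proof. by move=> cF cG x y xO yO; rewrite !linearD /= (cF x y) // (cG x y). Qed.

Lemma circle_constant_mulx g F : circle_constant F -> circle_constant (mulx g F).
Proof. by move=> cF x y xO yO; rewrite !(mulxC _ g) (cF x y). Qed.

Lemma setIU1_out g A : g \notin O -> (g |: A) :&: O = A :&: O.
Proof.
move=> gO; have g0 : [set g] :&: O = set0 by apply/eqP; rewrite setI_eq0 disjoints1.
by rewrite setIUl g0 set0U.
Qed.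

Lemma setDU1_out g A : g \notin O -> (g |: A) :\: O = g |: (A :\: O).
Proof.
by move=> gO; rewrite setDUl; congr (_ :|: _); apply/setDidPl; rewrite disjoints1.
Qed.

Lemma mulx_circle_unit g F : g \notin O ->
  mulx g (circle_unit F) = circle_unit (mulx g F).
Proof.
move=> gO; apply/ffunP => A; rewrite !ffunE setIU1_out // setDU1_out // inE gO /=.
by case: ifP; case: ifP.
Qed.

Lemma mulx_circle_trace a k g F : g \notin O ->
  mulx g (circle_trace a k F) = circle_trace a k (mulx g F).
Proof.
move=> gO; apply/ffunP => A; rewrite 2!ffunE [in RHS]ffunE mulxC.
rewrite setIU1_out // setDU1_out // [mulx g F A]ffunE.
rewrite [mulx g (mulx a F) _]ffunE inE gO /=.
by case: (g \in A); do 2?case: ifP => //; rewrite ?mulr0.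
Qed.

Section Merge.

Variables (t : {perm E}) (a e : E).
Hypotheses (eO : e \in O) (aO : a \notin O) (tO : porbit t e = O).
Let c := (a, e).
Let s := toggle c t.

Lemma porbit_circle x : x \in O -> porbit t x = O.
Proof. by move=> xO; apply/eqP; rewrite -[X in _ == X]tO eq_porbit_mem tO. Qed.

Lemma circle_neq : a != e.
Proof. by apply: contraNneq aO => ->. Qed.

Lemma circle_notin_porbit : a \in porbit t e = false.
Proof. by rewrite tO (negPf aO). Qed.

Lemma merge_porbit : a \in porbit s e.
Proof. by rewrite (porbit_toggle_neq (c := c) t circle_neq) /= circle_notin_porbit. Qed.

Lemma circular_constant F : circular t F -> circle_constant F.
Proof.
move=> cF x y xO yO; apply: circular_porbit cF _.
by rewrite porbit_circle.
Qed.

Lemma circular_merge F : circular s F -> circular t F /\ mulx a F = mulx e F.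
Proof.
move=> cF; have eF := circular_porbit cF merge_porbit; split=> //.
by rewrite -(toggleK c t); apply: circular_toggle.
Qed.

Lemma circular_outside (L : edge_poly E -> edge_poly E) F :
  (forall g F, g \notin O -> mulx g (L F) = L (mulx g F)) ->
  circle_constant (L F) -> circular t F -> circular t (L F).
Proof.
move=> LO cL cF x; have [xO|xO] := boolP (x \in O).
  by apply: cL => //; rewrite -tO porbit_step ?tO.
rewrite !LO ?cF //; apply: contra xO => txO.
by rewrite -(porbit_circle txO) porbit_sym porbit_step ?porbit_id.
Qed.

Lemma circular_circle_unit F : circular t F -> circular t (circle_unit F).
Proof.
apply: circular_outside => [g G gO|]; first exact: mulx_circle_unit.
exact: circle_unit_constant.
Qed.

Lemma circular_circle_trace b k F : circular t F -> circular t (circle_trace b k F).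
Proof.
apply: circular_outside => [g G gO|]; first exact: mulx_circle_trace.
exact: circle_trace_constant.
Qed.

Lemma mulx_circle0 x B F : x \in O -> B :&: O = set0 -> mulx x F B = F (x |: B).
Proof. by move=> xO B0; rewrite ffunE ifN ?(circle1_notin xO). Qed.

Lemma mulx_a_trace k F B : B :&: O = set0 ->
  mulx a (circle_trace a k F) B = mulx a F B.
Proof.
by move=> B0; rewrite !ffunE setIU1_out // B0 cards0.
Qed.

(** For factor 1 the operator is the counit on [O], which keeps the coefficient of v-, followed by
    the comultiplication of the circle of [a] into [O]. *)
Lemma circular_circle_merge F : circular t F -> circular s (circle_trace a 1 F).
Proof.
move=> cF; apply: circular_toggle; first exact: circular_circle_trace.
have cT := @circle_trace_constant a 1 F.
apply: circle_ext => [||B B0|x B xO B0].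
- exact: circle_constant_mulx.
- exact: circle_constant_mulx.
- by rewrite mulx_a_trace // (mulx_circle0 _ eO) // circle_trace1 // mul1r.
rewrite mulx_circle_trace // circle_trace1 // mulxx ffunE mulr0 /=.
by rewrite (cT e x) // ffunE setU11.
Qed.

(** Counit after comultiplication. *)
Lemma circle_traceK F : circular s F -> circle_trace a 1 F = F.
Proof.
move=> /circular_merge[cF eF]; have cO := circular_constant cF.
apply: circle_ext => [|//|B B0|x B xO B0].
- exact: circle_trace_constant.
- exact: circle_trace0.
by rewrite circle_trace1 // mul1r eF (mulx_circle0 _ eO) // (circle_constantE cO eO xO).
Qed.

(** Multiplication by the unit: a new circle labelled v+ is merged back. *)
Lemma circle_unitK F : circular s F ->
  mulx a (circle_unit F) + mulx e (circle_unit F) = F.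
Proof.
move=> /circular_merge[cF eF]; have cO := circular_constant cF.
have cU := @circle_unit_constant F.
apply: circle_ext => [|//|B B0|x B xO B0].
- by apply: circle_constantD; apply: circle_constant_mulx.
- rewrite ffunE mulx_circle_unit // circle_unit0 // add0r.
  by rewrite (mulx_circle0 _ eO) // circle_unit1.
rewrite ffunE mulx_circle_unit // circle_unit1 // (cU e x) // [mulx x _ _]ffunE.
by rewrite setU11 addr0 eF (mulx_circle0 _ eO) // (circle_constantE cO eO xO).
Qed.

(** Subtracting the trace removes the part with v- on [O]; what remains has v+ there, and merging
    followed by the unit reproduces it. *)
Lemma circle_decomposition b F : b \notin O -> circular t F ->
  let G := F - circle_trace b 1 F in
  circle_trace b 1 F + circle_unit (mulx a G + mulx e G) = F.
Proof.
move=> bO cF G; have cO := circular_constant cF.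
have cU := circle_unit_constant; have cT := circle_trace_constant.
have G0 B : B :&: O = set0 -> G B = 0.
  by move=> B0; rewrite !ffunE B0 cards0 eqxx subrr.
apply: circle_ext => [|//|B B0|x B xO B0].
- by apply: circle_constantD.
- by rewrite ffunE circle_trace0 // circle_unit0 // addr0.
have -> : (circle_trace b 1 F + circle_unit (mulx a G + mulx e G)) (x |: B)
    = mulx b F B + (mulx a G B + mulx e G B).
  by rewrite ffunE circle_trace1 // circle_unit1 // mul1r [(_ + _ : edge_poly E) B]ffunE.
have -> : mulx a G B = 0 by rewrite ffunE G0 ?if_same // setIU1_out.
have -> : mulx e G B = F (e |: B) - mulx b F B.
  rewrite (mulx_circle0 _ eO) // /G [LHS]ffunE; congr (_ + _).
  by rewrite [LHS]ffunE circle_trace1 // mul1r.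
by rewrite add0r addrC subrK (circle_constantE cO eO xO).
Qed.

Lemma circle_trace_unit b F : b \notin O -> circle_trace b 1 (circle_unit F) = 0.
Proof.
move=> bO; apply: circle_ext => [|//|B B0|x B xO B0].
- exact: circle_trace_constant.
- by move=> x y; rewrite !linear0.
- by rewrite circle_trace0 // circle_unit0 // ffunE.
by rewrite circle_trace1 // mulx_circle_unit // circle_unit0 // mulr0 ffunE.
Qed.

(** The factor -1 turns Q into x Q - w x_a Q, which the merge kills. Such elements and the image of
    the unit together split the merge. *)
Lemma circle_kernel F : circular t F ->
  circle_trace a (-1) (circle_trace a 1 F)
  + circle_unit (mulx a F + mulx e F) = F.
Proof.
move=> cF; have cO := circular_constant cF.
have cU := circle_unit_constant; have cT := circle_trace_constant.
apply: circle_ext => [|//|B B0|x B xO B0].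
- by apply: circle_constantD.
- by rewrite ffunE !circle_trace0 // circle_unit0 // addr0.
rewrite ffunE circle_trace1 // circle_unit1 // mulN1r mulx_a_trace //.
rewrite [(_ + _ : edge_poly E) B]ffunE addKr.
by rewrite (mulx_circle0 _ eO) // (circle_constantE cO eO xO).
Qed.

Lemma circle_kernelK F : circular s F ->
  circle_trace a 1 (circle_trace a (-1) F) = F.
Proof.
move=> /circular_merge[cF eF]; have cO := circular_constant cF.
apply: circle_ext => [|//|B B0|x B xO B0].
- exact: circle_trace_constant.
- by rewrite !circle_trace0.
rewrite circle_trace1 // mul1r mulx_a_trace // eF (mulx_circle0 _ eO) //.
by rewrite (circle_constantE cO eO xO).
Qed.

Lemma circle_kernel_merge F : circular s F ->
  mulx a (circle_trace a (-1) F) + mulx e (circle_trace a (-1) F) = 0.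
Proof.
move=> /circular_merge[cF eF]; have cO := circular_constant cF.
have cT := circle_trace_constant.
apply: circle_ext => [||B B0|x B xO B0].
- by apply: circle_constantD; apply: circle_constant_mulx.
- by move=> x y; rewrite !linear0.
- rewrite [LHS]ffunE [RHS]ffunE mulx_a_trace // (mulx_circle0 _ eO) // circle_trace1 //.
  by rewrite mulN1r subrr.
rewrite [LHS]ffunE [RHS]ffunE mulx_circle_trace // circle_trace1 // mulxx ffunE mulr0 add0r.
by rewrite (cT _ _ _ e x) // ffunE setU11.
Qed.

Lemma porbits_merge : #|porbits t|%:Z = #|porbits s|%:Z + 1.
Proof.
have := porbits_toggle (c := c) t circle_neq; rewrite /= circle_notin_porbit -/s.
by move->; rewrite subrK.
Qed.

Lemma poly_degree_circle_unit j F :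
  poly_degree s j F -> poly_degree t (j + 1) (circle_unit F).
Proof.
move=> dF A; rewrite porbits_merge; case: (circleP A) => [A0|x B xO B0 ->|x y B xO yO xB yB ->].
- by rewrite circle_unit0 ?eqxx.
- by rewrite circle_unit1 // => /dF; rewrite cardsU1 (circle1_notin xO B0) /=; lia.
- by rewrite (circle_unit2 _ xO yO) ?eqxx.
Qed.

Lemma circle_trace_support k F A : circle_trace a k F A != 0 ->
  exists2 B, F B != 0 & #|B| = #|A|.
Proof.
case: (circleP A) => [A0|x B xO B0 ->|x y B xO yO xB yB ->].
- by rewrite circle_trace0 //; exists A.
- rewrite circle_trace1 // mulf_eq0 negb_or ffunE => /andP[_].
  case: ifPn => [_|aB]; first by rewrite eqxx.
  by exists (a |: B); rewrite // !cardsU1 aB (circle1_notin xO B0).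
- by rewrite (circle_trace2 _ _ _ xO yO) ?eqxx.
Qed.

Lemma poly_degree_circle_trace j k F :
  poly_degree t j F -> poly_degree s (j + 1) (circle_trace a k F).
Proof.
by move=> dF A /circle_trace_support[B /dF <- ->]; rewrite porbits_merge; lia.
Qed.

Lemma poly_degree_circle_trace' j k F :
  poly_degree s j F -> poly_degree t (j - 1) (circle_trace a k F).
Proof.
by move=> dF A /circle_trace_support[B /dF <- ->]; rewrite porbits_merge; lia.
Qed.

Lemma saddle_split F : saddle t c F = mulx a F + mulx e F.
Proof. by rewrite /saddle /= circle_notin_porbit. Qed.

(** Hence a saddle away from [O] is a split in both states or a merge in both, and commutes with
    operators that act on [O] only. *)
Lemma merge_porbit_out x y : x \notin O -> y \notin O ->
  (x \in porbit s y) = (x \in porbit t y).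
Proof.
have outO u v : u \notin O -> v \notin O -> touches t c u -> touches t c v -> u \in porbit t v.
  rewrite /touches /= tO => uO vO; rewrite (negPf uO) (negPf vO) !orbF => ua.
  by rewrite porbit_sym => av; apply: porbit_trans ua av.
move=> xO yO; apply/idP/idP.
  by case/porbit_toggle/orP => // /andP[]; apply: outO.
rewrite -{1}(toggleK c t) => /porbit_toggle /orP[//|/andP[]].
have touch_a u : touches s c u -> u \in porbit s a.
  by case/orP => // /porbit_trans; apply; rewrite porbit_sym merge_porbit.
move=> /touch_a xa /touch_a ya; apply: porbit_trans xa _.
by rewrite porbit_sym.
Qed.

End Merge.

End CircleOperators.

Section ReidemeisterMoves.

Variable E : finType.
Implicit Types (s t : {perm E}) (c d : E * E) (D : seq (E * E)) (O : {set E}).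
Implicit Types (F G : edge_poly E) (a b e f g h x y : E) (i j : int).

Lemma lift_comp (L L' : edge_poly E -> edge_poly E) D (w : cube D) :
  lift (fun F => L (L' F)) w = lift L (lift L' w).
Proof. by elim: D w => //= c D IH w; rewrite !IH. Qed.

Lemma liftD (L L' : edge_poly E -> edge_poly E) D (w : cube D) :
  lift (fun F => L F + L' F) w = lift L w + lift L' w.
Proof. by elim: D w => //= c D IH w; rewrite !IH. Qed.

Lemma liftB (L L' : edge_poly E -> edge_poly E) D (w : cube D) :
  lift (fun F => L F - L' F) w = lift L w - lift L' w.
Proof. by elim: D w => //= c D IH w; rewrite !IH. Qed.

Lemma lift_id D (w : cube D) : lift id w = w.
Proof. by elim: D w => //= c D IH [w0 w1]; rewrite !IH. Qed.

Lemma lift_eq (L L' : edge_poly E -> edge_poly E) (P : pred (E * E))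
    (C : {perm E} -> Prop) t D i j (w : cube D) :
  (forall c t, P c -> C t -> C (toggle c t)) ->
  (forall t F, C t -> circular t F -> L F = L' F) ->
  all P D -> C t -> w \in chains t D i j -> lift L w = lift L' w.
Proof.
move=> CP eL; elim: D t i j w => [|c D IH] t i j w.
  move=> _ Ct; rewrite memv_chains_nil; case: ifP => _ Cw.
    by case/state_spaceP: Cw => cw _; apply: (eL t).
  by rewrite (eqP Cw); apply: (eL t) => // x; rewrite !linear0.
case/andP => Pc PD Ct; rewrite memv_chains_cons => /andP[w0 w1] /=.
by congr (_, _); [apply: IH w0 | apply: IH w1 => //; apply: CP].
Qed.

Definition outside O c := (c.1 \notin O) && (c.2 \notin O).

Lemma toggle_circle O e c t : outside O c -> porbit t e = O -> porbit (toggle c t) e = O.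
Proof.
case/andP => c1 c2 tO; have nt : ~~ touches t c e.
  by rewrite /touches !(porbit_sym _ e) tO negb_or c1.
apply/setP => x; apply/idP/idP => [/porbit_toggle|].
  by rewrite (negPf nt) andbF orbF tO.
by rewrite -{1}tO => xe; apply: porbit_toggle_out.
Qed.

Section Circle.

Variables (O : {set E}) (e : E).
Hypothesis eO : e \in O.

Section Merge.

Variables (a : E) (D : seq (E * E)) (t : {perm E}).
Hypotheses (aO : a \notin O) (tO : porbit t e = O).
Hypothesis D_outside : all (outside O) D.
Hypothesis D_disjoint : all (disjoint_chords (a, e)) D.

Let c := (a, e).
Let s := toggle c t.
Let P d := outside O d && disjoint_chords c d.
Let Q u v := porbit v e = O /\ u = toggle c v.

Let PD : all P D.
Proof. by apply/allP => d dD; apply/andP; split; [apply: (allP D_outside)|apply: (allP D_disjoint)]. Qed.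

Let Q_toggle d u v : P d -> Q u v -> Q (toggle d u) (toggle d v).
Proof.
case/andP => dO cd [vO ->]; split; first exact: toggle_circle.
by rewrite (toggle_commute _ cd).
Qed.

Let Q_toggle' d u v : P d -> Q v u -> Q (toggle d v) (toggle d u).
Proof. exact: Q_toggle. Qed.

Let Qst : Q s t. Proof. by []. Qed.

Let saddle_out u v (L : edge_poly E -> edge_poly E) d F :
  (forall g F, g \notin O -> mulx g (L F) = L (mulx g F)) ->
  (forall F G, L (F + G) = L F + L G) ->
  P d -> porbit v e = O -> (u = toggle c v) ->
  (saddle u d (L F) = L (saddle v d F)) /\ (saddle v d (L F) = L (saddle u d F)).
Proof.
move=> LO LD /andP[/andP[d1 d2] _] vO ->; rewrite /saddle.
rewrite (merge_porbit_out eO aO vO d1 d2).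
by case: ifP => _; rewrite // !LO // -LD.
Qed.

Lemma cube_circle_unit_chains i j (w : cube D) :
  w \in chains s D i j -> lift (circle_unit O) w \in chains t D i (j + 1).
Proof.
apply: (lift_chains Q_toggle) PD Qst => u v k F [vO ->] /state_spaceP[cF dF].
have [cF' _] := circular_merge eO aO vO cF.
apply/state_spaceP; split; first exact: (circular_circle_unit vO).
exact: (poly_degree_circle_unit eO aO vO).
Qed.

Lemma cube_circle_trace_chains i j (w : cube D) :
  w \in chains t D i j -> lift (circle_trace O a 1) w \in chains s D i (j + 1).
Proof.
apply: (@lift_chains _ _ P (fun v u => Q u v)) => //.
  by move=> v u k F [vO ->] /state_spaceP[cF dF]; apply/state_spaceP; split;
    [apply: (circular_circle_merge eO aO vO) | apply: (poly_degree_circle_trace eO aO vO)].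
Qed.

Lemma cube_circle_kernel_chains i j (w : cube D) :
  w \in chains s D i j -> lift (circle_trace O a (-1)) w \in chains t D i (j - 1).
Proof.
apply: (lift_chains Q_toggle) PD Qst => u v k F [vO ->] /state_spaceP[cF dF].
have [cF' _] := circular_merge eO aO vO cF.
apply/state_spaceP; split; first exact: (circular_circle_trace vO).
exact: (poly_degree_circle_trace' eO aO vO).
Qed.

Lemma dif_circle_unit (w : cube D) :
  dif t (lift (circle_unit O) w) = lift (circle_unit O) (dif s w).
Proof.
apply: (dif_lift Q_toggle) PD Qst => d u v F Pd [vO eu].
by have [] := saddle_out F (@mulx_circle_unit E O) (linearD _) Pd vO eu.
Qed.

Lemma dif_circle_trace k (w : cube D) :
  dif s (lift (circle_trace O a k) w) = lift (circle_trace O a k) (dif t w).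
Proof.
apply: (@dif_lift _ _ P (fun v u => Q u v)) => //.
move=> d v u F Pd [vO eu].
by have [] := saddle_out F (@mulx_circle_trace E O a k) (linearD _) Pd vO eu.
Qed.

Lemma dif_circle_trace' k (w : cube D) :
  dif t (lift (circle_trace O a k) w) = lift (circle_trace O a k) (dif s w).
Proof.
apply: (dif_lift Q_toggle) PD Qst => d u v F Pd [vO eu].
by have [] := saddle_out F (@mulx_circle_trace E O a k) (linearD _) Pd vO eu.
Qed.

Let C v := porbit v e = O.
Let C_toggle d v : P d -> C v -> C (toggle d v).
Proof. by case/andP => dO _; apply: toggle_circle. Qed.

Let C' v := exists u, C u /\ v = toggle c u.
Let C'_toggle d v : P d -> C' v -> C' (toggle d v).
Proof.
move=> Pd [u [Cu ->]]; exists (toggle d u); split; first exact: C_toggle.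
by case/andP: Pd => _ cd; rewrite (toggle_commute _ cd).
Qed.
Let C's : C' s. Proof. by exists t. Qed.

Lemma cube_saddle_merge (w : cube D) : cube_saddle s c w = w.
Proof.
have aux D' u (v : cube D') : all P D' -> C' u -> cube_saddle u c v = v.
  elim: D' u v => [|d D' IH] u v.
    by move=> _ [x [xO ->]]; rewrite /= /saddle (merge_porbit eO aO xO).
  case/andP => Pd PD' Cu; case: v => v0 v1 /=.
  by rewrite !IH //; apply: C'_toggle.
exact: aux PD C's.
Qed.

Lemma cube_saddle_split (w : cube D) : cube_saddle t c w = cube_mul a w + cube_mul e w.
Proof.
have aux D' u (v : cube D') : all P D' -> C u ->
    cube_saddle u c v = cube_mul a v + cube_mul e v.
  elim: D' u v => [|d D' IH] u v; first by move=> _ uO; apply: (saddle_split aO uO).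
  case/andP => Pd PD' Cu; rewrite /= !IH //.
  exact: C_toggle.
exact: aux PD tO.
Qed.

Lemma cube_circle_traceK i j (w : cube D) :
  w \in chains s D i j -> lift (circle_trace O a 1) w = w.
Proof.
move=> wC; rewrite -[RHS]lift_id; apply: (lift_eq C'_toggle) PD C's wC.
by move=> u F [v [vO ->]]; apply: (circle_traceK eO aO vO).
Qed.

Lemma cube_circle_unitK i j (w : cube D) : w \in chains s D i j ->
  cube_mul a (lift (circle_unit O) w) + cube_mul e (lift (circle_unit O) w) = w.
Proof.
move=> wC; rewrite -[RHS]lift_id /cube_mul -!lift_comp -liftD.
apply: (lift_eq C'_toggle) PD C's wC.
by move=> u F [v [vO ->]]; apply: (circle_unitK eO aO vO).
Qed.

Lemma cube_circle_kernel i j (w : cube D) : w \in chains t D i j ->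
  lift (circle_trace O a (-1)) (lift (circle_trace O a 1) w)
  + lift (circle_unit O) (cube_mul a w + cube_mul e w) = w.
Proof.
move=> wC; rewrite -[RHS]lift_id /cube_mul -liftD -!lift_comp -liftD.
apply: (lift_eq C_toggle) PD tO wC.
by move=> u F uO; apply: (circle_kernel eO aO uO).
Qed.

Lemma cube_circle_kernelK i j (w : cube D) : w \in chains s D i j ->
  lift (circle_trace O a 1) (lift (circle_trace O a (-1)) w) = w.
Proof.
move=> wC; rewrite -[RHS]lift_id -!lift_comp.
apply: (lift_eq C'_toggle) PD C's wC.
by move=> u F [v [vO ->]]; apply: (circle_kernelK eO aO vO).
Qed.

Lemma cube_circle_kernel_merge i j (w : cube D) : w \in chains s D i j ->
  cube_mul a (lift (circle_trace O a (-1)) w)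
  + cube_mul e (lift (circle_trace O a (-1)) w) = 0.
Proof.
move=> wC; have -> : 0 = lift (fun=> 0) w by elim: (D) w {wC} => //= d D' IH w; rewrite -!IH.
rewrite /cube_mul -!lift_comp -liftD.
apply: (lift_eq C'_toggle) PD C's wC.
by move=> u F [v [vO ->]]; apply: (circle_kernel_merge eO aO vO).
Qed.

Lemma cube_circle_decomposition b i j (w : cube D) : b \notin O ->
  w \in chains t D i j -> let v := w - lift (circle_trace O b 1) w in
  lift (circle_trace O b 1) w + lift (circle_unit O) (cube_mul a v + cube_mul e v) = w.
Proof.
move=> bO wC v; rewrite /v -[in RHS](lift_id w) -[in X in X - _](lift_id w).
rewrite -liftB /cube_mul -!lift_comp -liftD -lift_comp -liftD.
apply: (lift_eq C_toggle) PD tO wC.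
by move=> u F uO cF; apply: (circle_decomposition eO aO uO).
Qed.

Lemma cube_circle_trace_unit b (w : cube D) : b \notin O ->
  lift (circle_trace O b 1) (lift (circle_unit O) w) = 0.
Proof.
move=> bO; elim: (D) w => [|d D' IH] w /=; first exact: circle_trace_unit.
by rewrite !IH.
Qed.

End Merge.

End Circle.

Lemma cube_mul_lift L g D (w : cube D) :
  (forall F, mulx g (L F) = L (mulx g F)) -> cube_mul g (lift L w) = lift L (cube_mul g w).
Proof.
move=> LO; elim: D w => [|d D IH] w /=; first exact: LO.
by congr (_, _); apply: IH.
Qed.

Lemma sub_circle O (P : pred E) t e : porbit t e = O ->
  P e -> (forall x, P x -> P (t x)) -> forall x, ~~ P x -> x \notin O.
Proof. by move=> <- Pe Pt x; apply: contra; apply: porbit_ind. Qed.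

(* The chords of [D] and the marked points have to stay away from the circle of
   [e] that one of the smoothings creates; this is checked on an invariant set
   [P] that contains the circle. *)
Section Moves.

Variables (D : seq (E * E)) (g h : E) (i0 j0 : int) (P : pred E).
Hypotheses (gP : ~~ P g) (hP : ~~ P h) (DP : all (fun d => ~~ P d.1 && ~~ P d.2) D).

Let outD O : (forall x, ~~ P x -> x \notin O) -> all (outside O) D.
Proof.
move=> PO; apply: sub_all DP => d /andP[d1 d2].
by rewrite /outside !PO.
Qed.

(** Reidemeister I with an injective saddle: the 1-smoothing splits off the circle of [e], and the
    homology is the cokernel, represented by v+ on that circle. The cone contributes (1,1) to the
    shift and the label (0,1). *)
Lemma unlink_homology_split_kink s a e : wf_chords ((a, e) :: D) ->
  ~~ P a -> P e -> (forall x, P x -> P (toggle (a, e) s x)) ->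
  unlink_homology s D g h i0 j0 ->
  unlink_homology s ((a, e) :: D) g h (i0 + 1) (j0 + 2).
Proof.
case/and3P => _ dis wD aP eP PT; set c := (a, e) in dis PT *.
set t := toggle c s in PT; pose O := porbit t e.
have tO : porbit t e = O by [].
have PO := sub_circle tO eP PT.
have eO : e \in O by apply: porbit_id.
have aO := PO _ aP; have oD := outD PO.
have st : toggle c t = s by apply: toggleK.
pose T := fun w : cube D => (0, lift (circle_unit O) w) : cube (c :: D).
have lT : linear T.
  move=> k u v; congr (_, _); first by rewrite /= scaler0 addr0.
  exact: (linearP (@lift E (circle_unit O) D)).
pose L : {linear cube D -> cube (c :: D)} :=
  HB.pack T (GRing.isLinear.Build rat (cube D) (cube (c :: D)) _ T lT).
have T_mul x w : x \notin O -> T (cube_mul x w) = cube_mul x (T w).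
  move=> xO; rewrite /T /cube_mul /=; congr (_, _).
    by rewrite (linear0 (@lift E (mulx x) D)).
  by rewrite -/(cube_mul x (lift _ w)) cube_mul_lift // => F; apply: mulx_circle_unit.
have U_chains := cube_circle_unit_chains eO aO tO oD dis.
have U_dif := dif_circle_unit eO aO tO oD dis.
have r_chains := cube_circle_trace_chains eO aO tO oD dis.
have r_dif := dif_circle_trace eO aO tO oD dis.
have rK := cube_circle_traceK eO aO tO oD dis.
have UK := cube_circle_unitK eO aO tO oD dis.
have dec i j (w : cube D) := cube_circle_decomposition eO aO tO oD dis (i := i) (j := j) (w := w) aO.
have merge := cube_saddle_merge eO aO tO oD dis.
have split := cube_saddle_split aO tO oD dis.
rewrite -/c st in U_chains U_dif r_chains r_dif rK UK merge.
have wfc : wf_chords (c :: D).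
  by apply/and3P; split=> //; apply: contraNneq aO => /= ->.
have m_chains i j (w : cube D) : w \in chains t D i j ->
    cube_mul a w + cube_mul e w \in chains s D i (j - 1).
  move=> wC; rewrite -split -st; exact: cube_saddle_chains wC.
have m_dif i j (w : cube D) : w \in chains t D i j ->
    dif s (cube_mul a w + cube_mul e w) = cube_mul a (dif t w) + cube_mul e (dif t w).
  move=> wC; rewrite -!split -st; exact: dif_saddle wC.
have incl i j (w : cube D) : w \in chains s D i j -> w \in chains t D i (j - 1).
  by move=> wC; rewrite -[w]merge; apply: cube_saddle_chains.
have incl_dif i j (w : cube D) : w \in chains s D i j -> dif t w = dif s w.
  by move=> wC; rewrite -[in LHS](merge w) (dif_saddle wfc wC) merge.
have r_unit := cube_circle_trace_unit (O := O) (D := D) _ aO.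
have mulB (u v : cube D) : cube_mul a (u - v) + cube_mul e (u - v) =
    cube_mul a u + cube_mul e u - (cube_mul a v + cube_mul e v).
  rewrite !(linearB (@cube_mul E _ D)) /= opprD !addrA.
  by rewrite [LHS](ACl (1*3*2*4)%AC).
pose r := lift (circle_trace O a 1) (D := D).
apply: (unlink_homology_transport (T := L) (k := -1)) => //.
- move=> i j w wC; rewrite memv_chains_cons mem0v /= addrK -addrA.
  exact: U_chains.
- by move=> w; apply: T_mul; apply: PO.
- by move=> w; apply: T_mul; apply: PO.
- move=> i j w wC; rewrite scaleN1r; congr (_, _).
    by transitivity (0 : cube D); [apply: (linear0 (@dif E s D)) | apply/esym/oppr0].
  by rewrite -[LHS]/(cube_saddle s c 0 - dif t (lift (circle_unit O) w)) linear0 sub0r U_dif.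
- move=> i j [v0 v1]; rewrite memv_chains_cons => /andP[/= v0C v1C] [dv0 /eqP].
  rewrite subr_eq0 merge => /eqP dv1; rewrite -/t in dv1 v1C.
  have rvC : r v1 \in chains s D (i - 1) j.
    by have := r_chains _ _ _ v1C; rewrite subrK.
  have rvd : dif t (r v1) = v0.
    by rewrite (incl_dif _ _ _ rvC) r_dif -dv1 (rK _ _ _ v0C).
  have vC : v1 - r v1 \in chains t D (i - 1) (j - 1) by apply: rpredB (incl _ _ _ rvC).
  (* The boundary of ([r v1], 0) accounts for the first component; the remainder [v1 - r v1] has v+
     on the circle and is recovered from its merge. *)
  exists (cube_mul a (v1 - r v1) + cube_mul e (v1 - r v1)), (r v1, 0); split.
  + by have := m_chains _ _ _ vC; rewrite -addrA -opprD.
  + rewrite (m_dif _ _ _ vC) (linearB (@dif E t D)) /= rvd -dv1 subrr.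
    by rewrite !linear0 addr0.
  + by rewrite memv_chains_cons mem0v andbT.
  + congr (_, _); rewrite /= -/t.
      by rewrite add0r -(incl_dif _ _ _ rvC) rvd.
    by rewrite linear0 subr0 merge addrC (dec _ _ _ v1C).
- move=> i j w [u0 u1] wC dw; rewrite memv_chains_cons => /andP[/= u0C u1C].
  case=> du0; rewrite merge -/t => eu; rewrite -/t in u1C.
  have u1C' : u1 \in chains t D (i - 1) (j + 1) by rewrite addrK -addrA in u1C.
  have rC := r_chains _ _ _ u1C'; have rC' := incl _ _ _ rC; rewrite addrK in rC'.
  have vC : r u1 - u1 \in chains t D (i - 1) (j + 1) by apply: rpredB.
  exists (cube_mul a (r u1 - u1) + cube_mul e (r u1 - u1)).
    by have := m_chains _ _ _ vC; rewrite addrK.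
  have du1 : dif t u1 = u0 - lift (circle_unit O) w by rewrite eu opprB addrC subrK.
  rewrite (m_dif _ _ _ vC) (linearB (@dif E t D)) /= (incl_dif _ _ _ rC) r_dif du1.
  rewrite (linearB (@lift E (circle_trace O a 1) D)) /= r_unit subr0.
  by rewrite (rK _ _ _ u0C) opprB [u0 + _]addrC subrK (UK _ _ _ wC).
Qed.

(** Reidemeister I with a surjective saddle: here the 0-smoothing contains the circle of [e], and
    the homology is the kernel of the merge, parametrised by [circle_trace] with factor -1. *)
Lemma unlink_homology_merge_kink s a e : wf_chords ((a, e) :: D) ->
  ~~ P a -> P e -> (forall x, P x -> P (s x)) ->
  unlink_homology (toggle (a, e) s) D g h i0 j0 ->
  unlink_homology s ((a, e) :: D) g h i0 (j0 - 1).
Proof.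
move=> wf aP eP PT H; have /and3P[_ dis wD] := wf; move: wf H; set c := (a, e) in dis *.
set m := toggle c s => wf H; pose O := porbit s e.
have tO : porbit s e = O by [].
have PO := sub_circle tO eP PT.
have eO : e \in O by apply: porbit_id.
have aO := PO _ aP; have oD := outD PO.
pose K := lift (circle_trace O a (-1)) (D := D).
pose r := lift (circle_trace O a 1) (D := D).
pose U := lift (circle_unit O) (D := D).
pose T := fun w : cube D => (K w, 0) : cube (c :: D).
have lT : linear T.
  move=> k u v; congr (_, _); last by rewrite /= scaler0 addr0.
  exact: (linearP (@lift E (circle_trace O a (-1)) D)).
pose L : {linear cube D -> cube (c :: D)} :=
  HB.pack T (GRing.isLinear.Build rat (cube D) (cube (c :: D)) _ T lT).
have T_mul x w : x \notin O -> T (cube_mul x w) = cube_mul x (T w).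
  move=> xO; rewrite /T /cube_mul /=; congr (_, _); last first.
    by rewrite (linear0 (@lift E (mulx x) D)).
  by rewrite -/(cube_mul x (K w)) /K cube_mul_lift // => F; apply: mulx_circle_trace.
have U_chains := cube_circle_unit_chains eO aO tO oD dis.
have U_dif := dif_circle_unit eO aO tO oD dis.
have r_chains := cube_circle_trace_chains eO aO tO oD dis.
have r_dif := dif_circle_trace eO aO tO oD dis 1.
have K_chains := cube_circle_kernel_chains eO aO tO oD dis.
have K_dif := dif_circle_trace' eO aO tO oD dis (-1).
have UK := cube_circle_unitK eO aO tO oD dis.
have KK := cube_circle_kernelK eO aO tO oD dis.
have Kdec := cube_circle_kernel eO aO tO oD dis.
have Kmerge := cube_circle_kernel_merge eO aO tO oD dis.
have split := cube_saddle_split aO tO oD dis.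
rewrite -/c -/m in U_chains U_dif r_chains r_dif K_chains K_dif UK KK Kmerge.
rewrite -/c in split.
rewrite -[i0]addr0; apply: (unlink_homology_transport (T := L) (k := 1)) H => //.
- move=> i j w wC; rewrite memv_chains_cons mem0v andbT /= addr0.
  exact: K_chains.
- by move=> w; apply: T_mul; apply: PO.
- by move=> w; apply: T_mul; apply: PO.
- move=> i j w wC; rewrite scale1r; congr (_, _); first exact: K_dif.
  rewrite -[LHS]/(cube_saddle s c (K w) - dif m 0) linear0 subr0 split.
  exact: Kmerge wC.
- move=> i j [v0 v1]; rewrite memv_chains_cons => /andP[/= v0C v1C] [dv0 /eqP].
  rewrite subr_eq0 split => /eqP dv1; rewrite -/m in dv1 v1C.
  exists (r v0), (U v1, 0); split.
  + by rewrite subr0 opprK; apply: r_chains.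
  + by rewrite r_dif dv0 linear0.
  + rewrite memv_chains_cons mem0v andbT /=.
    by have := U_chains _ _ _ v1C; rewrite subrK.
  + congr (_, _).
      by rewrite /= U_dif -dv1 (Kdec _ _ _ v0C).
    by rewrite /= -/m linear0 subr0 split add0r (UK _ _ _ v1C).
- move=> i j w [u0 u1] wC dw; rewrite memv_chains_cons addr0 => /andP[/= u0C u1C].
  case=> eu _; exists (r u0); first by have := r_chains _ _ _ u0C; rewrite subrK.
  by rewrite r_dif -eu (KK _ _ _ wC).
Qed.

Lemma unlink_homology_bigon s a b e f : wf_chords [:: (a, f), (b, e) & D] ->
  ~~ P a -> ~~ P b -> P e -> (forall x, P x -> P (toggle (b, e) s x)) ->
  f \in porbit (toggle (b, e) s) e ->
  unlink_homology (toggle (a, f) s) D g h i0 j0 ->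
  unlink_homology s [:: (a, f), (b, e) & D] g h (i0 + 1) (j0 + 1).
Proof.
move=> wf aP bP eP PT fe H.
have /and3P[_ /andP[c12 dis1] /and3P[_ dis2 wD]] := wf.
move: wf H; set c1 := (a, f) in c12 dis1 *; set c2 := (b, e) in c12 dis2 PT fe *.
set t := toggle c2 s in PT fe *; set u := toggle c1 s => wf H.
pose v := toggle c1 t.
have st : toggle c2 t = s by apply: toggleK.
have vE : toggle c2 u = v by rewrite /v /t /u (toggle_commute _ c12).
have wf1 : wf_chords (c1 :: D) by case/and3P: wf => nf /andP[_ ?] /and3P[*]; apply/and3P.
have wf2 : wf_chords (c2 :: D) by case/and3P: wf => _ _.
pose O := porbit t e.
have tO : porbit t e = O by [].
have PO := sub_circle tO eP PT.
have eO : e \in O by apply: porbit_id.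
have tO' : porbit t f = O by apply: porbit_circle tO _ _.
have aO := PO _ aP; have bO := PO _ bP; have oD := outD PO.
pose U := lift (circle_unit O) (D := D).
pose r := lift (circle_trace O b 1) (D := D).
pose th := cube_saddle s c1 (D := D).
pose ps := cube_saddle u c2 (D := D).
have U_chains := cube_circle_unit_chains fe aO tO' oD dis1.
have U_dif := dif_circle_unit fe aO tO' oD dis1.
have UK := cube_circle_unitK fe aO tO' oD dis1.
have split := cube_saddle_split aO tO' oD dis1.
have dec i j (w : cube D) :=
  cube_circle_decomposition fe aO tO' oD dis1 (i := i) (j := j) (w := w) bO.
have r_chains := cube_circle_trace_chains eO bO tO oD dis2.
have r_dif := dif_circle_trace eO bO tO oD dis2 1.
have rK := cube_circle_traceK eO bO tO oD dis2.
have merge := cube_saddle_merge eO bO tO oD dis2.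
have rU := cube_circle_trace_unit (O := O) (D := D) _ bO.
rewrite -/c1 -/v in U_chains U_dif UK; rewrite -/c1 in split.
rewrite -/c2 st in r_chains r_dif rK merge.
have ps_th i j (w : cube D) : w \in chains s D i j -> ps (th w) = cube_saddle t c1 w.
  by move=> wC; rewrite /ps /th (cube_saddle_commute wf wC) merge.
have th_chains i j (w : cube D) : w \in chains s D i j -> th w \in chains u D i (j - 1).
  exact: cube_saddle_chains.
have ps_chains i j (w : cube D) : w \in chains u D i j -> ps w \in chains v D i (j - 1).
  by rewrite -vE; apply: cube_saddle_chains.
have th_dif i j (w : cube D) : w \in chains s D i j -> dif u (th w) = th (dif s w).
  exact: dif_saddle.
have ps_dif i j (w : cube D) : w \in chains u D i j -> dif v (ps w) = ps (dif u w).
  by rewrite -vE; apply: dif_saddle.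
(* The entry at 01 puts v+ on [O]; its merge into 11 cancels the saddle of [w] from 10 into 11. *)
pose T := fun w : cube D => ((0, U (ps w)), (w, 0)) : cube [:: c1, c2 & D].
have lT : linear T.
  move=> k x y; congr ((_, _), (_, _)); rewrite /= ?scaler0 ?addr0 //.
  rewrite /ps (linearP (@cube_saddle E u c2 D)).
  exact: (linearP (@lift E (circle_unit O) D)).
pose L : {linear cube D -> cube [:: c1, c2 & D]} :=
  HB.pack T (GRing.isLinear.Build rat (cube D) (cube [:: c1, c2 & D]) _ T lT).
have T_mul x w : x \notin O -> T (cube_mul x w) = cube_mul x (T w).
  move=> xO; rewrite /T /cube_mul /= !(linear0 (@lift E (mulx x) D)).
  congr ((_, _), (_, _)); rewrite -/(cube_mul x (U _)) -/(cube_mul x w).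
  rewrite /ps cube_saddle_mul /U cube_mul_lift // => F.
  exact: mulx_circle_unit.
apply: (unlink_homology_transport (T := L) (k := -1)) H => //.
- move=> i j w wC; rewrite !memv_chains_cons !mem0v andbT /= !addrK wC andbT.
  by have := U_chains _ _ _ (ps_chains _ _ _ wC); rewrite subrK.
- by move=> w; apply: T_mul; apply: PO.
- by move=> w; apply: T_mul; apply: PO.
- move=> i j w wC; rewrite scaleN1r; congr ((_, _), (_, _)).
  + by transitivity (0 : cube D); [apply: (linear0 (@dif E s D)) | apply/esym/oppr0].
  + rewrite -[LHS]/(cube_saddle s c2 0 - dif t (U (ps w))) linear0 sub0r U_dif.
    by rewrite (ps_dif _ _ _ wC).
  + by rewrite -[LHS]/(cube_saddle s c1 0 - dif u w) linear0 sub0r.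
  + rewrite -[LHS]/(cube_saddle t c1 (U (ps w)) - (ps w - dif _ 0)) linear0 subr0.
    rewrite split (UK _ _ _ (ps_chains _ _ _ wC)) subrr.
    exact/esym/oppr0.
- move=> i j [[f00 f01] [f10 f11]]; rewrite !memv_chains_cons -/t -/u vE /=.
  case/andP => /andP[f00C f01C] /andP[f10C f11C].
  case=> d00 /eqP; rewrite subr_eq0 merge -/t => /eqP d01.
  move=> /eqP; rewrite subr_eq0 -/u -/th => /eqP d10.
  move=> /eqP; rewrite subr_eq0 -/t -/u vE split => /eqP d11.
  have rC : r f01 \in chains s D (i - 1) j.
    by have := r_chains _ _ _ f01C; rewrite subrK.
  have rd : dif s (r f01) = f00 by rewrite r_dif -d01 (rK _ _ _ f00C).
  have thC := th_chains _ _ _ rC.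
  (* Subtracting this boundary clears the states 00 and 11: the differential of [r f01] is [f00],
     and [U f11] merges to [f11]. *)
  exists (f10 - th (r f01)), ((r f01, U f11), (0, 0)); split.
  + exact: rpredB.
  + by rewrite (linearB (@dif E u D)) /= (th_dif _ _ _ rC) rd -d10 subrr.
  + rewrite -vE; change ((((r f01, U f11), (0, 0)) : cube [:: c1, c2 & D]) \in chains s [:: c1, c2 & D] (i - 1) j).
    rewrite !memv_chains_cons -/t -/u vE !mem0v !andbT rC /=.
    by have := U_chains _ _ _ f11C; rewrite subrK.
  + congr ((_, _), (_, _)).
    * by rewrite -[RHS]/(0 + dif s (r f01)) add0r rd.
    * rewrite -[RHS]/(U (ps (f10 - th (r f01)))
        + (cube_saddle s c2 (r f01) - dif t (U f11))) merge U_dif.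
      have -> : dif v f11 = ps f10 - cube_saddle t c1 f01.
        by rewrite split d11 opprB addrC subrK.
      rewrite -[in LHS](dec _ _ _ f01C) -split (linearB (@cube_saddle E t c1 D)) /=.
      rewrite [ps (f10 - _)](linearB (@cube_saddle E u c2 D)) /= -/ps (ps_th _ _ _ rC).
      rewrite -/(U _) /U !(linearB (@lift E (circle_unit O) D)) /= -/U opprB !addrA.
      by rewrite [RHS](ACl (3*4*2*1*5)%AC) /= addrK.
    * rewrite -[RHS]/(f10 - th (r f01) + (th (r f01) - dif u 0)).
      by rewrite linear0 subr0 subrK.
    * rewrite -[RHS]/(0 + (cube_saddle t c1 (U f11)
        - (cube_saddle u c2 0 - dif v 0))).
      by rewrite !linear0 !addr0 !linear0 addr0 add0r split (UK _ _ _ f11C).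
- move=> i j w [[u00 u01] [u10 u11]] wC dw; rewrite !memv_chains_cons -/t -/u vE.
  case/andP => /andP[/= u00C u01C] /andP[u10C _].
  rewrite /L /= /T => -[/= _ e01 e10 _]; rewrite -/t merge in e01.
  rewrite !addrK in u01C u10C.
  have rC := r_chains _ _ _ u01C.
  exists (th (r u01) - u10).
    by apply: rpredB => //; have := th_chains _ _ _ rC; rewrite addrK.
  rewrite (linearB (@dif E u D)) /= (th_dif _ _ _ rC) r_dif.
  have -> : dif t u01 = u00 - U (ps w) by rewrite e01 opprB addrC subrK.
  rewrite (linearB (@lift E (circle_trace O b 1) D)) /= rU subr0.
  by rewrite (rK _ _ _ u00C) e10.
Qed.

End Moves.

End ReidemeisterMoves.

(** * The state with exactly two circles *)

Section TwoCircles.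

Variables (E : finType) (s : {perm E}) (g h : E).
Hypothesis two_circles : forall x, (x \in porbit s g) (+) (x \in porbit s h).
Let O := porbit s g.
Let O' := porbit s h.
Implicit Types (A B : {set E}) (F : edge_poly E).

Let gO : g \in O. Proof. exact: porbit_id. Qed.
Let hO' : h \in O'. Proof. exact: porbit_id. Qed.
Let O'E x : (x \in O') = (x \notin O).
Proof. by have := two_circles x; rewrite -/O -/O'; case: (x \in O); case: (x \in O'). Qed.

Let gO' : g \notin O'. Proof. by rewrite O'E gO. Qed.
Let hO : h \notin O. Proof. by rewrite -O'E. Qed.

Let split_empty A : A :&: O = set0 -> A :&: O' = set0 -> A = set0.
Proof.
move=> /setP A0 /setP A1; apply/setP => x; have := A0 x; have := A1 x.
by rewrite !inE O'E; case: (x \in A); case: (x \in O).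
Qed.

(** A nonzero value has at most one mark on each circle, and the mark can be moved along it to [g]
    or [h]. *)
Lemma circular2_eq0 F : circular s F ->
  F set0 = 0 -> F [set g] = 0 -> F [set h] = 0 -> F [set g; h] = 0 -> F = 0.
Proof.
move=> cF F0 Fg Fh Fgh; apply/ffunP => A; rewrite [RHS]ffunE.
have cO : circle_constant O F by apply: (circular_constant (erefl O)).
have cO' : circle_constant O' F by apply: (circular_constant (erefl O')).
case: (circleP O A) => [A0|x B xO B0 ->|x y B xO yO xB yB ->]; last first.
- exact: (circle_constant2 cO xO yO).
- rewrite (circle_constantE cO xO gO B0).
  case: (circleP O' B) => [B1|y C yO C0 eB|y z C yO zO yC zC eB].
  + by rewrite (split_empty B0 B1) setU0.
  + have C1 : C :&: O = set0.
      by apply/eqP; rewrite -subset0 -B0 eB setSI // subsetUr.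
    have gC0 : (g |: C) :&: O' = set0 by rewrite setIU1_out.
    rewrite eB setUCA (circle_constantE cO' yO hO' gC0).
    by rewrite (split_empty C1 C0) setU0 setUC.
  + rewrite eB setUCA (circle_constant2 cO' yO zO) // !inE ?zC ?orbT //.
    by rewrite negb_or yC andbT; apply: contraNneq gO' => <-.
- case: (circleP O' A) => [A1|y C yO C0 eA|y z C yO zO yC zC ->].
  + by rewrite (split_empty A0 A1).
  + have C1 : C :&: O = set0.
      by apply/eqP; rewrite -subset0 -A0 eA setSI // subsetUr.
    by rewrite eA (circle_constantE cO' yO hO') // (split_empty C1 C0) setU0.
  + exact: (circle_constant2 cO' yO zO).
Qed.

(** The label v+ on both circles, hence exactly one mark on each. *)
Definition circle_product : edge_poly E :=
  [ffun A : {set E} => ((#|A :&: O| == 1%N) && (#|A :&: O'| == 1%N))%:R].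

Let card_add x A (P : {set E}) : x \in P -> x \notin A ->
  #|(x |: A) :&: P| = #|A :&: P|.+1.
Proof.
move=> xP xA; rewrite setIUl (setIidPl _) ?sub1set // cardsU1 inE (negPf xA).
by rewrite add1n.
Qed.

Let mulx_productE x A : x \in O ->
  mulx x circle_product A = ((#|A :&: O| == 0%N) && (#|A :&: O'| == 1%N))%:R.
Proof.
move=> xO; rewrite !ffunE; case: ifPn => [xA|xA].
  by rewrite cards_eq0; case: eqP => // /setP/(_ x); rewrite !inE xA xO.
by rewrite (card_add xO xA) setIU1_out ?O'E ?xO.
Qed.

Let mulx_productE' x A : x \in O' ->
  mulx x circle_product A = ((#|A :&: O| == 1%N) && (#|A :&: O'| == 0%N))%:R.
Proof.
move=> xO; rewrite !ffunE; case: ifPn => [xA|xA].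
  by rewrite andbC cards_eq0; case: eqP => // /setP/(_ x); rewrite !inE xA xO.
by rewrite (card_add xO xA) setIU1_out // -O'E.
Qed.

Lemma circular_product : circular s circle_product.
Proof.
move=> x; have sx (P : {set E}) y : P = porbit s y -> x \in P -> s x \in P.
  by move=> ->; apply: porbit_step.
apply/ffunP => A; have [xO|] := boolP (x \in O).
  by rewrite !mulx_productE // (sx O g).
by rewrite -O'E => xO; rewrite !mulx_productE' // (sx O' h).
Qed.

Lemma porbits_two_circles : #|porbits s| = 2%N.
Proof.
have -> : porbits s = [set O; O'].
  apply/setP => P; rewrite !inE; apply/imsetP/orP => [[x _ ->]|[] /eqP ->].
  - rewrite !eq_porbit_mem -/O -/O' O'E.
    by case: (x \in O); [left|right].
  - by exists g.
  - by exists h.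
by rewrite cards2; case: eqP => // eO; move: hO; rewrite eO hO'.
Qed.

Let card_split A : #|A| = (#|A :&: O| + #|A :&: O'|)%N.
Proof.
rewrite -(cardsID O A); congr (_ + _)%N; apply: eq_card => x.
by rewrite !inE O'E andbC.
Qed.

Lemma unlink_homology_two_circles : unlink_homology s [::] g h 0 2.
Proof.
pose z := circle_product.
have zE : [/\ z [set g; h] = 1, z set0 = 0, z [set g] = 0 & z [set h] = 0].
  have Ig : [set g] :&: O = [set g] by apply/setIidPl; rewrite sub1set.
  have Ih : [set h] :&: O' = [set h] by apply/setIidPl; rewrite sub1set.
  have Ig' : [set g] :&: O' = set0 by apply/eqP; rewrite setI_eq0 disjoints1.
  have Ih' : [set h] :&: O = set0 by apply/eqP; rewrite setI_eq0 disjoints1.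
  rewrite /z !ffunE !setIUl !Ig !Ih !Ig' !Ih' !set0I ?setU0 ?set0U.
  by rewrite !cards1 !cards0.
case: zE => zgh z0 zg zh.
have ngh : g != h by apply: contraNneq hO => <-.
have nhg : h != g by rewrite eq_sym.
have zC : z \in chains s [::] 0 2.
  rewrite memv_chains_nil eqxx; apply/state_spaceP; split.
    exact: circular_product.
  move=> A; have cA := card_split A; rewrite ffunE porbits_two_circles cA.
  have [->|_] := eqVneq #|A :&: O| 1%N; last by rewrite eqxx.
  by have [->|_] := eqVneq #|A :&: O'| 1%N; last by rewrite eqxx.
have cz : circular s z by apply: circular_product.
clearbody z; exists z; first by [].
split=> [i j w|u _]; last first.
  move=> /= /ffunP/(_ set0); rewrite !ffunE !inE (negPf nhg) setU0 => /eqP.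
  by rewrite setUC zgh eq_sym oner_eq0.
rewrite memv_chains_nil; case: eqP => [-> wC _|_ /eqP -> _]; last first.
  exists 0, 0, 0, 0, 0; first by rewrite mem0v.
  by split; [rewrite !scale0r !addr0 | rewrite !eqxx].
have /state_spaceP[cw dw] := wC.
(* Multiplying by x_g takes away the mark on the circle of [g], so x_g z is detected at [[set h]],
   and x_h z at [[set g]]. *)
exists (w [set g; h]), (w [set h]), (w [set g]), (w set0), 0; first by rewrite mem0v.
split; last first.
  by split=> /dw; rewrite porbits_two_circles ?cards2 ?ngh ?cards1 ?cards0 => <-.
apply/eqP; rewrite addr0 -subr_eq0; apply/eqP; apply: circular2_eq0.
- have cN (c : rat) F : circular s F -> circular s (c *: F).
    by move=> cF x; rewrite (linearZZ (mulx (s x))) (linearZZ (mulx x)) /= cF.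
  rewrite -scaleN1r; apply: circularD => //; apply: (cN _).
  by do !apply: circularD; apply: (cN _) => //; do ?apply: circular_mulx.
all: rewrite !ffunE !inE ?(negPf ngh) ?(negPf nhg) ?eqxx ?setU0 /=.
all: have zgh' : z [set h; g] = 1 by rewrite setUC.
all: rewrite ?zgh ?zgh' ?z0 ?zg ?zh !scaler0 ?addr0 ?add0r.
all: by rewrite -[_ *: _]/(_ * _) mulr1 subrr.
Qed.

End TwoCircles.

(** * Removing a crossing whose other smoothing is an unlink *)

Section FiberDimension.

Variables (K : fieldType) (V1 V2 : vectType K).

Definition pair_zero (y : V2) : (V1 * V2)%type := (0, y).

Fact pair_zero_is_linear : linear pair_zero.
Proof. by move=> k x y; congr (_, _); rewrite /= scaler0 addr0. Qed.

HB.instance Definition _ :=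
  GRing.isLinear.Build K V2 (V1 * V2)%type _ pair_zero pair_zero_is_linear.

Lemma dim_fibers (W : {vspace (V1 * V2)%type}) (U1 : {vspace V1}) (U2 : {vspace V2}) :
  (forall x, x \in U1 <-> exists y, (x, y) \in W) ->
  (forall y, (y \in U2) = ((0, y) \in W)) ->
  \dim W = (\dim U1 + \dim U2)%N.
Proof.
move=> U1W U2W; rewrite -(limg_ker_dim (linfun fst) W) addnC; congr (_ + _)%N.
  congr (\dim _); apply/vspaceP => x; apply/memv_imgP/idP.
    by case=> -[x' y] xyW ->; rewrite lfunE /=; apply/U1W; exists y.
  by case/U1W => y xyW; exists (x, y); rewrite ?lfunE.
have -> : (W :&: lker (linfun fst))%VS = (linfun pair_zero @: U2)%VS.
  apply/vspaceP => -[x y]; rewrite memv_cap memv_ker lfunE /=; apply/andP/memv_imgP.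
    by case=> xyW /eqP x0; rewrite x0 in xyW *; exists y; rewrite ?lfunE ?U2W.
  by case=> y' y'U; rewrite lfunE /= => -[-> ->]; rewrite -U2W y'U.
apply: limg_dim_eq; apply/eqP; rewrite -subv0; apply/subvP => y.
by rewrite memv_cap memv_ker lfunE memv0 => /andP[_ /eqP[->]].
Qed.

Lemma dim_addv_line (v : V1) (U : {vspace V1}) :
  v \notin U -> \dim (<[v]> + U)%VS = (\dim U).+1.
Proof.
move=> vU; have v0 : v != 0 by apply: contraNneq vU => ->; rewrite mem0v.
rewrite dimv_disjoint_sum ?dim_vline ?v0 //.
apply/eqP; rewrite -subv0; apply/subvP => x; rewrite memv_cap => /andP[/vlineP[k ->]].
have [->|k0] := eqVneq k 0; first by rewrite scale0r => _; apply: mem0v.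
by rewrite rpredZeq (negPf k0) (negPf vU).
Qed.

End FiberDimension.

(** * Betti numbers of the cone of a saddle *)

Section Betti.

Variable E : finType.
Implicit Types (s t : {perm E}) (c d : E * E) (D : seq (E * E)) (g h : E).
Implicit Types (i j : int).

Definition cycle_space s D i j : {vspace cube D} :=
  (chains s D i j :&: lker (linfun (@dif E s D)))%VS.

Definition boundary_space s D i j : {vspace cube D} :=
  (linfun (@dif E s D) @: chains s D (i - 1) j)%VS.

Definition betti s D i j : int :=
  (\dim (cycle_space s D i j))%:Z - (\dim (boundary_space s D i j))%:Z.

Lemma cycle_spaceP s D i j (w : cube D) :
  reflect (w \in chains s D i j /\ dif s w = 0) (w \in cycle_space s D i j).
Proof.
rewrite memv_cap memv_ker lfunE /=.
by apply: (iffP andP) => -[-> /eqP ->].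
Qed.

Lemma boundary_spaceP s D i j (w : cube D) :
  reflect (exists2 u, u \in chains s D (i - 1) j & w = dif s u)
    (w \in boundary_space s D i j).
Proof.
apply: (iffP memv_imgP) => -[u uC ->]; exists u => //; by rewrite lfunE.
Qed.

Lemma dim_boundary s D i j :
  (\dim (boundary_space s D i j))%:Z
  = (\dim (chains s D (i - 1) j))%:Z - (\dim (cycle_space s D (i - 1) j))%:Z.
Proof.
have := limg_ker_dim (linfun (@dif E s D)) (chains s D (i - 1) j).
rewrite -/(cycle_space s D (i - 1) j) -/(boundary_space s D i j) => <-.
by rewrite PoszD addrAC subrr add0r.
Qed.

Lemma boundary_cycle s D i j : wf_chords D ->
  (boundary_space s D i j <= cycle_space s D i j)%VS.
Proof.
move=> wD; apply/subvP => w /boundary_spaceP[u uC ->]; apply/cycle_spaceP.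
split; last exact: dif_dif uC.
by rewrite -[i](subrK 1); apply: dif_chains.
Qed.

Section Cone.

Variables (s : {perm E}) (c : E * E) (D : seq (E * E)).
Hypothesis wf : wf_chords (c :: D).
Let t := toggle c s.
Let phi := @cube_saddle E s c D.
Let psi := @cube_saddle E t c D.

Let wD : wf_chords D. Proof. by case/and3P: wf. Qed.

(** The cycles representing the kernel of the saddle on homology. *)
Definition saddle_kernel i j : {vspace cube D} :=
  (cycle_space s D i j :&: (linfun (@cube_saddle E s c D) @^-1: boundary_space t D i (j - 1)))%VS.

Lemma saddle_kernelP i j (w : cube D) :
  reflect (w \in cycle_space s D i j /\ phi w \in boundary_space t D i (j - 1))
    (w \in saddle_kernel i j).
Proof.
have -> : (w \in saddle_kernel i j) =
    (w \in cycle_space s D i j) && (phi w \in boundary_space t D i (j - 1)).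
  by rewrite [LHS]memv_cap -memv_preim lfunE.
exact: andP.
Qed.

Lemma boundary_saddle_kernel i j : (boundary_space s D i j <= saddle_kernel i j)%VS.
Proof.
apply/subvP => w wB; apply/saddle_kernelP; split.
  exact: (subvP (boundary_cycle s i j wD)).
case/boundary_spaceP: wB => u uC ->; apply/boundary_spaceP; exists (phi u).
  exact: cube_saddle_chains.
by rewrite (dif_saddle wf uC).
Qed.

Lemma dim_chains_cons i j :
  \dim (chains s (c :: D) i j) =
  (\dim (chains s D i j) + \dim (chains t D (i - 1) (j - 1)))%N.
Proof.
apply: dim_fibers => [x|y]; last by rewrite memv_chains_cons mem0v.
split=> [xC|[y]]; last by rewrite memv_chains_cons => /andP[].
by exists 0; rewrite memv_chains_cons xC mem0v.
Qed.

Lemma dim_cycle_cons i j :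
  \dim (cycle_space s (c :: D) i j) =
  (\dim (saddle_kernel i j) + \dim (cycle_space t D (i - 1) (j - 1)))%N.
Proof.
apply: dim_fibers => [x|y].
  split=> [/saddle_kernelP[/cycle_spaceP[xC dx] /boundary_spaceP[y yC e]]|[y]].
    exists y; apply/(@cycle_spaceP s (c :: D) i j (x, y)); rewrite memv_chains_cons xC yC; split=> //.
    by congr (_, _) => //=; rewrite -/phi -/t e subrr.
  case/(@cycle_spaceP s (c :: D) i j (x, y)); rewrite memv_chains_cons => /andP[/= xC yC] [dx /eqP].
  rewrite subr_eq0 => /eqP e; apply/saddle_kernelP; split; first exact/cycle_spaceP.
  by apply/boundary_spaceP; exists y.
apply/idP/idP => [/cycle_spaceP[yC dy]|/(@cycle_spaceP s (c :: D) i j (0, y))[]].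
  apply/(@cycle_spaceP s (c :: D) i j (0, y)); rewrite memv_chains_cons mem0v yC; split=> //.
  congr (_, _); first exact: (linear0 (@dif E s D)).
  by rewrite -[LHS]/(cube_saddle s c 0 - dif t y) dy linear0 oppr0 addr0.
rewrite memv_chains_cons => /andP[_ /= yC] [_] /eqP.
by rewrite linear0 sub0r oppr_eq0 => /eqP dy; apply/cycle_spaceP.
Qed.

(** The dimension count of the long exact sequence of the cone: the kernel of the saddle in height
    [i] and its cokernel in height [i - 1], whose rank is the last bracket. *)
Lemma betti_cons i j :
  betti s (c :: D) i j =
  betti t D (i - 1) (j - 1)
  + ((\dim (saddle_kernel i j))%:Z - (\dim (boundary_space s D i j))%:Z)
  - ((\dim (cycle_space s D (i - 1) j))%:Z - (\dim (saddle_kernel (i - 1) j))%:Z).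
Proof.
rewrite /betti !dim_boundary dim_cycle_cons dim_chains_cons dim_cycle_cons !PoszD.
by ring.
Qed.

End Cone.

Lemma boundary_mul s D e i j (w : cube D) :
  w \in boundary_space s D i j -> cube_mul e w \in boundary_space s D i (j - 2).
Proof.
case/boundary_spaceP => u uC ->; apply/boundary_spaceP; exists (cube_mul e u).
  exact: cube_mul_chains.
by rewrite dif_mul.
Qed.

Lemma cycle_mul s D e i j (w : cube D) :
  w \in cycle_space s D i j -> cube_mul e w \in cycle_space s D i (j - 2).
Proof.
case/cycle_spaceP => wC dw; apply/cycle_spaceP.
by rewrite dif_mul dw linear0; split=> //; apply: cube_mul_chains.
Qed.

Lemma cycle_saddle s c D i j (w : cube D) : wf_chords (c :: D) ->
  w \in cycle_space s D i j -> cube_saddle s c w \in cycle_space (toggle c s) D i (j - 1).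
Proof.
move=> wf /cycle_spaceP[wC dw]; apply/cycle_spaceP.
by rewrite (dif_saddle wf wC) dw linear0; split=> //; apply: cube_saddle_chains.
Qed.

Lemma boundary_saddle s c D i j (w : cube D) : wf_chords (c :: D) ->
  w \in boundary_space s D i j ->
  cube_saddle s c w \in boundary_space (toggle c s) D i (j - 1).
Proof.
move=> wf /boundary_spaceP[u uC ->]; apply/boundary_spaceP; exists (cube_saddle s c u).
  exact: cube_saddle_chains.
by rewrite (dif_saddle wf uC).
Qed.

Lemma dim_add_line (K : fieldType) (W : vectType K) (v : W) (U U' : {vspace W}) :
  v \notin U -> v \in U' -> (U <= U')%VS ->
  (forall w, w \in U' -> exists k, w - k *: v \in U) -> \dim U' = (\dim U).+1.
Proof.
move=> vU vU' UU' H; rewrite -(dim_addv_line vU); congr (\dim _).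
apply/eqP; rewrite eqEsubv subv_add UU' -memvE vU' /= andbT.
apply/subvP => w /H[k wU]; rewrite -(subrK (k *: v) w) addrC.
by apply: memv_add => //; apply: memvZ; apply: memv_line.
Qed.

(** [unlink_homology] in terms of the subspaces of cycles and boundaries, with the generator
    exposed. *)
Definition generates s D g h i0 j0 (z : cube D) :=
  [/\ z \in cycle_space s D i0 j0,
      cube_mul g (cube_mul h z) \notin boundary_space s D i0 (j0 - 4) &
      forall i j w, w \in cycle_space s D i j ->
      exists k0 k1 k2 k3 : rat, exists2 u, u \in boundary_space s D i j &
        w = k0 *: z + k1 *: cube_mul g z + k2 *: cube_mul h z
            + k3 *: cube_mul g (cube_mul h z) + u /\
        [/\ (k0 != 0 -> i = i0 /\ j = j0),
            (k1 != 0 -> i = i0 /\ j = j0 - 2),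
            (k2 != 0 -> i = i0 /\ j = j0 - 2)
          & (k3 != 0 -> i = i0 /\ j = j0 - 4)]].

Lemma unlink_homology_generates s D g h i0 j0 :
  unlink_homology s D g h i0 j0 -> exists z, @generates s D g h i0 j0 z.
Proof.
case=> z [zC dz] [gen nb]; exists z; split; first exact/cycle_spaceP.
  by apply/negP => /boundary_spaceP[u uC e]; apply: (nb u uC).
move=> i j w /cycle_spaceP[wC dw].
have [k0 [k1 [k2 [k3 [u uC [-> H]]]]]] := gen _ _ _ wC dw.
by exists k0, k1, k2, k3, (dif s u) => //; apply/boundary_spaceP; exists u.
Qed.

Section UnlinkCone.

Variables (c : E * E) (D : seq (E * E)) (g h : E) (i0 j0 : int).
Hypothesis wf : wf_chords (c :: D).
Let wD : wf_chords D. Proof. by case/and3P: wf. Qed.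

Section Source.

Variables (s : {perm E}) (z : cube D).
Let t := toggle c s.
Let phi := @cube_saddle E s c D.
Let psi := @cube_saddle E t c D.
Hypothesis gen : generates s g h i0 j0 z.
Hypothesis gh : forall i j w, w \in chains t D i j -> cube_mul g w = cube_mul h w.
Hypothesis cgh : forall i j w, w \in chains s D i j ->
  cube_mul c.1 w + cube_mul c.2 w = cube_mul g w + cube_mul h w.

Let zC : z \in chains s D i0 j0. Proof. by case: gen => /cycle_spaceP[]. Qed.
Let zZ : z \in cycle_space s D i0 j0. Proof. by case: gen. Qed.
Let nB : cube_mul g (cube_mul h z) \notin boundary_space s D i0 (j0 - 4).
Proof. by case: gen. Qed.
Let j024 : j0 - 2 - 2 = j0 - 4. Proof. by rewrite -addrA -opprD. Qed.
Let xxZ : cube_mul g (cube_mul h z) \in cycle_space s D i0 (j0 - 4).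
Proof. by rewrite -j024; do 2!apply: cycle_mul. Qed.

Let psi_phi i j w : w \in chains s D i j -> psi (phi w) = cube_mul g w + cube_mul h w.
Proof.
move=> wC; have /and3P[nc dc _] := wf.
by rewrite -(cgh wC); apply: cube_saddleK.
Qed.

Let not0 : z \notin saddle_kernel s c D i0 j0.
Proof.
apply: contra nB => /saddle_kernelP[_ /(boundary_saddle wf)].
rewrite toggleK -/t -/psi (psi_phi zC) => /(boundary_mul g).
by rewrite linearD /= cube_mulxx add0r -!addrA -!opprD.
Qed.

Let not1 : cube_mul h z \notin saddle_kernel s c D i0 (j0 - 2).
Proof.
apply: contra nB => /saddle_kernelP[_ /(boundary_saddle wf)].
rewrite toggleK -/t -/psi (psi_phi (cube_mul_chains h zC)) cube_mulxx addr0.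
by rewrite -!addrA -!opprD.
Qed.

Let not2 : cube_mul g z - cube_mul h z \notin boundary_space s D i0 (j0 - 2).
Proof.
apply: contra nB => /(boundary_mul h).
by rewrite (linearB (@cube_mul E h D)) /= cube_mulxx subr0 j024 cube_mulC.
Qed.

Let phi_gh : phi (cube_mul g z) = phi (cube_mul h z).
Proof. by rewrite /phi !cube_saddle_mul (gh (cube_saddle_chains wf zC)). Qed.

Let diffN : cube_mul g z - cube_mul h z \in saddle_kernel s c D i0 (j0 - 2).
Proof.
apply/saddle_kernelP; split; first by apply: rpredB; apply: cycle_mul.
by rewrite (linearB (@cube_saddle E s c D)) /= -/phi phi_gh subrr mem0v.
Qed.

Let xxN : cube_mul g (cube_mul h z) \in saddle_kernel s c D i0 (j0 - 4).
Proof.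
apply/saddle_kernelP; split=> //.
rewrite cube_saddle_mul -/phi -phi_gh /phi !cube_saddle_mul cube_mulxx.
exact: mem0v.
Qed.

Let BN i j : (boundary_space s D i j <= saddle_kernel s c D i j)%VS.
Proof. exact: boundary_saddle_kernel. Qed.

Let NZ i j : (saddle_kernel s c D i j <= cycle_space s D i j)%VS.
Proof. exact: capvSl. Qed.

Let j20 : (j0 - 2 == j0) = false. Proof. by clear; lia. Qed.
Let j40 : (j0 - 4 == j0) = false. Proof. by clear; lia. Qed.
Let j42 : (j0 - 4 == j0 - 2) = false. Proof. by clear; lia. Qed.
Let j24 : (j0 - 2 == j0 - 4) = false. Proof. by clear; lia. Qed.
Let j02 : (j0 == j0 - 2) = false. Proof. by clear; lia. Qed.
Let j04 : (j0 == j0 - 4) = false. Proof. by clear; lia. Qed.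

Let zero_coef (k : rat) (i i' j j' : int) :
  (k != 0 -> i = i' /\ j = j') -> ~~ ((i == i') && (j == j')) -> k = 0.
Proof. by move=> H n; apply: contraNeq n => /H[-> ->]; rewrite !eqxx. Qed.

(** As x_g and x_h agree on the target, the saddle kills (x_g - x_h) z and x_g x_h z. It kills
    neither z nor x_h z: the reverse saddle takes their images to (x_g + x_h) z and x_g x_h z, and
    x_g times the former is again x_g x_h z. *)
Lemma dim_saddle_kernel i j : \dim (saddle_kernel s c D i j) =
  (\dim (boundary_space s D i j)
   + nat_of_bool ((i == i0) && ((j == j0 - 2)%R || (j == j0 - 4)%R)))%N.
Proof.
have [_ _ gen'] := gen.
case: (boolP ((i == i0) && _)) => [/andP[/eqP -> /orP[]] /eqP ->|nij].
- rewrite addn1; apply: dim_add_line not2 diffN (BN _ _) _ => w wN.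
  have [k0 [k1 [k2 [k3 [u uB [ew [h0 h1 h2 h3]]]]]]] := gen' _ _ _ (subvP (NZ _ _) _ wN).
  exists k1; have ew' : w - k1 *: (cube_mul g z - cube_mul h z) =
      (k1 + k2) *: cube_mul h z + u.
    rewrite ew (zero_coef h0) ?eqxx ?j20 // (zero_coef h3) ?eqxx ?j24 //.
    rewrite !scale0r add0r addr0 scalerBr opprB addrA scalerDl.
    by rewrite [LHS](ACl (4*2*3*1*5)%AC) /= addrK.
  have kN : (k1 + k2) *: cube_mul h z \in saddle_kernel s c D i0 (j0 - 2).
    rewrite -(addrK u (_ *: _)) -ew'; apply: rpredB; last exact: (subvP (BN _ _)).
    by apply: rpredB => //; apply: memvZ.
  rewrite ew'; move: kN; rewrite rpredZeq (negPf not1) orbF => /eqP ->.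
  by rewrite scale0r add0r.
- rewrite addn1; apply: dim_add_line nB xxN (BN _ _) _ => w wN.
  have [k0 [k1 [k2 [k3 [u uB [ew [h0 h1 h2 h3]]]]]]] := gen' _ _ _ (subvP (NZ _ _) _ wN).
  exists k3; rewrite ew (zero_coef h0) ?eqxx ?j40 // (zero_coef h1) ?eqxx ?j42 //.
  rewrite (zero_coef h2) ?eqxx ?j42 // !scale0r !add0r.
  by rewrite addrC addKr.
- rewrite addn0; congr (\dim _); apply/eqP; rewrite eqEsubv BN andbT; apply/subvP => w wN.
  have [k0 [k1 [k2 [k3 [u uB [ew [h0 h1 h2 h3]]]]]]] := gen' _ _ _ (subvP (NZ _ _) _ wN).
  move: ew; rewrite (zero_coef h1) ?(zero_coef h2) ?(zero_coef h3);
    try by apply: contra nij => /andP[-> ->]; rewrite ?orbT.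
  rewrite !scale0r !addr0 => ew; rewrite ew; have [->|k0n] := eqVneq k0 0.
    by rewrite scale0r add0r.
  have [ei ej] := h0 k0n; move: uB wN; rewrite ei ej => uB wN.
  have : k0 *: z \in saddle_kernel s c D i0 j0.
    by rewrite -(addrK u (k0 *: z)) -ew; apply: rpredB => //; apply: (subvP (BN _ _)).
  by rewrite rpredZeq (negPf k0n) (negPf not0).
Qed.

(** This is the rank of the saddle on homology, carried by the classes of z and x_h z. *)
Lemma dim_cycle_kernel i j : \dim (cycle_space s D i j) =
  (\dim (saddle_kernel s c D i j)
   + nat_of_bool ((i == i0) && ((j == j0)%R || (j == j0 - 2)%R)))%N.
Proof.
have [_ _ gen'] := gen.
case: (boolP ((i == i0) && _)) => [/andP[/eqP -> /orP[]] /eqP ->|nij].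
- rewrite addn1; apply: dim_add_line not0 zZ (NZ _ _) _ => w wZ.
  have [k0 [k1 [k2 [k3 [u uB [ew [h0 h1 h2 h3]]]]]]] := gen' _ _ _ wZ.
  exists k0; rewrite ew (zero_coef h1) ?eqxx ?j02 // (zero_coef h2) ?eqxx ?j02 //.
  rewrite (zero_coef h3) ?eqxx ?j04 // !scale0r !addr0.
  by rewrite addrC addKr; apply: (subvP (BN _ _)).
- rewrite addn1; apply: dim_add_line not1 _ (NZ _ _) _ => [|w wZ]; first exact: cycle_mul.
  have [k0 [k1 [k2 [k3 [u uB [ew [h0 h1 h2 h3]]]]]]] := gen' _ _ _ wZ.
  exists (k1 + k2); have -> : w - (k1 + k2) *: cube_mul h z =
      k1 *: (cube_mul g z - cube_mul h z) + u.
    rewrite ew (zero_coef h0) ?eqxx ?j20 // (zero_coef h3) ?eqxx ?j24 //.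
    rewrite !scale0r add0r addr0 scalerBr scalerDl opprD !addrA.
    by rewrite [LHS](ACl (1*4*3*2*5)%AC) /= addrK.
  by apply: rpredD; [apply: memvZ | apply: (subvP (BN _ _))].
- rewrite addn0; congr (\dim _); apply/eqP; rewrite eqEsubv NZ andbT; apply/subvP => w wZ.
  have [k0 [k1 [k2 [k3 [u uB [-> [h0 h1 h2 h3]]]]]]] := gen' _ _ _ wZ.
  rewrite (zero_coef h1) ?(zero_coef h2) ?(zero_coef h0);
    try by apply: contra nij => /andP[-> ->]; rewrite ?orbT.
  rewrite !scale0r !add0r; apply: rpredD; last exact: (subvP (BN _ _)).
  have [->|k3n] := eqVneq k3 0; first by rewrite scale0r mem0v.
  by have [-> ->] := h3 k3n; apply: memvZ.
Qed.

Lemma betti_unlink_source i j :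
  betti s (c :: D) i j = betti t D (i - 1) (j - 1)
  + (nat_of_bool ((i == i0) && ((j == j0 - 2) || (j == j0 - 4))))%:Z
  - (nat_of_bool ((i == i0 + 1) && ((j == j0) || (j == j0 - 2))))%:Z.
Proof.
rewrite betti_cons // dim_cycle_kernel dim_saddle_kernel -/t !PoszD.
have -> : (i == i0 + 1) = (i - 1 == i0) by rewrite subr_eq.
set x := (\dim _)%:Z; set y := (\dim _)%:Z; set n1 := (nat_of_bool _)%:Z.
set n2 := (nat_of_bool _)%:Z.
by ring.
Qed.

End Source.

Section Target.

Variables (s : {perm E}) (z : cube D).
Let t := toggle c s.
Let phi := @cube_saddle E s c D.
Let psi := @cube_saddle E t c D.
Hypothesis gen : generates t g h i0 j0 z.
Hypothesis gh : forall i j w, w \in chains s D i j -> cube_mul g w = cube_mul h w.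
Hypothesis cgh : forall i j w, w \in chains t D i j ->
  cube_mul c.1 w + cube_mul c.2 w = cube_mul g w + cube_mul h w.

Let zC : z \in chains t D i0 j0. Proof. by case: gen => /cycle_spaceP[]. Qed.
Let zZ : z \in cycle_space t D i0 j0. Proof. by case: gen. Qed.
Let nB : cube_mul g (cube_mul h z) \notin boundary_space t D i0 (j0 - 4).
Proof. by case: gen. Qed.

Let phi_psi i j w : w \in chains t D i j -> phi (psi w) = cube_mul g w + cube_mul h w.
Proof.
move=> wC; have /and3P[nc dc _] := wf; rewrite -(cgh wC) /phi -(toggleK c s).
exact: cube_saddleK.
Qed.

Let psi_cycle i j w : w \in cycle_space t D i j -> psi w \in cycle_space s D i (j - 1).
Proof. by move/(cycle_saddle wf); rewrite toggleK. Qed.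

Let phi_gh i j w : w \in chains s D i j -> cube_mul g (phi w) = cube_mul h (phi w).
Proof. by move=> wC; rewrite /phi -!cube_saddle_mul (gh wC). Qed.

Let NZ i j : (saddle_kernel s c D i j <= cycle_space s D i j)%VS.
Proof. exact: capvSl. Qed.

Let coef0 (k : rat) (i i' j j' : int) :
  (k != 0 -> i = i' /\ j = j') -> ~~ ((i == i') && (j == j')) -> k = 0.
Proof. by move=> H n; apply: contraNeq n => /H[-> ->]; rewrite !eqxx. Qed.

(** The image of the saddle is killed by x_g - x_h, hence spanned at most by (x_g + x_h) z and x_g
    x_h z. Both occur, as images of the reverse saddles of z and x_h z, so the rank is two here as
    well. *)
Lemma dim_cycle_target i j : \dim (cycle_space s D i j) =
  (\dim (saddle_kernel s c D i j)
   + nat_of_bool ((i == i0) && ((j == j0 - 1)%R || (j == j0 - 3)%R)))%N.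
Proof.
have [_ _ gen'] := gen.
have j2 : j0 - 1 - 1 = j0 - 2 by clear; lia.
have j4 : j0 - 3 - 1 = j0 - 4 by clear; lia.
have j22 : j0 - 2 - 2 = j0 - 4 by clear; lia.
have n20 : (j0 - 2 == j0) = false by clear; lia.
have n40 : (j0 - 4 == j0) = false by clear; lia.
have n24 : (j0 - 2 == j0 - 4) = false by clear; lia.
have n42 : (j0 - 4 == j0 - 2) = false by clear; lia.
case: (boolP ((i == i0) && _)) => [/andP[/eqP -> /orP[]] /eqP ->|nij].
- rewrite addn1; apply: (dim_add_line (v := psi z)) (NZ _ _) _.
  + apply: contra nB => /saddle_kernelP[_]; rewrite -/phi (phi_psi zC) -/t j2.
    move/(boundary_mul h); rewrite linearD /= cube_mulxx addr0 j22.
    by rewrite cube_mulC.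
  + exact: psi_cycle.
  move=> w wZ; have /cycle_spaceP[wC _] := wZ.
  have := cycle_saddle wf wZ; rewrite -/phi -/t j2 => /gen'.
  case=> k0 [k1 [k2 [k3 [u uB [ew [h0 h1 h2 h3]]]]]].
  exists k1; apply/saddle_kernelP; split.
    by apply: rpredB => //; apply: memvZ; apply: psi_cycle.
  rewrite (coef0 h0) ?n20 ?andbF // (coef0 h3) ?n24 ?andbF // in ew.
  rewrite !scale0r add0r addr0 in ew.
  (* Up to a boundary, x_g - x_h takes the image to (k2 - k1) x_g x_h z. *)
  have ek : k1 = k2.
    have := phi_gh wC; rewrite ew !linearD !linearZZ /= !cube_mulxx.
    rewrite !scaler0 add0r addr0 => e.
    have : (k1 - k2) *: cube_mul g (cube_mul h z) \in boundary_space t D i0 (j0 - 4).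
      rewrite scalerBl; have -> : k1 *: cube_mul g (cube_mul h z)
          - k2 *: cube_mul g (cube_mul h z) = cube_mul g u - cube_mul h u.
        rewrite [in k1 *: _]cube_mulC -[k1 *: _](addrK (cube_mul h u)) -e.
        by rewrite [LHS](ACl (2*3*1*4)%AC) /= addrK.
      by rewrite -j22; apply: rpredB; apply: boundary_mul.
    by rewrite rpredZeq (negPf nB) orbF subr_eq0 => /eqP.
  rewrite (linearB (@cube_saddle E s c D)) (linearZZ (@cube_saddle E s c D)) /=.
  rewrite -/phi -/t (phi_psi zC) ew -ek j2 scalerDr addrC addKr.
  exact: uB.
- rewrite addn1; have hC := cube_mul_chains h zC.
  have hZ := cycle_mul h zZ; have j3 : j0 - 2 - 1 = j0 - 3 by clear; lia.
  apply: (dim_add_line (v := psi (cube_mul h z))) (NZ _ _) _.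
  + apply: contra nB => /saddle_kernelP[_]; rewrite -/phi (phi_psi hC) -/t j4.
    by rewrite cube_mulxx addr0.
  + by have := psi_cycle hZ; rewrite j3.
  move=> w wZ; have /cycle_spaceP[wC _] := wZ.
  have := cycle_saddle wf wZ; rewrite -/phi -/t j4 => /gen'.
  case=> k0 [k1 [k2 [k3 [u uB [ew [h0 h1 h2 h3]]]]]].
  exists k3; apply/saddle_kernelP; split.
    by apply: rpredB => //; apply: memvZ; rewrite -j3; apply: psi_cycle.
  rewrite (coef0 h0) ?n40 ?andbF // (coef0 h1) ?n42 ?andbF // (coef0 h2) ?n42 ?andbF // in ew.
  rewrite !scale0r !add0r in ew.
  rewrite (linearB (@cube_saddle E s c D)) (linearZZ (@cube_saddle E s c D)) /=.
  by rewrite -/phi -/t (phi_psi hC) ew cube_mulxx addr0 addrC addKr j4.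
rewrite addn0; congr (\dim _); apply/eqP; rewrite eqEsubv NZ andbT; apply/subvP => w wZ.
apply/saddle_kernelP; split=> //; have /cycle_spaceP[wC _] := wZ.
have := cycle_saddle wf wZ; rewrite -/phi -/t => /gen'.
case=> k0 [k1 [k2 [k3 [u uB [ew [h0 h1 h2 h3]]]]]].
have nj : ~~ ((i == i0) && ((j - 1 == j0 - 2) || (j - 1 == j0 - 4))).
  apply: contra nij => /andP[-> H]; apply/orP; case/orP: H => /eqP e; [left|right];
  by apply/eqP; move: e; clear; lia.
have nj2 : ~~ ((i == i0) && (j - 1 == j0 - 2)).
  by apply: contra nj => /andP[-> ->].
have nj4 : ~~ ((i == i0) && (j - 1 == j0 - 4)).
  by apply: contra nj => /andP[-> ->]; rewrite orbT.
rewrite (coef0 h1 nj2) (coef0 h2 nj2) (coef0 h3 nj4) !scale0r !addr0 in ew.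
(* A term in z would survive: x_h (x_g - x_h) z = x_g x_h z is not a boundary. *)
suff k00 : k0 = 0 by rewrite ew k00 scale0r add0r.
apply: contraNeq nB => k0n; have [ei ej] := h0 k0n; rewrite ei ej in uB.
have := phi_gh wC; rewrite ew !linearD !linearZZ /= => e.
have : k0 *: cube_mul g (cube_mul h z) \in boundary_space t D i0 (j0 - 4).
  have -> : k0 *: cube_mul g (cube_mul h z) = cube_mul h (cube_mul h u - cube_mul g u).
    rewrite (linearB (@cube_mul E h D)) /= cube_mulxx sub0r.
    have := congr1 (@cube_mul E h D) e; rewrite !linearD !linearZZ /= !cube_mulxx.
    rewrite scaler0 add0r => /eqP; rewrite addr_eq0 => /eqP <-.
    by rewrite cube_mulC.
  by rewrite -j22; apply: boundary_mul; apply: rpredB; apply: boundary_mul.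
by rewrite rpredZeq (negPf k0n).
Qed.

Lemma betti_unlink_target i j :
  betti s (c :: D) i j = betti s D i j
  + (nat_of_bool ((i == i0 + 1) && ((j == j0 + 1) || (j == j0 - 1))))%:Z
  - (nat_of_bool ((i == i0) && ((j == j0 - 1) || (j == j0 - 3))))%:Z.
Proof.
have gh' i' j' w : w \in chains (toggle c t) D i' j' -> cube_mul g w = cube_mul h w.
  by rewrite toggleK; apply: gh.
rewrite betti_cons // -/t dim_cycle_target /betti !dim_cycle_target.
(* The Betti numbers of the unlink itself: it is the source of the reverse saddle, and the two
   counts for a source add up to them. *)
rewrite (dim_cycle_kernel gen gh' cgh) (dim_saddle_kernel gen gh' cgh).
rewrite !PoszD.
have -> : (i == i0 + 1) = (i - 1 == i0) by rewrite subr_eq.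
have -> : (j == j0 + 1) = (j - 1 == j0) by rewrite subr_eq.
have -> : (j == j0 - 1) = (j - 1 == j0 - 2) by clear; lia.
have -> : (j == j0 - 3) = (j - 1 == j0 - 4) by clear; lia.
set x := (\dim _)%:Z; set y := (\dim _)%:Z; set n1 := (nat_of_bool _)%:Z.
by ring.
Qed.

End Target.

End UnlinkCone.

End Betti.

(** * Khovanov complexes and chord diagrams *)

Section Coordinates.

Variable E : finType.
Implicit Types (s : {perm E}) (c : E * E) (D : seq (E * E)) (b : seq bool).
Implicit Types (i j : int).

Fixpoint at_state D : cube D -> seq bool -> edge_poly E :=
  if D is c :: D' return cube D -> seq bool -> edge_poly E
  then fun f b => at_state (if head false b then f.2 else f.1) (behead b)
  else fun f _ => f.

Fixpoint build D (F : seq bool -> edge_poly E) : cube D :=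
  if D is c :: D' return cube D
  then (build D' (fun b => F (false :: b)), build D' (fun b => F (true :: b)))
  else F [::].

Fixpoint state_perm s D b : {perm E} :=
  if D is c :: D'
  then state_perm (if head false b then toggle c s else s) D' (behead b) else s.

Lemma at_build D F b : size b = size D -> at_state (build D F) b = F b.
Proof.
by elim: D F b => [|c D IH] F [|x b] //= [sb]; case: x; rewrite /= IH.
Qed.

Lemma eq_at D (f g : cube D) :
  (forall b, size b = size D -> at_state f b = at_state g b) -> f = g.
Proof.
elim: D f g => [|c D IH] f g H; first exact: (H [::]).
case: f g H => f0 f1 [g0 g1] H; congr (_, _); apply: IH => b sb.
  by apply: (H (false :: b)); rewrite /= sb.
by apply: (H (true :: b)); rewrite /= sb.
Qed.

Let shift_height (n : nat) i : ((1 + n)%N%:Z == i) = (n%:Z == i - 1).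
Proof. by lia. Qed.

Let shift_degree i j : j - 1 - (i - 1) = j - i. Proof. by lia. Qed.

Lemma at_chains s D i j (f : cube D) :
  f \in chains s D i j <->
  forall b, size b = size D ->
    if (count id b)%:Z == i
    then at_state f b \in state_space (state_perm s D b) (j - i)
    else at_state f b == 0.
Proof.
elim: D s i j f => [|c D IH] s i j f.
  rewrite memv_chains_nil; split=> [H [|//] _|/(_ [::] erefl)] /=; rewrite eq_sym.
    by case: eqP H => [->|//]; rewrite subr0.
  by case: eqP => [->|//]; rewrite subr0.
rewrite memv_chains_cons; split=> [/andP[/IH f0 /IH f1] [|[] b] // [sb]|H] /=.
- by have := f1 _ sb; rewrite shift_height shift_degree.
- exact: f0.
apply/andP; split; apply/IH => b sb.
  by have := H (false :: b); rewrite /= sb => /(_ erefl).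
have := H (true :: b); rewrite /= sb => /(_ erefl).
by rewrite shift_height shift_degree.
Qed.

Lemma at_stateD D (f g : cube D) b : at_state (f + g) b = at_state f b + at_state g b.
Proof. by elim: D f g b => //= c D IH f g b; case: (head _ b); rewrite IH. Qed.

Lemma at_stateN D (f : cube D) b : at_state (- f) b = - at_state f b.
Proof. by elim: D f b => //= c D IH f b; case: (head _ b); rewrite IH. Qed.

Lemma at_stateZ D k (f : cube D) b : at_state (k *: f) b = k *: at_state f b.
Proof. by elim: D f b => //= c D IH f b; case: (head _ b); rewrite IH. Qed.

Lemma at_saddle s c D (f : cube D) b :
  at_state (cube_saddle s c f) b = saddle (state_perm s D b) c (at_state f b).
Proof. by elim: D s f b => //= d D IH s f b; case: (head _ b); rewrite IH. Qed.

Definition unset b k := set_nth false b k false.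

(** Unfolding the cones produces the usual sign: one minus for each earlier chord that is
    1-smoothed. *)
Lemma at_dif s D (f : cube D) b c0 : size b = size D ->
  at_state (dif s f) b =
  \sum_(k < size D | nth false b k)
     (-1) ^+ count id (take k b)
     *: saddle (state_perm s D (unset b k)) (nth c0 D k) (at_state f (unset b k)).
Proof.
elim: D s f b => [|c D IH] s f [|x b] //=; first by rewrite big_ord0.
case=> sb; rewrite big_mkcond big_ord_recl /= -big_mkcond /=.
have rest t (g : cube D) : at_state (dif t g) b =
    \sum_(k < size D | nth false b k)
     (-1) ^+ count id (take k b)
     *: saddle (state_perm t D (unset b k)) (nth c0 D k) (at_state g (unset b k)).
  exact: IH.
case: x => /=.
  rewrite at_stateD at_stateN at_saddle rest expr0 scale1r; congr (_ + _).
  rewrite -sumrN; apply: eq_bigr => k _.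
  by rewrite /bump add1n exprS mulN1r scaleNr.
by rewrite add0r rest; apply: eq_bigr.
Qed.

End Coordinates.

Section StatePerm.

Variable E : finType.
Implicit Types (s : {perm E}) (c : E * E) (D : seq (E * E)).

Lemma state_perm_toggle s c D b : all (disjoint_chords c) D ->
  state_perm (toggle c s) D b = toggle c (state_perm s D b).
Proof.
elim: D s b => //= d D IH s b /andP[cd cD].
by case: (head _ b); rewrite -?(toggle_commute _ cd) IH.
Qed.

Lemma state_perm_set s c0 D b k : wf_chords D -> size b = size D -> (k < size D)%N ->
  nth false b k = false ->
  state_perm s D (set_nth false b k true) = toggle (nth c0 D k) (state_perm s D b).
Proof.
elim: D s b k => // c D IH s [|x b] [|k] //= /and3P[_ cD wD] [sb] kD.
  by move=> ->; apply: state_perm_toggle.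
by move=> bk; apply: IH.
Qed.

Lemma wf_chords_nth c0 D k : wf_chords D -> (k < size D)%N ->
  (nth c0 D k).1 != (nth c0 D k).2.
Proof. by elim: D k => // c D IH [|k] /= /and3P[nc _ wD] //; apply: IH. Qed.

End StatePerm.

Section CircularValues.

Variables (E : finType) (s : {perm E}) (F : edge_poly E).
Hypothesis cF : circular s F.
Implicit Types (A B P : {set E}) (x : E).

Lemma card_setU1I x A P : x \notin A ->
  #|(x |: A) :&: P| = ((x \in P) + #|A :&: P|)%N.
Proof.
move=> xA; rewrite setIUl; case: (boolP (x \in P)) => [xP|xP] /=.
  by rewrite (setIidPl _) ?sub1set // cardsU1 inE (negPf xA) add1n.
suff -> : [set x] :&: P = set0 by rewrite set0U.
by apply/eqP; rewrite setI_eq0 disjoints1.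
Qed.

Lemma circular_eq0 A x : (1 < #|A :&: porbit s x|)%N -> F A = 0.
Proof.
case/card_gt1P => u [v [uA vA nuv]]; move: uA vA; rewrite !inE.
case/andP => uA ux /andP[vA vx]; rewrite -(setD1K uA).
have cO := circular_constant (erefl (porbit s x)) cF.
by apply: (circle_constant2 cO ux vx); rewrite !inE ?eqxx // eq_sym nuv.
Qed.

(** Marks are moved along their circles one at a time, by induction on the number of marks of [A]
    outside [B]. *)
Lemma circular_eq A B : (forall x, #|A :&: porbit s x| = #|B :&: porbit s x|) -> F A = F B.
Proof.
have [n] := ubnP #|A :\: B|; elim: n A => // n IH A /ltnSE An AB.
have [AB0|[x]] := set_0Vmem (A :\: B).
  congr (F _); apply/eqP; rewrite eqEsubset -setD_eq0 AB0 eqxx /=.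
  apply/subsetP => y yB; apply: contraT => yA.
  have sAB : A \subset B by rewrite -setD_eq0 AB0.
  suff : (#|A :&: porbit s y| < #|B :&: porbit s y|)%N by rewrite AB ltnn.
  apply/proper_card/properP; split; first exact: setSI.
  by exists y; rewrite !inE ?yB ?porbit_id // (negPf yA).
rewrite inE => /andP[xB xA].
have [y [yx yB yA]] : exists y, [/\ y \in porbit s x, y \in B & y \notin A].
  have [/existsP[y /and3P[]]|/existsPn H] :=
    boolP [exists y, [&& y \in porbit s x, y \in B & y \notin A]]; first by exists y.
  suff : (#|B :&: porbit s x| < #|A :&: porbit s x|)%N by rewrite AB ltnn.
  apply/proper_card/properP; split; last first.
    by exists x; rewrite !inE ?xA ?porbit_id // (negPf xB).
  apply/subsetP => y; rewrite !inE => /andP[yB yx]; rewrite yx andbT.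
  by apply: contraT => yA; case/negP: (H y); apply/and3P.
have xC : x \notin A :\ x by rewrite !inE eqxx.
have yC : y \notin A :\ x by rewrite !inE (negPf yA) andbF.
transitivity (F (y |: (A :\ x))).
  rewrite -{1}(setD1K xA); have /ffunP/(_ (A :\ x)) := circular_porbit cF yx.
  by rewrite !ffunE (negPf xC) (negPf yC).
apply: IH => [|z].
  apply: leq_trans An; apply: proper_card; apply/properP; split.
    apply/subsetP => z; rewrite !inE => /andP[zB /orP[/eqP ez|/andP[_ zA]]].
      by rewrite ez yB in zB.
    by rewrite zB.
  exists x; rewrite !inE ?xA ?xB // eqxx orbF; apply/negP => /eqP ex.
  by rewrite -ex xA in yA.
rewrite -AB -{2}(setD1K xA) !card_setU1I //; congr (nat_of_bool _ + _)%N.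
apply/idP/idP; first by move=> yz; rewrite porbit_sym in yx; apply: porbit_trans yx yz.
exact: porbit_trans yx.
Qed.

End CircularValues.

(** * Labelled states as elements of the edge ring *)

Section Labels.

Variables (E1 E2 : finType) (pi : E1 -> E2).
Implicit Types (s : {perm E2}) (c : E2 * E2) (A B : {set E2}) (l : E1 -> bool).
Implicit Types (e f a b : E1) (x : E2).

Definition marks s A e := #|A :&: porbit s (pi e)|.

Definition label_constant s l := forall e f, pi f \in porbit s (pi e) -> l e = l f.

(** A circle without edges of the knot diagram would have no label. *)
Definition meets_circles s := forall x, exists e, x \in porbit s (pi e).

(* The image of the tensor with the labels [l]: a circle labelled v+ carries
   exactly one mark, and a circle labelled v- carries none. *)
Definition label_poly s l : edge_poly E2 :=
  [ffun A : {set E2} => [forall e, marks s A e == l e]%:R].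

Lemma marks_circle s A e f : pi f \in porbit s (pi e) -> marks s A e = marks s A f.
Proof. by rewrite -eq_porbit_mem => /eqP; rewrite /marks => ->. Qed.

Lemma marksU1 s A x e : x \notin A ->
  marks s (x |: A) e = ((x \in porbit s (pi e)) + marks s A e)%N.
Proof.
move=> xA; rewrite /marks setIUl; case: (boolP (x \in _)) => [xe|xe] /=.
  by rewrite (setIidPl _) ?sub1set // cardsU1 inE (negPf xA) add1n.
suff -> : [set x] :&: porbit s (pi e) = set0 by rewrite set0U.
by apply/eqP; rewrite setI_eq0 disjoints1.
Qed.

Lemma marks_gt0 s A x e : x \in A -> x \in porbit s (pi e) -> (0 < marks s A e)%N.
Proof. by move=> xA xe; rewrite card_gt0; apply/set0Pn; exists x; rewrite inE xA. Qed.

(** Multiplication by x turns v+ on the circle of [e] into v-, kills v-, and leaves the other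
    circles alone. *)
Lemma mulx_label_poly s l x e A : label_constant s l -> x \in porbit s (pi e) ->
  mulx x (label_poly s l) A =
  ([forall f, (pi f \notin porbit s (pi e)) ==> (marks s A f == l f)]
   && ((marks s A e == 0%N) && l e))%:R.
Proof.
move=> cl xe; rewrite !ffunE; case: ifPn => [xA|xA].
  by rewrite eqn0Ngt (marks_gt0 xA xe) andbF.
congr (nat_of_bool _)%:R; apply/forallP/andP => [H|[/forallP H /andP[/eqP m0 le]] f].
  split; last by have := H e; rewrite marksU1 // xe; case: (l e); case: marks.
  apply/forallP => f; apply/implyP => nf; have := H f; rewrite marksU1 //.
  suff -> : x \in porbit s (pi f) = false by [].
  apply: contraNF nf => xf; rewrite -eq_porbit_mem.
  by move: xe xf; rewrite -!eq_porbit_mem => /eqP <- /eqP <-.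
rewrite marksU1 //; have [fe|nf] := boolP (pi f \in porbit s (pi e)).
  have ef := fe; rewrite porbit_sym in ef.
  by rewrite (porbit_trans xe ef) -(marks_circle A fe) m0 -(cl _ _ fe) le.
have := H f; rewrite nf /= => /eqP <-; rewrite (_ : x \in _ = false) //.
apply: contraNF nf => xf; rewrite -eq_porbit_mem.
by move: xe xf; rewrite -!eq_porbit_mem => /eqP <- /eqP <-.
Qed.

Lemma circular_label_poly s l : label_constant s l -> meets_circles s ->
  circular s (label_poly s l).
Proof.
move=> cl ms x; have [e xe] := ms x; apply/ffunP => A.
rewrite (mulx_label_poly A cl xe) (@mulx_label_poly _ _ (s x) e) //.
exact: porbit_step.
Qed.

Lemma porbit_toggle_untouched s c x : ~~ touches s c x ->
  porbit (toggle c s) x = porbit s x.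
Proof.
move=> nx; apply/setP => y; apply/idP/idP; last by move=> yx; apply: porbit_toggle_out.
by case/porbit_toggle/orP => // /andP[_]; rewrite (negPf nx).
Qed.

Lemma porbit_toggle_merge s c : c.1 != c.2 -> c.1 \notin porbit s c.2 ->
  porbit (toggle c s) c.1 = porbit s c.1 :|: porbit s c.2.
Proof.
move=> nc hc; have h2 : c.2 \in porbit (toggle c s) c.1.
  by rewrite porbit_sym porbit_toggle_neq.
have t1 y : touches (toggle c s) c y -> y \in porbit (toggle c s) c.1.
  by case/orP => // h; apply: porbit_trans h h2.
have back y (f : E2) : f \in porbit (toggle c s) c.1 -> y \in porbit s f ->
    y \in porbit (toggle c s) c.1.
  rewrite -{2}(toggleK c s) => fT /porbit_toggle /orP[h|/andP[/t1//]].
  exact: porbit_trans h fT.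
apply/setP => y; rewrite inE -/(touches s c y); apply/idP/idP.
  by case/porbit_toggle/orP => [|/andP[]//]; rewrite /touches => ->.
by case/orP; apply: back => //; apply: porbit_id.
Qed.

Section Merge.

Variables (s : {perm E2}) (c : E2 * E2) (a b : E1) (l : E1 -> bool).
Hypotheses (nc : c.1 != c.2) (hc : c.1 \notin porbit s c.2).
Hypotheses (ca : c.1 \in porbit s (pi a)) (cb : c.2 \in porbit s (pi b)).
Hypothesis cl : label_constant s l.

Definition off_circles A :=
  [forall e, (~~ (pi a \in porbit s (pi e)) && ~~ (pi b \in porbit s (pi e)))
             ==> (marks s A e == l e)].

Let oa : porbit s c.1 = porbit s (pi a). Proof. by apply/eqP; rewrite eq_porbit_mem. Qed.
Let ob : porbit s c.2 = porbit s (pi b). Proof. by apply/eqP; rewrite eq_porbit_mem. Qed.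

Lemma marks_merge A : marks (toggle c s) A a = (marks s A a + marks s A b)%N.
Proof.
have -> : marks (toggle c s) A a = #|A :&: porbit (toggle c s) c.1|.
  rewrite /marks; congr #|_ :&: _|; apply/eqP; rewrite eq_porbit_mem.
  by rewrite porbit_toggle_merge // inE oa porbit_id.
rewrite porbit_toggle_merge // setIUr cardsU oa ob -/(marks s A a) -/(marks s A b).
suff -> : A :&: porbit s (pi a) :&: (A :&: porbit s (pi b)) = set0 by rewrite cards0 subn0.
apply/setP => x; rewrite !inE; apply/negP => /andP[/andP[_ xa] /andP[_ xb]].
case/negP: hc; rewrite -eq_porbit_mem oa ob.
by move: xa xb; rewrite -!eq_porbit_mem => /eqP <- /eqP ->.
Qed.

Lemma touchesE e : touches s c (pi e) =
  (pi a \in porbit s (pi e)) || (pi b \in porbit s (pi e)).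
Proof. by rewrite /touches oa ob porbit_sym [X in _ || X]porbit_sym. Qed.

Lemma marks_toggle_off A e : ~~ (pi a \in porbit s (pi e)) ->
  ~~ (pi b \in porbit s (pi e)) -> marks (toggle c s) A e = marks s A e.
Proof.
by move=> na nb; rewrite /marks porbit_toggle_untouched // touchesE negb_or na.
Qed.

Lemma porbit_toggle_mark e :
  (pi a \in porbit (toggle c s) (pi e)) = touches s c (pi e).
Proof.
have ea : porbit (toggle c s) (pi a) = porbit (toggle c s) c.1.
  by apply/eqP; rewrite eq_porbit_mem porbit_toggle_merge // inE oa porbit_id.
by rewrite porbit_sym ea porbit_toggle_merge // inE.
Qed.

(** The test of [edge_map] on the other circles, when a label is read off as having exactly one
    mark. *)
Definition labels_off A (m : E1 -> nat) :=
  [forall e, (~~ (pi a \in porbit s (pi e)) && ~~ (pi b \in porbit s (pi e)))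
             ==> ((m e == 1%N) == l e)].

Let l_le1 (x : bool) : (x <= 1)%N. Proof. by case: x. Qed.

Lemma off_circles_labels A m :
  (forall e, ~~ (pi a \in porbit s (pi e)) -> ~~ (pi b \in porbit s (pi e)) ->
     m e = marks s A e) ->
  [forall e, (m e <= 1)%N] && labels_off A m = [forall e, (m e <= 1)%N] && off_circles A.
Proof.
move=> em; case: forallP => //= v; apply: eq_forallb => e.
have := em e; case: (pi a \in _) => //; case: (pi b \in _) => //= <- //.
by have := v e; case: (m e) => [|[|]] //; case: (l e).
Qed.

Lemma off_circles_split A : off_circles A ->
  [forall e, (marks s A e <= 1)%N] = (marks s A a <= 1)%N && (marks s A b <= 1)%N.
Proof.
move=> /forallP off; apply/forallP/andP => [H|[ha hb] e]; first by split.
have := off e; have [ae _|_] := boolP (pi a \in porbit s (pi e)).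
  by rewrite (marks_circle A ae).
have [be _|_ /= /eqP ->] := boolP (pi b \in porbit s (pi e)); last exact: l_le1.
by rewrite (marks_circle A be).
Qed.

Lemma off_circles_merge A : off_circles A ->
  [forall e, (marks (toggle c s) A e <= 1)%N] = (marks s A a + marks s A b <= 1)%N.
Proof.
move=> /forallP off; apply/forallP/idP => [H|ab e]; first by rewrite -marks_merge.
have [te|nte] := boolP (touches s c (pi e)).
  by rewrite -porbit_toggle_mark in te; rewrite (marks_circle A te) marks_merge.
have := nte; rewrite touchesE negb_or => /andP[na nb].
by have := off e; rewrite na nb /= marks_toggle_off // => /eqP ->; apply: l_le1.
Qed.

(** One summand for each of the two variables; in terms of the marks on the merged circle they make
    up the table [mulA]. *)
Lemma saddle_label_poly A :
  saddle s c (label_poly s l) A =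
  (off_circles A && ((marks s A a == 0%N) && l a && (marks s A b == l b)))%:R
  + (off_circles A && ((marks s A b == 0%N) && l b && (marks s A a == l a)))%:R.
Proof.
rewrite /saddle (negPf hc) ffunE (mulx_label_poly A cl ca) (mulx_label_poly A cl cb).
have nab : pi a \notin porbit s (pi b).
  by rewrite -eq_porbit_mem -oa -ob eq_porbit_mem.
have aux (u v : E1) :
    (forall A, off_circles A = [forall e, (~~ (pi u \in porbit s (pi e))
      && ~~ (pi v \in porbit s (pi e))) ==> (marks s A e == l e)]) ->
    pi u \notin porbit s (pi v) ->
    ([forall f, (pi f \notin porbit s (pi u)) ==> (marks s A f == l f)]
     && ((marks s A u == 0%N) && l u)) =
    (off_circles A && ((marks s A u == 0%N) && l u && (marks s A v == l v))).
  move=> -> nuv; apply/andP/andP => -[/forallP H].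
    case/andP => -> ->; split.
      apply/forallP => e; apply/implyP => /andP[ne _].
      by have := H e; rewrite porbit_sym ne.
    by have := H v; rewrite porbit_sym nuv.
  case/andP => -> mv; split=> //; apply/forallP => f; apply/implyP => fu.
  have := H f; rewrite porbit_sym fu /=.
  have [vf _|//] := boolP (pi v \in porbit s (pi f)).
  by rewrite (marks_circle A vf) (cl vf).
rewrite (aux a b) // (aux b a) //; last by rewrite porbit_sym.
by move=> B; apply: eq_forallb => e; rewrite andbC.
Qed.

End Merge.

Lemma label_polyE s l a A : label_constant s l ->
  label_poly s l A =
  ([forall e, (pi a \notin porbit s (pi e)) ==> (marks s A e == l e)]
   && (marks s A a == l a))%:R.
Proof.
move=> cl; rewrite ffunE; congr (nat_of_bool _)%:R.
apply/forallP/andP => [H|[/forallP H ma] e].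
  by split=> //; apply/forallP => e; rewrite H implybT.
have := H e; have [ae _|//] := boolP (pi a \in porbit s (pi e)).
by rewrite (marks_circle A ae) (cl _ _ ae).
Qed.

End Labels.

(** * Comparing the complex of a planar diagram with the cube *)

Section Bridge.

Variables (E1 E2 : finType) (D1 : seq (crossing E1)) (D2 : seq (E2 * E2)).
Variables (s0 : {perm E2}) (pi : E1 -> E2) (c0 : E2 * E2).
Hypothesis sizeD : size D2 = size D1.
Hypothesis wf : wf_chords D2.

Definition state_bits (s : state D1) : seq bool := [seq s k | k <- enum 'I_(size D1)].
Definition circles_of (s : state D1) : {perm E2} := state_perm s0 D2 (state_bits s).

Local Notation sg := circles_of.
Local Notation chord k := (nth c0 D2 k).

(* The orbits represent the circles of the states, and the two ends of each
   chord lie on the circles of [e0] and [e2]. *)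
Hypothesis same_circleE : forall s e f,
  same_circle s e f = (pi f \in porbit (sg s) (pi e)).
Hypothesis circles_onto : forall s, meets_circles pi (sg s).
Hypothesis chord_ends : forall (s : state D1) (k : 'I_(size D1)),
  let c := chord k in let a := pi (e0 (xing k)) in let b := pi (e2 (xing k)) in
  ((c.1 \in porbit (sg s) a) && (c.2 \in porbit (sg s) b))
  || ((c.2 \in porbit (sg s) a) && (c.1 \in porbit (sg s) b)).

Implicit Types (s : state D1) (y : enhanced D1) (k : 'I_(size D1)) (A : {set E2}).

Lemma size_state_bits s : size (state_bits s) = size D2.
Proof. by rewrite size_map size_enum_ord. Qed.

Lemma nth_state_bits s k : nth false (state_bits s) k = s k.
Proof.
by rewrite (nth_map k) ?size_enum_ord // nth_ord_enum.
Qed.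

Lemma enhanced_constant y : label_constant pi (sg (est y)) (elab y).
Proof.
move=> e f; rewrite -same_circleE => /connectP[p pth ->].
elim: p e pth => //= g p IH e /andP[eg /IH <-].
have /forallP/(_ e)/forallP/(_ g)/implyP/(_ eg) := valP y.
by move/eqP.
Qed.

Fact marked_label_subproof s A :
  let y := (s, [ffun e => marks pi (sg s) A e == 1%N]) in
  [forall e, forall f, joined y.1 e f ==> (y.2 e == y.2 f)].
Proof.
apply/forallP => e; apply/forallP => f; apply/implyP => /= ef; rewrite !ffunE.
have := connect1 ef; rewrite -[connect _ _ _]/(same_circle s e f) same_circleE => h.
by rewrite (marks_circle A h).
Qed.

(** The only labelling of [s] whose polynomial can be nonzero at [A], so that sums over labellings
    reduce to one term. *)
Definition marked_label s A : enhanced D1 :=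
  exist _ (s, [ffun e => marks pi (sg s) A e == 1%N]) (marked_label_subproof s A).

Lemma sum_label_poly (G : enhanced D1 -> rat) s A :
  \sum_(y | est y == s) G y * label_poly pi (sg s) (elab y) A =
  if [forall e, (marks pi (sg s) A e <= 1)%N] then G (marked_label s A) else 0.
Proof.
have W y : est y = s -> label_poly pi (sg s) (elab y) A != 0 -> y = marked_label s A.
  move=> ey; rewrite ffunE; case: forallP => // H _; apply: val_inj.
  rewrite /= [val y]surjective_pairing -[(val y).1]/(est y) ey; congr (_, _).
  apply/ffunP => e; rewrite ffunE (eqP (H e)) -[(val y).2]/(elab y).
  by case: (elab y e).
case: ifPn => [/forallP v|/forallPn[e ne]].
  rewrite (bigD1 (marked_label s A)) //= big1 => [|y /andP[/eqP ey ny]].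
    rewrite addr0 ffunE (_ : [forall e, _] = true) ?mulr1 //.
    apply/forallP => e; rewrite /elab /= ffunE; have := v e.
    by case: (marks _ _ _ _) => [|[|]].
  apply/eqP; rewrite mulf_eq0; apply/orP; right; apply: contraNT ny => /W ->//.
rewrite big1 // => y /eqP ey; rewrite ffunE; case: forallP => [H|_]; last by rewrite mulr0.
by case/negP: ne; rewrite (eqP (H e)); case: (elab y e).
Qed.

Lemma state_bits_flip s k : state_bits (flip s k) = set_nth false (state_bits s) k true.
Proof.
have sz : size (set_nth false (state_bits s) k true) = size D1.
  by rewrite size_set_nth size_state_bits sizeD; apply/maxn_idPr.
apply: (@eq_from_nth _ false) => [|m]; rewrite size_state_bits sizeD ?sz // => mD.
rewrite nth_set_nth /= (nth_state_bits _ (Ordinal mD)) ffunE -(nth_state_bits s (Ordinal mD)).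
by rewrite -val_eqE.
Qed.

Lemma circles_of_flip s k : ~~ s k -> sg (flip s k) = toggle (chord k) (sg s).
Proof.
move=> sk; rewrite /circles_of state_bits_flip; apply: state_perm_set => //.
- by rewrite size_state_bits.
- by rewrite sizeD.
- by rewrite nth_state_bits (negPf sk).
Qed.

(** The edge maps are the saddles, written in label polynomials. At [A] the sum has at most one
    term, and away from the two arcs both sides impose the same condition; the marks on the circles
    of the arcs leave a finite table. *)
Lemma edge_sum y k A : ~~ est y k ->
  \sum_(y' | est y' == flip (est y) k)
     edge_map k y y' * label_poly pi (sg (flip (est y) k)) (elab y') A
  = saddle (sg (est y)) (chord k) (label_poly pi (sg (est y)) (elab y)) A.
Proof.
move=> yk; rewrite sum_label_poly circles_of_flip //.
set s := est y in yk *; set c := chord k.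
pose a := e0 (xing k); pose b := e2 (xing k).
have cl : label_constant pi (sg s) (elab y) := @enhanced_constant y.
have nc : c.1 != c.2 by apply: wf_chords_nth; rewrite // sizeD.
have xE e : elab (marked_label (flip s k) A) e = (marks pi (toggle c (sg s)) A e == 1%N).
  by rewrite /elab /= ffunE circles_of_flip.
have ifE (T : Type) (p q : bool) (u v : T) :
    (if p then if q then u else v else v) = if p && q then u else v by case: p.
(* A split is read as a merge starting from the 1-smoothed state. *)
have [hc|hc] := boolP (c.1 \in porbit (sg s) c.2).
  have hc' : c.1 \notin porbit (sg (flip s k)) c.2.
    by rewrite circles_of_flip // porbit_toggle_neq // negbK.
  have [d [d1 d2 hd nd [ed ed']]] : exists d, [/\ d.1 \in porbit (sg (flip s k)) (pi a),
      d.2 \in porbit (sg (flip s k)) (pi b), d.1 \notin porbit (sg (flip s k)) d.2,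
      d.1 != d.2 & toggle d (sg (flip s k)) = sg s /\ toggle c (sg s) = toggle d (sg s)].
    case/orP: (chord_ends (flip s k) k) => /andP[h1 h2].
      by exists c; split; rewrite // circles_of_flip // toggleK.
    exists (c.2, c.1); split=> //=; rewrite ?[c.2 == _]eq_sym ?[c.2 \in _]porbit_sym //.
    by rewrite circles_of_flip // !(toggle_swap c.2) -surjective_pairing toggleK.
  have tE : toggle c (sg s) = sg (flip s k) by rewrite circles_of_flip.
  rewrite tE in xE *.
  have ab : same_circle (est y) a b.
    rewrite same_circleE -ed porbit_sym porbit_toggle_mark // /touches.
    by rewrite [X in _ || X]porbit_sym d2 orbT.
  rewrite /edge_map -/a -/b ab ifE !xE.
  have -> : saddle (sg s) c (label_poly pi (sg s) (elab y)) = label_poly pi (sg s) (elab y).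
    by rewrite /saddle hc.
  rewrite (label_polyE a A cl).
  have -> : [forall e, (pi a \notin porbit (sg s) (pi e)) ==> (marks pi (sg s) A e == elab y e)]
      = off_circles pi (sg (flip s k)) a b (elab y) A.
    apply: eq_forallb => e; rewrite -negb_or -(touchesE d1 d2) -ed porbit_toggle_mark //.
    have [//|te] := boolP (touches _ _ _).
    by rewrite /marks porbit_toggle_untouched.
  have -> : marks pi (sg s) A a = (marks pi (sg (flip s k)) A a + marks pi (sg (flip s k)) A b)%N.
    by rewrite -ed (marks_merge _ _ d1 d2).
  set crit := [forall e, _ ==> _].
  have -> : crit = labels_off pi (sg (flip s k)) a b (elab y) A
                     (fun e => marks pi (sg (flip s k)) A e).
    apply: eq_forallb => e; rewrite !same_circleE !xE; congr (_ ==> _).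
    have <- : porbit (sg s) (pi a) = porbit (sg s) (pi b).
      by apply/eqP; rewrite eq_porbit_mem porbit_sym -same_circleE.
    rewrite andbb -negb_or -(touchesE d1 d2) porbit_sym -ed.
    by rewrite porbit_toggle_mark.
  rewrite off_circles_labels //.
  case off: (off_circles _ _ _ _ _ _); rewrite ?andbF ?andbT //=.
  rewrite (off_circles_split off).
  case: (marks _ _ _ a) => [|[|u]]; case: (marks _ _ _ b) => [|[|v]] //=;
    rewrite ?addn0 ?addnS; by case: (elab y a).
have [d [d1 d2 hd nd [ed es]]] : exists d, [/\ d.1 \in porbit (sg s) (pi a),
    d.2 \in porbit (sg s) (pi b), d.1 \notin porbit (sg s) d.2, d.1 != d.2
    & toggle d (sg s) = toggle c (sg s) /\ (forall F, saddle (sg s) d F = saddle (sg s) c F)].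
  case/orP: (chord_ends s k) => /andP[h1 h2]; first by exists c.
  exists (c.2, c.1); split=> //=; rewrite ?[c.2 == _]eq_sym ?[c.2 \in _]porbit_sym //.
  split; first by rewrite toggle_swap -surjective_pairing.
  by move=> F; rewrite /saddle /= porbit_sym (negPf hc) addrC.
rewrite -es -ed (saddle_label_poly hd d1 d2 cl).
rewrite -ed in xE.
have nab : same_circle (est y) a b = false.
  apply: contraNF hd; rewrite same_circleE => h; rewrite porbit_sym in h.
  by apply: porbit_trans d1 (porbit_trans h _); rewrite porbit_sym.
rewrite /edge_map -/a -/b nab ifE !xE.
set crit := [forall e, _ ==> _].
have -> : crit = labels_off pi (sg s) a b (elab y) A
                   (fun e => marks pi (toggle d (sg s)) A e).
  apply: eq_forallb => e; rewrite !same_circleE !xE.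
  by rewrite (porbit_sym _ (pi e)) (porbit_sym _ (pi e) (pi b)).
rewrite off_circles_labels; last by move=> e; apply: marks_toggle_off.
case off: (off_circles _ _ _ _ _ _); rewrite ?andbF ?andbT ?addr0 //=.
rewrite (off_circles_merge nd hd d1 d2 off) (marks_merge nd hd d1 d2).
case: (marks _ _ _ a) => [|[|u]]; case: (marks _ _ _ b) => [|[|v]] //=;
  rewrite ?addn0 ?addnS; by case: (elab y a); case: (elab y b).
Qed.

Lemma same_circle_sym s : connect_sym (joined s).
Proof. by move=> e f; rewrite -!/(same_circle s _ _) !same_circleE porbit_sym. Qed.

Let circle s e : {set E2} := porbit (sg s) (pi e).

Lemma circle_inj s : {in roots (joined s) &, injective (circle s)}.
Proof.
move=> e f re rf /eqP; rewrite eq_porbit_mem porbit_sym -same_circleE => ef.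
have := root_connect (same_circle_sym s) e f; rewrite -[connect _ _ _]/(same_circle s e f) ef.
by move/eqP; rewrite (eqP re) (eqP rf).
Qed.

Lemma porbits_circles s : porbits (sg s) = [set circle s e | e in roots (joined s)].
Proof.
apply/setP => O; apply/imsetP/imsetP => -[x _ ->]; last by exists (pi x).
have [e xe] := circles_onto s x; exists (fingraph.root (joined s) e).
  exact: (roots_root (same_circle_sym s)).
apply/eqP; rewrite eq_porbit_mem; apply: porbit_trans xe _.
rewrite porbit_sym -same_circleE; exact: connect_root.
Qed.

Lemma card_marks s A : #|A| = (\sum_(e in roots (joined s)) marks pi (sg s) A e)%N.
Proof.
rewrite -sum1_card (partition_big (porbit (sg s)) (mem (porbits (sg s)))) => [|x _]; last first.
  exact: imset_f.
rewrite porbits_circles big_imset /=; last exact: circle_inj.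
apply: eq_bigr => e _; rewrite sum1dep_card /marks; apply: eq_card => x.
by rewrite !inE eq_porbit_mem.
Qed.

Lemma label_degreeE y A : label_poly pi (sg (est y)) (elab y) A != 0 ->
  label_degree y = (2 * #|A|)%:Z - #|porbits (sg (est y))|%:Z.
Proof.
rewrite ffunE; case: forallP => // H _; rewrite (card_marks (est y) A) porbits_circles.
rewrite card_in_imset; last exact: circle_inj.
have -> : label_degree y =
    \sum_(e in roots (joined (est y))) ((2 * marks pi (sg (est y)) A e)%N%:Z - 1).
  by apply: eq_bigr => e _; rewrite (eqP (H e)); case: (elab y e).
rewrite sumrB -sum1_card big_distrr /= !(big_morph Posz PoszD (erefl _)).
by [].
Qed.

(** The comparison map: an isomorphism onto [chains] in unnormalised degrees, with inverse
    [cube_chain]. *)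
Definition chain_cube i j (f : chain D1 i j) : cube D2 :=
  build D2 (fun b => \sum_(y : bigraded D1 i j | state_bits (est (val y)) == b)
    (f y : rat) *: label_poly pi (sg (est (val y))) (elab (val y))).

Fact chain_cube_is_linear i j : linear (@chain_cube i j).
Proof.
move=> k f g; apply: eq_at => b sb.
rewrite at_stateD at_stateZ !at_build // scaler_sumr -big_split /=.
by apply: eq_bigr => y _; rewrite !ffunE scalerDl scalerA.
Qed.

HB.instance Definition _ i j := GRing.isLinear.Build rat (chain D1 i j) (cube D2) _
  (@chain_cube i j) (@chain_cube_is_linear i j).

Lemma state_bits_inj : injective state_bits.
Proof. by move=> s t e; apply/ffunP => k; rewrite -!nth_state_bits e. Qed.

Lemma state_bits_onto b : size b = size D2 -> exists s, state_bits s = b.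
Proof.
move=> sb; exists [ffun k : 'I_(size D1) => nth false b k].
apply: (@eq_from_nth _ false) => [|m]; rewrite size_state_bits ?sb // sizeD => mD.
by rewrite (nth_state_bits _ (Ordinal mD)) ffunE.
Qed.

Lemma at_chain_cube i j (f : chain D1 i j) s :
  at_state (chain_cube f) (state_bits s) =
  \sum_(y : bigraded D1 i j | est (val y) == s)
    (f y : rat) *: label_poly pi (sg s) (elab (val y)).
Proof.
rewrite at_build ?size_state_bits //.
rewrite (eq_bigl (fun y : bigraded D1 i j => est (val y) == s)) => [|y]; last first.
  exact: inj_eq state_bits_inj _ _.
by apply: eq_bigr => y /eqP ->.
Qed.

Lemma count_state_bits s : count id (state_bits s) = height s.
Proof.
rewrite /height cardE /enum_mem size_filter count_map enumT.
by apply: eq_count.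
Qed.

Lemma label_poly_state_space y :
  label_poly pi (sg (est y)) (elab y) \in state_space (sg (est y)) (label_degree y).
Proof.
apply/state_spaceP; split; last by move=> A /label_degreeE ->.
apply: circular_label_poly; first exact: enhanced_constant.
exact: circles_onto.
Qed.

Let qshift (j : int) : int := j - (npos D1)%:Z + (nneg D1)%:Z *+ 2.

Lemma bigraded_degrees i j (y : bigraded D1 i j) :
  hdegree (val y) = i /\ qdegree (val y) = j.
Proof. by have /andP[/eqP ? /eqP ?] := valP y. Qed.

Lemma label_degree_qshift i j y : hdegree y = i -> qdegree y = j ->
  label_degree y = qshift j - (i + (nneg D1)%:Z).
Proof.
rewrite /hdegree /qdegree /qshift => <- <-; rewrite mulr2n.
by set h := height _; clearbody h; clear; lia.
Qed.

Lemma chain_cube_chains i j (f : chain D1 i j) :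
  chain_cube f \in chains s0 D2 (i + (nneg D1)%:Z) (qshift j).
Proof.
apply/at_chains => b /state_bits_onto[s <-]; rewrite count_state_bits at_chain_cube.
case: eqP => hs; last first.
  rewrite big_pred0 // => y; apply/eqP => es; case: hs.
  by have [hy _] := bigraded_degrees y; rewrite -hy /hdegree es subrK.
apply: rpred_sum => y /eqP es; apply: rpredZ.
have [hy qy] := bigraded_degrees y.
rewrite -(label_degree_qshift hy qy) -es.
exact: label_poly_state_space.
Qed.

(** One mark on each circle labelled v+, placed at its root: evaluation at these sets is dual to the
    basis of label polynomials. *)
Definition mark_set y : {set E2} :=
  [set pi e | e in [pred e | (e \in roots (joined (est y))) && elab y e]].

Lemma marks_mark_set y e : marks pi (sg (est y)) (mark_set y) e = elab y e.
Proof.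
set r := fingraph.root (joined (est y)) e.
have er : pi r \in porbit (sg (est y)) (pi e).
  by rewrite -same_circleE; apply: connect_root.
have rr : r \in roots (joined (est y)) := roots_root (same_circle_sym (est y)) e.
rewrite (@enhanced_constant y e r er) /marks; case lr: (elab y r) => /=; last first.
  apply/eqP; rewrite cards_eq0; apply/eqP/setP => x; rewrite !inE.
  apply/negP => /andP[/imsetP[f /andP[/= rf lf] ->] fe].
  have fr : f = r by apply: (circle_inj rf rr); apply/eqP;
    rewrite eq_porbit_mem; apply: porbit_trans fe _; rewrite porbit_sym.
  by rewrite fr lr in lf.
suff -> : mark_set y :&: porbit (sg (est y)) (pi e) = [set pi r] by rewrite cards1.
apply/setP => x; rewrite !inE.
apply/andP/eqP => [[/imsetP[f /andP[/= rf lf] ->] fe]|->]; last first.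
  by split=> //; apply/imsetP; exists r; rewrite // inE rr lr.
congr (pi _); apply: (circle_inj rf rr); apply/eqP.
by rewrite eq_porbit_mem; apply: porbit_trans fe _; rewrite porbit_sym.
Qed.

Lemma label_poly_mark_set y y' : est y' = est y ->
  label_poly pi (sg (est y)) (elab y') (mark_set y) = (y' == y)%:R.
Proof.
move=> ey; rewrite ffunE; congr (nat_of_bool _)%:R; apply/forallP/eqP => [H|-> e].
  apply: val_inj; rewrite [val y]surjective_pairing [val y']surjective_pairing.
  congr (_, _); first exact: ey.
  apply/ffunP => e; have := H e; rewrite marks_mark_set /elab.
  by case: (_ e); case: (_ e).
by rewrite marks_mark_set.
Qed.

Definition cube_chain i j (w : cube D2) : chain D1 i j :=
  [ffun y => at_state w (state_bits (est (val y))) (mark_set (val y))].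

Lemma chain_cubeK i j : cancel (@chain_cube i j) (@cube_chain i j).
Proof.
move=> f; apply/ffunP => y; rewrite ffunE at_chain_cube sum_ffunE.
rewrite (bigD1 y) //= big1 => [|y' /andP[/eqP ey ny]].
  by rewrite addr0 ffunE label_poly_mark_set // eqxx -[_ *: _]/(_ * _) mulr1.
rewrite ffunE label_poly_mark_set // (inj_eq val_inj) (negPf ny).
exact: scaler0.
Qed.

Lemma sum_bigraded i j (G : enhanced D1 -> rat) (P : pred (enhanced D1)) :
  \sum_(y : bigraded D1 i j | P (val y)) G (val y) =
  \sum_(y | P y) if (hdegree y == i) && (qdegree y == j) then G y else 0.
Proof.
rewrite -big_mkcondr /=.
rewrite (eq_bigl (fun y => (y \in [pred y | (hdegree y == i) && (qdegree y == j)]) && P y)).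
  by rewrite big_sub_cond.
by move=> y; rewrite /= andbC.
Qed.

(** A circular element vanishes at sets with two marks on a circle and otherwise depends on the
    numbers of marks only, so its values at the sets [mark_set] determine it. *)
Lemma cube_chainK i j w :
  w \in chains s0 D2 (i + (nneg D1)%:Z) (qshift j) ->
  chain_cube (@cube_chain i j w) = w.
Proof.
move/at_chains => wC; apply: eq_at => b sb; have [s eb] := state_bits_onto sb.
rewrite -eb at_chain_cube; apply/ffunP => A; rewrite sum_ffunE.
have := wC _ sb; rewrite -eb count_state_bits -/(sg s) => {}wC.
pose G y := at_state w (state_bits s) (mark_set y) * label_poly pi (sg s) (elab y) A.
transitivity (\sum_(y : bigraded D1 i j | est (val y) == s) G (val y)).
  by apply: eq_bigr => y /eqP es; rewrite [LHS]ffunE; congr (_ * _); rewrite ffunE es.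
rewrite (@sum_bigraded i j G (fun y => est y == s)).
pose H y := if (hdegree y == i) && (qdegree y == j)
            then at_state w (state_bits s) (mark_set y) else 0.
transitivity (\sum_(y | est y == s) H y * label_poly pi (sg s) (elab y) A).
  by apply: eq_bigr => y _; rewrite /H; case: ifP; rewrite // mul0r.
rewrite sum_label_poly; have cw : circular (sg s) (at_state w (state_bits s)).
  move: wC; case: ifP => _; first by case/state_spaceP.
  by move/eqP => -> x; rewrite !linear0.
case: ifPn => [/forallP v|/forallPn[e]]; last first.
  by rewrite -ltnNge => /(circular_eq0 cw).
have mE e : elab (marked_label s A) e = marks pi (sg s) A e :> nat.
  by rewrite /elab /= ffunE; have := v e; case: (marks _ _ _ e) => [|[|]].
have <- : at_state w (state_bits s) (mark_set (marked_label s A)) = at_state w (state_bits s) A.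
  apply: (circular_eq cw) => x; have [e xe] := circles_onto s x.
  have -> : porbit (sg s) x = porbit (sg s) (pi e) by apply/eqP; rewrite eq_porbit_mem.
  rewrite -[LHS]/(marks pi (sg (est (marked_label s A))) (mark_set (marked_label s A)) e).
  by rewrite marks_mark_set mE.
rewrite /H; case: ifP => // ny; apply/esym/eqP; apply: contraFT ny => w0.
set y := marked_label s A in w0 *.
have lA : label_poly pi (sg (est y)) (elab y) (mark_set y) != 0.
  by rewrite label_poly_mark_set // eqxx oner_eq0.
move: wC; case: eqP => [hs|_ /eqP we]; last by rewrite we ffunE eqxx in w0.
case/state_spaceP => _ /(_ _ w0) dw.
have := label_degreeE lA; rewrite -[est y]/s dw => ly.
rewrite /hdegree /qdegree ly -[est y]/s hs /qshift mulr2n addrK eqxx /=.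
by apply/eqP; clear; lia.
Qed.

Definition clear_bit s k : state D1 := [ffun l => if l == k then false else s l].

Lemma state_bits_clear s k : state_bits (clear_bit s k) = unset (state_bits s) k.
Proof.
have sz : size (unset (state_bits s) k) = size D1.
  by rewrite size_set_nth size_state_bits sizeD; apply/maxn_idPr.
apply: (@eq_from_nth _ false) => [|m]; rewrite size_state_bits sizeD ?sz // => mD.
rewrite nth_set_nth /= (nth_state_bits _ (Ordinal mD)) ffunE -(nth_state_bits s (Ordinal mD)).
by rewrite -val_eqE.
Qed.

Lemma flip_clear s t k : (~~ s k && (t == flip s k)) = (t k && (s == clear_bit t k)).
Proof.
apply/andP/andP => -[h /eqP e].
  rewrite e ffunE eqxx; split=> //; apply/eqP/ffunP => l; rewrite !ffunE.
  by have [->|//] := eqVneq l k; apply: negbTE.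
rewrite e ffunE eqxx; split=> //; apply/eqP/ffunP => l; rewrite !ffunE.
by have [->|//] := eqVneq l k.
Qed.

Lemma height_flip s k : ~~ s k -> height (flip s k) = (height s).+1.
Proof.
move=> sk; rewrite /height (cardD1 k) inE ffunE eqxx add1n; congr _.+1.
apply: eq_card => l; rewrite !inE ffunE.
by have [->|//] := eqVneq l k; rewrite (negPf sk).
Qed.

Lemma count_take_bits s k :
  count id (take k (state_bits s)) = #|[pred l : 'I_(size D1) | (l < k)%N && s l]|.
Proof.
have tk l : (l \in take k (enum 'I_(size D1))) = (l < k)%N.
  rewrite -(mem_map val_inj) map_take val_enum_ord take_iota mem_iota /= add0n.
  by rewrite leq_min ltn_ord andbT.
have dk l : (l \in drop k (enum 'I_(size D1))) = (k <= l)%N.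
  rewrite -(mem_map val_inj) map_drop val_enum_ord drop_iota mem_iota /= add0n.
  by have := ltn_ord l; have := ltn_ord k; lia.
have -> : #|[pred l : 'I_(size D1) | (l < k)%N && s l]|
    = count (mem [pred l : 'I_(size D1) | (l < k)%N && s l]) (enum 'I_(size D1)).
  by rewrite -size_filter cardE enumT /enum_mem.
rewrite /state_bits -map_take count_map.
rewrite -[in RHS](cat_take_drop k (enum 'I_(size D1))) count_cat.
have d0 : count (mem [pred l : 'I_(size D1) | (l < k)%N && s l])
    (drop k (enum 'I_(size D1))) = 0%N.
  apply/eqP; rewrite -leqn0 leqNgt -has_count; apply/hasPn => l.
  rewrite dk leqNgt => /negPf kl; change (~~ ((l < k)%N && s l)).
  by rewrite kl.
rewrite d0 addn0; apply: eq_in_count => l; rewrite tk => kl.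
by change (s l = (l < k)%N && s l); rewrite kl.
Qed.

Lemma label_poly_neq0 y A : label_poly pi (sg (est y)) (elab y) A != 0 ->
  y = marked_label (est y) A /\ [forall e, (marks pi (sg (est y)) A e <= 1)%N].
Proof.
rewrite ffunE; case: forallP => // H _; split.
  apply: val_inj; rewrite /= {1}[val y]surjective_pairing; congr (_, _).
  apply/ffunP => e; rewrite ffunE (eqP (H e)) -[(val y).2]/(elab y).
  by case: (elab y e).
by apply/forallP => e; rewrite (eqP (H e)); case: (elab y e).
Qed.

(** By [edge_sum] a nonzero entry is a coefficient of a saddle, whose degree is known; the degrees
    of [y'] can be read off there. *)
Lemma edge_map_degrees y k y' A : ~~ est y k -> est y' = flip (est y) k ->
  edge_map k y y' * label_poly pi (sg (est y')) (elab y') A != 0 ->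
  hdegree y' = hdegree y + 1 /\ qdegree y' = qdegree y.
Proof.
move=> yk ey'; rewrite mulf_eq0 negb_or => /andP[e0 l0].
have [ym yv] := label_poly_neq0 l0; have := edge_sum A yk.
rewrite sum_label_poly -ey' yv -ym => es.
rewrite es in e0; have /state_spaceP[_ dy] := label_poly_state_space y.
have nc : (chord k).1 != (chord k).2 by apply: wf_chords_nth; rewrite // sizeD.
have := poly_degree_saddle nc dy e0; rewrite -circles_of_flip // -ey'.
rewrite -(label_degreeE l0) => ld.
rewrite /hdegree /qdegree ld ey' height_flip //.
by set h := height _; clearbody h; clear; split; lia.
Qed.

(** Entries outside the right bidegree vanish by [edge_map_degrees], so the sum may run over all
    labellings of [s]; then [edge_sum] applies to each crossing. *)
Lemma diff_coef_sum i i' j (y : enhanced D1) s A :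
  i' = i + 1 -> hdegree y = i -> qdegree y = j ->
  \sum_(y' : bigraded D1 i' j | est (val y') == s)
     diff_coef y (val y') * label_poly pi (sg s) (elab (val y')) A
  = \sum_(k | s k && (est y == clear_bit s k))
      (-1) ^+ count id (take k (state_bits s))
      * saddle (sg (est y)) (chord k) (label_poly pi (sg (est y)) (elab y)) A.
Proof.
move=> ei hy qy.
rewrite (@sum_bigraded i' j
  (fun y' => diff_coef y y' * label_poly pi (sg s) (elab y') A) (fun y' => est y' == s)).
transitivity (\sum_(y' | est y' == s) \sum_(k | s k && (est y == clear_bit s k))
   (-1) ^+ count id (take k (state_bits s))
     * (edge_map k y y' * label_poly pi (sg s) (elab y') A)).
  apply: eq_bigr => y' /eqP es.
  have -> : diff_coef y y' * label_poly pi (sg s) (elab y') A =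
     \sum_(k | s k && (est y == clear_bit s k))
   (-1) ^+ count id (take k (state_bits s))
     * (edge_map k y y' * label_poly pi (sg s) (elab y') A).
    rewrite /diff_coef mulr_suml es; apply: eq_big => k; first by rewrite flip_clear.
    case/andP => yk /eqP ey; rewrite mulrA; congr (_ ^+ _ * _ * _).
    rewrite count_take_bits ey; apply: eq_card => l; rewrite !inE ffunE.
    by have [->|//] := eqVneq l k; rewrite ltnn.
  case: ifPn => // nd; rewrite big1 // => k; rewrite -flip_clear => /andP[yk /eqP ek].
  apply/eqP; rewrite mulf_eq0; apply/orP; right; apply: contraNT nd.
  rewrite -es in ek *; move/(edge_map_degrees yk ek) => [-> ->].
  by rewrite hy qy ei !eqxx.
rewrite exchange_big /=; apply: eq_bigr => k; rewrite -flip_clear => /andP[yk /eqP ek].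
by rewrite -mulr_sumr ek edge_sum.
Qed.

Lemma chain_cube_diff i i' j (f : chain D1 i j) : i' = i + 1 ->
  chain_cube (@diff_fun E1 D1 i i' j f) = dif s0 (chain_cube f).
Proof.
move=> ei; apply: eq_at => b sb; have [s eb] := state_bits_onto sb; rewrite -eb.
rewrite at_chain_cube (at_dif s0 _ c0) ?size_state_bits //.
apply/ffunP => A; rewrite !sum_ffunE.
transitivity (\sum_(y : bigraded D1 i j) (f y : rat) *
  \sum_(y' : bigraded D1 i' j | est (val y') == s)
     diff_coef (val y) (val y') * label_poly pi (sg s) (elab (val y')) A).
  rewrite [RHS](eq_bigr (fun y : bigraded D1 i j =>
    \sum_(y' : bigraded D1 i' j | est (val y') == s) (f y : rat) *
     (diff_coef (val y) (val y') * label_poly pi (sg s) (elab (val y')) A))); last first.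
    by move=> y _; rewrite mulr_sumr.
  rewrite [RHS]exchange_big /=; apply: eq_bigr => y' _; rewrite ffunE [diff_fun _ f y']ffunE.
  rewrite -[_ *: _]/(_ * _) mulr_suml; apply: eq_bigr => y _.
  by rewrite mulrA.
pose S k y := saddle (sg (est y)) (chord (k : 'I_(size D1)))
  (label_poly pi (sg (est y)) (elab y)) A.
transitivity (\sum_(y : bigraded D1 i j) \sum_(k | s k && (est (val y) == clear_bit s k))
   (-1) ^+ count id (take k (state_bits s)) * ((f y : rat) * S k (val y))).
  apply: eq_bigr => y _; have [hy qy] := bigraded_degrees y.
  rewrite (diff_coef_sum s A ei hy qy) mulr_sumr; apply: eq_bigr => k _.
  by rewrite mulrCA.
rewrite -(big_mkord (fun k : nat => nth false (state_bits s) k)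
  (fun k : nat => ((-1) ^+ count id (take k (state_bits s)) *:
     saddle (state_perm s0 D2 (unset (state_bits s) k)) (chord k)
       (at_state (chain_cube f) (unset (state_bits s) k))) A)) sizeD big_mkord.
rewrite (exchange_big_dep (fun k : 'I_(size D1) => s k)) => [|y k _ /andP[]//] /=.
apply: eq_big => [k|k sk]; first by rewrite nth_state_bits.
rewrite -(state_bits_clear s k) -/(sg _) at_chain_cube linear_sum ffunE sum_ffunE.
rewrite -[_ *: _]/(_ * _) mulr_sumr sk; apply: eq_bigr => y /eqP ey.
by rewrite linearZZ [X in _ = _ * X]ffunE /S ey.
Qed.

Lemma chain_cube_ker i j : lker (linfun (@chain_cube i j)) = 0%VS.
Proof.
apply/eqP; rewrite -subv0; apply/subvP => f; rewrite memv_ker lfunE memv0 => /eqP f0.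
by apply/eqP; rewrite -(chain_cubeK f) f0 -(linear0 (@chain_cube i j)) chain_cubeK.
Qed.

Lemma dim_cycles i j :
  \dim (cycles D1 i j) = \dim (cycle_space s0 D2 (i + (nneg D1)%:Z) (qshift j)).
Proof.
rewrite -(limg_dim_eq (f := linfun (@chain_cube i j))) ?chain_cube_ker ?capv0 //.
congr (\dim _); apply/vspaceP => w; apply/memv_imgP/cycle_spaceP => [[f fZ ->]|[wC dw]].
  rewrite lfunE; split; first exact: chain_cube_chains.
  move: fZ; rewrite memv_ker lfunE /= => /eqP df.
  by rewrite -(chain_cube_diff _ (erefl (i + 1))) df linear0.
exists (cube_chain i j w); last by rewrite lfunE /= cube_chainK.
rewrite memv_ker lfunE /=; apply/eqP; apply: (can_inj (@chain_cubeK _ _)).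
by rewrite (chain_cube_diff _ (erefl (i + 1))) cube_chainK // dw linear0.
Qed.

Lemma boundaries_img i j : (linfun (@chain_cube i j) @: boundaries D1 i j)%VS
  = boundary_space s0 D2 (i + (nneg D1)%:Z) (qshift j).
Proof.
have e1 : i = i - 1 + 1 by rewrite subrK.
have shift : i + (nneg D1)%:Z - 1 = i - 1 + (nneg D1)%:Z by rewrite addrAC.
apply/vspaceP => w; apply/memv_imgP/boundary_spaceP => [[f /memv_imgP[f' _ ->] ->]|[u]].
  rewrite !lfunE /=; exists (chain_cube f'); last exact: chain_cube_diff.
  by rewrite shift; apply: chain_cube_chains.
rewrite shift => uC ->; exists (diff_fun i (cube_chain (i - 1) j u)).
  by apply/memv_imgP; exists (cube_chain (i - 1) j u); rewrite ?memvf // lfunE.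
by rewrite lfunE /= chain_cube_diff // cube_chainK.
Qed.

Lemma dim_boundaries i j :
  \dim (boundaries D1 i j) = \dim (boundary_space s0 D2 (i + (nneg D1)%:Z) (qshift j)).
Proof. by rewrite -boundaries_img limg_dim_eq // chain_cube_ker capv0. Qed.

Lemma boundaries_cycles i j : (boundaries D1 i j <= cycles D1 i j)%VS.
Proof.
apply/subvP => f /memv_imgP[f' _ ->]; rewrite memv_ker !lfunE /=; apply/eqP.
apply: (can_inj (@chain_cubeK _ _)).
rewrite (chain_cube_diff _ (erefl (i + 1))) (@chain_cube_diff (i - 1) i) ?subrK //.
by rewrite (dif_dif wf (chain_cube_chains f')) linear0.
Qed.

Lemma khovanov_betti i j :
  (\dim (cycles D1 i j))%:Z - (\dim (boundaries D1 i j))%:Z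
  = betti s0 D2 (i + (nneg D1)%:Z) (j - (npos D1)%:Z + (nneg D1)%:Z *+ 2).
Proof. by rewrite dim_cycles dim_boundaries. Qed.

End Bridge.

(** * Quotients of equal dimension *)

Section QuotientDimension.

Variable K : fieldType.

Lemma quotient_pi_eq (V : vectType K) (U : {vspace V}) (v w : V) :
  (\pi_(quotient_space U)%qT v == \pi_(quotient_space U)%qT w) = (v - w \in U).
Proof. by rewrite -Quotient.idealrBE. Qed.

Lemma complement_maps (V W : vectType K) (U : {vspace V}) (U' : {vspace W}) :
  \dim U^C = \dim U'^C ->
  exists L : {linear V -> W}, (forall v, v \in U -> L v = 0) /\
    map L (vbasis U^C) = vbasis U'^C.
Proof.
move=> dC; have bU : basis_of fullv (vbasis U ++ vbasis U^C).
  have <- : (U + U^C)%VS = fullv by apply: addv_complf.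
  apply: cat_basis; rewrite ?vbasisP // directvE /= -dimv_disjoint_sum ?capv_compl //.
have [L HL] := linear_of_free (vbasis U ++ vbasis U^C)
  (nseq (\dim U) (0 : W) ++ vbasis U'^C).
have /eqP : map L (vbasis U ++ vbasis U^C) = nseq (\dim U) 0 ++ vbasis U'^C.
  apply: HL; first exact: basis_free bU.
  by rewrite !size_cat !size_tuple dC.
rewrite map_cat eqseq_cat ?size_map ?size_tuple // => /andP[/eqP L0 /eqP LC].
exists L; split=> // v vU; apply/eqP.
have : (U <= lker (linfun L))%VS.
  rewrite -{1}(span_basis (vbasisP U)); apply/span_subvP => u uU.
  rewrite memv_ker lfunE; have : L u \in map L (vbasis U) by apply: map_f.
  by rewrite L0 => /nseqP[-> _].
by move/subvP/(_ v vU); rewrite memv_ker lfunE.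
Qed.

Lemma complement_mapsK (V W : vectType K) (U : {vspace V}) (U' : {vspace W})
    (L : {linear V -> W}) (L' : {linear W -> V}) :
  (forall v, v \in U -> L v = 0) -> map L (vbasis U^C) = vbasis U'^C ->
  map L' (vbasis U'^C) = vbasis U^C ->
  forall v, L' (L v) - v \in U.
Proof.
move=> LU LC L'C v; have := memvf v; rewrite -(addv_complf U).
case/memv_addP => u uU [w wC ->]; rewrite linearD /= LU // add0r.
have : (U^C <= fixedSpace (linfun (L' \o L)))%VS.
  rewrite -{1}(span_basis (vbasisP U^C)%VS); apply/span_subvP => x xC.
  apply/fixedSpaceP; rewrite lfunE.
  have /eq_in_map : map (L' \o L) (vbasis U^C) = map id (vbasis U^C).
    by rewrite map_comp LC L'C map_id.
  by move/(_ x xC).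
move/subvP/(_ w wC)/fixedSpaceP; rewrite lfunE /= => ->.
by rewrite opprD addrCA subrr addr0 rpredN.
Qed.

(** Two linear maps that vanish on the subspaces and exchange bases of their complements become
    mutually inverse on the quotients. *)
Lemma quotient_space_iso (V W : vectType K) (U : {vspace V}) (U' : {vspace W}) :
  (\dim {:V} - \dim U)%N = (\dim {:W} - \dim U')%N ->
  exists f : {linear quotient_space U -> quotient_space U'}, bijective f.
Proof.
move=> dVW; have dC : \dim U^C = \dim U'^C by rewrite !dimv_compl dVW.
have [L [LU LC]] := complement_maps dC; have [L' [L'U L'C]] := complement_maps (esym dC).
have quotL (V1 V2 : vectType K) (U1 : {vspace V1}) (U2 : {vspace V2})
    (T : {linear V1 -> V2}) : (forall v, v \in U1 -> T v = 0) ->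
    exists f : {linear quotient_space U1 -> quotient_space U2},
      forall v, f (\pi_(quotient_space U1)%qT v) = \pi_(quotient_space U2)%qT (T v).
  move=> TU; pose f (x : quotient_space U1) : quotient_space U2 :=
    \pi_(quotient_space U2)%qT (T (repr x)).
  have fE v : f (\pi_(quotient_space U1)%qT v) = \pi_(quotient_space U2)%qT (T v).
    apply/eqP; rewrite quotient_pi_eq -linearB /= TU ?mem0v //.
    by rewrite -quotient_pi_eq reprK.
  have lf : linear f.
    move=> k x y; have [v ->] := quotient_pi_surj x; have [w ->] := quotient_pi_surj y.
    rewrite -[k *: _]/(quotient_scale k _) quotient_scale_pi -quotient_pi_add !fE.
    rewrite linearP quotient_pi_add -quotient_scale_pi.
    by [].
  pose g : {linear quotient_space U1 -> quotient_space U2} :=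
    HB.pack f (GRing.isLinear.Build K (quotient_space U1) (quotient_space U2) _ f lf).
  by exists g.
have [f fE] := quotL _ _ _ U' L LU; have [g gE] := quotL _ _ _ U L' L'U.
exists f; exists g => x; have [v ->] := quotient_pi_surj x.
  by rewrite fE gE; apply/eqP; rewrite quotient_pi_eq; apply: (complement_mapsK LU LC L'C).
by rewrite gE fE; apply/eqP; rewrite quotient_pi_eq; apply: (complement_mapsK L'U L'C LC).
Qed.

End QuotientDimension.

Lemma dim_subvs (K : fieldType) (V : vectType K) (U : {vspace V}) :
  \dim {:subvs_of U} = \dim U.
Proof.
rewrite -(limg_dim_eq (f := linfun vsval) (U := {:subvs_of U})).
  congr (\dim _); apply/vspaceP => w; apply/memv_imgP/idP => [[u _ ->]|wU].
    by rewrite lfunE /= subvsP.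
  by exists (vsproj U w); rewrite ?memvf // lfunE /= vsprojK.
apply/eqP; rewrite -subv0; apply/subvP => u; rewrite memv_cap memv_ker lfunE memv0.
by move=> /andP[_ /eqP u0]; apply/eqP/val_inj; rewrite u0.
Qed.

Lemma khovanov_iso (E E' : finType) (D : seq (crossing E)) (D' : seq (crossing E')) (i j : int) :
  (boundaries D i j <= cycles D i j)%VS -> (boundaries D' i j <= cycles D' i j)%VS ->
  (\dim (cycles D i j))%:Z - (\dim (boundaries D i j))%:Z
  = (\dim (cycles D' i j))%:Z - (\dim (boundaries D' i j))%:Z ->
  exists f : {linear khovanov D i j -> khovanov D' i j}, bijective f.
Proof.
have dimB (F : finType) (C : seq (crossing F)) : (boundaries C i j <= cycles C i j)%VS ->
    \dim (boundaries_in_cycles C i j) = \dim (boundaries C i j).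
  move=> BC; rewrite -(limg_dim_eq (f := linfun vsval) (U := boundaries_in_cycles C i j)).
    congr (\dim _); apply/vspaceP => w; apply/memv_imgP/idP => [[u]|wB].
      by rewrite -memv_preim => uB ->.
    have wC := subvP BC w wB; exists (vsproj (cycles C i j) w).
      by rewrite -memv_preim lfunE /= vsprojK.
    by rewrite lfunE /= vsprojK.
  apply/eqP; rewrite -subv0; apply/subvP => u; rewrite memv_cap memv_ker lfunE memv0.
  by move=> /andP[_ /eqP u0]; apply/eqP/val_inj; rewrite u0.
move=> BC BC' e; apply: quotient_space_iso.
rewrite !dimB // !dim_subvs.
have := dimvS BC; have := dimvS BC'; move: e.
by set a := \dim _; set b := \dim _; set c := \dim _; set d := \dim _; clear; lia.
Qed.

(** * Chord diagrams of the Kanenobu knots *)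

(* The crossings a, b, c, d on each side of the axis and the twist crossings on
   the [bc] and [ab] strands, counted from the top. *)
Variant site := Fa of bool | Fb of bool | Fc of bool | Fd of bool | Tbc of nat | Tab of nat.

Section Sites.

Definition site_code (c : site) : nat * bool * nat :=
  match c with
  | Fa s => (0, s, 0) | Fb s => (1, s, 0) | Fc s => (2, s, 0) | Fd s => (3, s, 0)
  | Tbc k => (4, false, k) | Tab k => (5, false, k)
  end%N.

Definition site_decode (x : nat * bool * nat) : site :=
  match x with
  | (0, s, _) => Fa s | (1, s, _) => Fb s | (2, s, _) => Fc s | (3, s, _) => Fd s
  | (4, _, k) => Tbc k | (_, _, k) => Tab k
  end%N.

Fact site_codeK : cancel site_code site_decode. Proof. by case. Qed.

End Sites.

HB.instance Definition _ := Equality.copy site (can_type site_codeK).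

Section ChordDiagram.

Variables M N : nat.
Local Notation E := (kedge M N).

Definition bc s k : E := BC s (inord k).
Definition ab s k : E := ABo s (inord k).

(** Twist sites are indexed by all natural numbers, so that one type serves every diagram; the
    bounds are imposed separately. *)
Definition valid_site (c : site) :=
  match c with Tbc k => (k < M)%N | Tab k => (k < N)%N | _ => true end.

(** The crossing that the edge enters; [site_of] and [slot_of] invert [inn], just as [out_site] and
    [out_slot] invert [out]. *)
Definition site_of (z : E) : site :=
  match z with
  | CAa => Fa true | CAc => Fc false
  | AB s => if s then Fa true else Fb false
  | AD s => if s then Fd true else Fa false
  | BD s => if s then Fb true else Fd false
  | CD1 s => if s then Fc true else Fd false
  | CD2 s => if s then Fd true else Fc false
  | BC s k =>
      if s then if val k == M then Fc true else Tbc k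
      else if val k == 0%N then Fb false else Tbc k.-1
  | ABo s k =>
      if s then if val k == N then Fb true else Tab k
      else if val k == 0%N then Fa false else Tab k.-1
  end.

Definition slot_of (z : E) : bool :=
  match z with
  | CAa => false | CAc => true
  | AB s => s
  | AD s => true
  | BD s => ~~ s
  | CD1 s => false
  | CD2 s => false
  | BC s k => if s then true else val k == 0%N
  | ABo s k => s
  end.

(* The two edges that enter the crossing [c] for the source-sink orientation,
   in which all the edges of a crossing alternate between entering and leaving. *)
Definition inn (c : site) (x : bool) : E :=
  match c with
  | Fa s => if s then if x then AB true else CAa
            else if x then AD false else ab false 0
  | Fb s => if s then if x then ab true N else BD true
            else if x then bc false 0 else AB false
  | Fc s => if s then if x then bc true M else CD1 true
            else if x then CAc else CD2 false
  | Fd s => if s then if x then AD true else CD2 true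
            else if x then BD false else CD1 false
  | Tbc k => if x then bc true k else bc false k.+1
  | Tab k => if x then ab true k else ab false k.+1
  end.

Definition out (c : site) (x : bool) : E :=
  match c with
  | Fa s => if s then if x then ab true 0 else AD true
            else if x then AB false else CAa
  | Fb s => if s then if x then AB true else bc true 0
            else if x then ab false N else BD false
  | Fc s => if s then if x then CD2 true else CAc
            else if x then bc false M else CD1 false
  | Fd s => if s then if x then CD1 true else BD true
            else if x then AD false else CD2 false
  | Tbc k => if x then bc false k else bc true k.+1
  | Tab k => if x then ab false k else ab true k.+1
  end.

Definition out_site (z : E) : site :=
  match z with
  | CAa => Fa false | CAc => Fc true
  | AB s => if s then Fb true else Fa false
  | AD s => if s then Fa true else Fd false
  | BD s => if s then Fd true else Fb false
  | CD1 s => if s then Fd true else Fc false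
  | CD2 s => if s then Fc true else Fd false
  | BC s k =>
      if s then if val k == 0%N then Fb true else Tbc k.-1
      else if val k == M then Fc false else Tbc k
  | ABo s k =>
      if s then if val k == 0%N then Fa true else Tab k.-1
      else if val k == N then Fb false else Tab k
  end.

Definition out_slot (z : E) : bool :=
  match z with
  | CAa => false | CAc => false
  | AB s => true
  | AD s => ~~ s
  | BD s => false
  | CD1 s => s
  | CD2 s => s
  | BC s k => ~~ s
  | ABo s k => if s then val k == 0%N else true
  end.

Lemma bcE s (k : 'I_M.+1) : BC s k = bc s k.
Proof. by rewrite /bc inord_val. Qed.

Lemma abE s (k : 'I_N.+1) : ABo s k = ab s k.
Proof. by rewrite /ab inord_val. Qed.

Lemma site_of_valid z : valid_site (site_of z).
Proof.
case: z => [||[]|[]|[]|[]|[]|[] k|[] k] //=; case: eqP => //= nk;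
  have := ltn_ord k; lia.
Qed.

Lemma inn_site z : inn (site_of z) (slot_of z) = z.
Proof.
case: z => [||[]|[]|[]|[]|[]|[] k|[] k] //=; rewrite ?bcE ?abE;
  case: eqP => /= [->|/eqP nk] //; by rewrite ?bcE ?abE // prednK // lt0n.
Qed.

Lemma site_innK c x : valid_site c -> site_of (inn c x) = c.
Proof.
by case: c x => [[]|[]|[]|[]|k|k] [] //= vc; rewrite inordK ?ltnS ?(ltnW vc) ?eqxx //= ltn_eqF.
Qed.

Lemma slot_innK c x : valid_site c -> slot_of (inn c x) = x.
Proof.
by case: c x => [[]|[]|[]|[]|k|k] [] //= vc; rewrite inordK ?ltnS ?(ltnW vc) ?eqxx //= ltn_eqF.
Qed.

Lemma out_siteK c x : valid_site c -> out_site (out c x) = c.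
Proof.
by case: c x => [[]|[]|[]|[]|k|k] [] //= vc; rewrite inordK ?ltnS ?(ltnW vc) ?eqxx //= ltn_eqF.
Qed.

Lemma out_slotK c x : valid_site c -> out_slot (out c x) = x.
Proof.
by case: c x => [[]|[]|[]|[]|k|k] [] //= vc; rewrite inordK ?ltnS ?(ltnW vc) ?eqxx //= ltn_eqF.
Qed.

Implicit Types (chi : site -> bool) (c d : site) (cs : seq site).

(** At a twist site the value [true] is the vertical smoothing and [false] the horizontal one,
    whatever the sign of the crossing. *)
Definition succ_edge chi (z : E) : E := out (site_of z) (slot_of z (+) chi (site_of z)).

Lemma succ_edge_inj chi : injective (succ_edge chi).
Proof.
move=> y z e; have := congr1 out_site e; have := congr1 out_slot e.
rewrite !(out_siteK, out_slotK) ?site_of_valid // => ex ec.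
rewrite -(inn_site y) -(inn_site z); move: ex; rewrite ec => /addIb.
by move->.
Qed.

Definition smoothed chi : {perm E} := perm (@succ_edge_inj chi).

Lemma smoothed_inn chi c x : valid_site c -> smoothed chi (inn c x) = out c (x (+) chi c).
Proof. by move=> vc; rewrite permE /succ_edge site_innK ?slot_innK. Qed.

Lemma eq_smoothed chi chi' : (forall c, valid_site c -> chi c = chi' c) ->
  smoothed chi = smoothed chi'.
Proof.
by move=> e; apply/permP => z; rewrite !permE /succ_edge e // site_of_valid.
Qed.

Lemma porbit_site chi c x z : valid_site c ->
  z \in porbit (smoothed chi) (out c (x (+) chi c)) -> z \in porbit (smoothed chi) (inn c x).
Proof.
move=> vc; rewrite -smoothed_inn // => zc.
exact: porbit_trans zc (porbit_step (porbit_id _ _)).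
Qed.

(** Along vertically smoothed sites the orbits run upwards on the left side and downwards on the
    right. *)
Lemma ladder_bc chi z a b : (forall k, (a <= k < b)%N -> chi (Tbc k)) -> (b <= M)%N ->
  forall k, (a <= k <= b)%N ->
  (z \in porbit (smoothed chi) (bc false a) -> z \in porbit (smoothed chi) (bc false k)) /\
  (z \in porbit (smoothed chi) (bc true b) -> z \in porbit (smoothed chi) (bc true k)).
Proof.
move=> V bM k /andP[ak kb]; split=> zk.
  elim: k ak kb => [|k IH] ak kb; first by have <- : a = 0%N by lia.
  have [ek|nk] := eqVneq a k.+1; first by rewrite -ek.
  refine (porbit_site (c := Tbc k) (x := false) _ _); first by rewrite /=; lia.
  by rewrite V /=; [apply: IH; lia | lia].
have [l el] : exists l, b = (k + l)%N by exists (b - k)%N; lia.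
elim: l k ak kb el => [|l IH] k ak kb el; first by rewrite addn0 in el; rewrite -el.
refine (porbit_site (c := Tbc k) (x := true) _ _); first by rewrite /=; lia.
by rewrite V /=; [apply: IH; lia | lia].
Qed.

Lemma ladder_ab chi z a b : (forall k, (a <= k < b)%N -> chi (Tab k)) -> (b <= N)%N ->
  forall k, (a <= k <= b)%N ->
  (z \in porbit (smoothed chi) (ab false a) -> z \in porbit (smoothed chi) (ab false k)) /\
  (z \in porbit (smoothed chi) (ab true b) -> z \in porbit (smoothed chi) (ab true k)).
Proof.
move=> V bN k /andP[ak kb]; split=> zk.
  elim: k ak kb => [|k IH] ak kb; first by have <- : a = 0%N by lia.
  have [ek|nk] := eqVneq a k.+1; first by rewrite -ek.
  refine (porbit_site (c := Tab k) (x := false) _ _); first by rewrite /=; lia.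
  by rewrite V /=; [apply: IH; lia | lia].
have [l el] : exists l, b = (k + l)%N by exists (b - k)%N; lia.
elim: l k ak kb el => [|l IH] k ak kb el; first by rewrite addn0 in el; rewrite -el.
refine (porbit_site (c := Tab k) (x := true) _ _); first by rewrite /=; lia.
by rewrite V /=; [apply: IH; lia | lia].
Qed.

Definition closed_in chi (P : pred E) := forall c x,
  valid_site c -> P (inn c x) -> P (out c (x (+) chi c)).

Lemma closed_smoothed chi P x : closed_in chi P -> P x -> P (smoothed chi x).
Proof.
by move=> cP; rewrite permE -{1}(inn_site x); apply: cP; apply: site_of_valid.
Qed.

Lemma two_circles chi (P : pred E) g h : closed_in chi P -> P g -> ~~ P h ->
  (forall z, P z -> g \in porbit (smoothed chi) z) ->
  (forall z, ~~ P z -> h \in porbit (smoothed chi) z) ->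
  forall z, (z \in porbit (smoothed chi) g) (+) (z \in porbit (smoothed chi) h).
Proof.
move=> cP Pg Ph rg rh z; rewrite ![z \in _]porbit_sym.
have cl y t : P y -> t \in porbit (smoothed chi) y -> P t.
  by move=> Py; apply: porbit_ind t => // e; apply: closed_smoothed.
case: (boolP (P z)) => Pz; first by rewrite rg //; apply: contra Ph; apply: cl.
rewrite rh // addbT; apply: contra Pz => gz; apply: cl Pg _.
by rewrite porbit_sym.
Qed.

Definition chord c : E * E := (inn c false, inn c true).

Definition resmooth c b chi : site -> bool := fun d => if d == c then b else chi d.

Lemma toggle_smoothed chi c : valid_site c ->
  toggle (chord c) (smoothed chi) = smoothed (resmooth c (~~ chi c) chi).
Proof.
move=> vc; apply/permP => z; rewrite /toggle permM.
rewrite -(inn_site z); set d := site_of z; set x := slot_of z.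
have vd : valid_site d := site_of_valid z.
rewrite [RHS]smoothed_inn // /resmooth; have [->|nd] := eqVneq d c.
  have -> : tperm (chord c).1 (chord c).2 (inn c x) = inn c (~~ x).
    by case: x; rewrite ?tpermL ?tpermR.
  by rewrite smoothed_inn // addbN addNb.
rewrite tpermD ?smoothed_inn //; apply: contraNneq nd => e;
  by rewrite -(site_innK x vd) -e site_innK.
Qed.

Lemma inn_inj c d x y : valid_site c -> valid_site d -> inn c x = inn d y -> c = d /\ x = y.
Proof.
move=> vc vd e; have ec := congr1 site_of e; have ex := congr1 slot_of e.
by rewrite !site_innK // in ec; rewrite !slot_innK // in ex.
Qed.

Local Notation chords cs := [seq chord c | c <- cs].

Lemma endpoint_chord cs e : all valid_site cs ->
  (e \in endpoints (chords cs)) = (site_of e \in cs).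
Proof.
elim: cs => //= c cs IH /andP[vc vs]; rewrite /endpoints /= !inE -/(endpoints _) IH //.
rewrite orbA; congr (_ || _); apply/orP/eqP => [[/eqP->|/eqP->]|<-]; rewrite ?site_innK //.
by rewrite -{1 3}(inn_site e); case: slot_of; [right|left].
Qed.

Lemma wf_chords_sites cs : uniq cs -> all valid_site cs -> wf_chords (chords cs).
Proof.
elim: cs => //= c cs IH /andP[nc us] /andP[vc vs]; rewrite IH // andbT.
rewrite all_disjoint_chords !endpoint_chord // !site_innK // !nc !andbT.
by apply/eqP => /inn_inj [].
Qed.

Lemma avoids_site cs e : site_of e \notin cs -> all valid_site cs ->
  all (fun c : E * E => (e != c.1) && (e != c.2)) (chords cs).
Proof.
move=> nc /allP vs; rewrite all_map; apply/allP => c cs' /=.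
apply/andP; split; apply: contraNneq nc => ->; rewrite site_innK //; exact: vs.
Qed.

Definition unlink chi cs g h i0 j0 := unlink_homology (smoothed chi) (chords cs) g h i0 j0.

Lemma eq_unlink chi chi' cs g h i0 j0 : (forall c, valid_site c -> chi c = chi' c) ->
  unlink chi cs g h i0 j0 -> unlink chi' cs g h i0 j0.
Proof. by move=> e; rewrite /unlink (eq_smoothed e). Qed.

Lemma unlink_perm chi cs cs' g h i0 j0 : uniq cs' -> all valid_site cs' -> perm_eq cs' cs ->
  unlink chi cs g h i0 j0 -> unlink chi cs' g h i0 j0.
Proof.
move=> us vs p; apply: unlink_homology_perm; last by rewrite perm_map // perm_sym.
by rewrite wf_chords_sites // -?(perm_uniq p) // -(eq_all_r (perm_mem p)).
Qed.

(** The site [c] is smoothed for good, so the mark slides along the strand through it. *)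
Lemma unlink_move chi cs c x g i0 j0 : valid_site c -> c \notin cs -> all valid_site cs ->
  unlink chi cs g (out c (x (+) chi c)) i0 j0 -> unlink chi cs g (inn c x) i0 j0.
Proof.
move=> vc nc vs U; apply/unlink_homologyC/unlink_homology_succ.
  by apply: avoids_site => //; rewrite site_innK.
by rewrite smoothed_inn //; apply: unlink_homologyC.
Qed.

Lemma unlink_ladder_left chi cs a b g i0 j0 :
  (forall k, (a <= k < b)%N -> chi (Tab k) && (Tab k \notin cs)) -> (b <= N)%N ->
  all valid_site cs -> (a <= b)%N ->
  unlink chi cs g (ab false a) i0 j0 -> unlink chi cs g (ab false b) i0 j0.
Proof.
move=> V; elim: b V => [|b IH] V bN vs ab U; first by move: ab U; rewrite leqn0 => /eqP->.
have [<-//|nab] := eqVneq a b.+1.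
have /andP[Vb nb] : chi (Tab b) && (Tab b \notin cs) by apply: V; lia.
refine (unlink_move (c := Tab b) (x := false) bN nb vs _); rewrite Vb /=.
apply: IH U => //; [by move=> k kb; apply: V; lia | exact: ltnW | lia].
Qed.

Lemma unlink_ladder_right chi cs b g i0 j0 l a :
  (forall k, (a <= k < b)%N -> chi (Tab k) && (Tab k \notin cs)) -> (b <= N)%N ->
  all valid_site cs -> (a + l)%N = b ->
  unlink chi cs g (ab true b) i0 j0 -> unlink chi cs g (ab true a) i0 j0.
Proof.
move=> V bN vs; elim: l a V => [|l IH] a V ab U; first by rewrite -[a]addn0 ab.
have /andP[Vb nb] : chi (Tab a) && (Tab a \notin cs) by apply: V; lia.
refine (unlink_move (c := Tab a) (x := true) _ nb vs _); first by rewrite /=; lia.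
rewrite Vb /=; apply: IH U; last lia.
by move=> k kb; apply: V; lia.
Qed.

(** Here [c] is still a crossing. The mark jumps to the other entering edge, and the sign is
    absorbed by the coefficients. *)
Lemma unlink_pass chi cs c x g i0 j0 : uniq cs -> all valid_site cs -> c \in cs ->
  unlink chi cs g (inn c x) i0 j0 -> unlink chi cs g (inn c (~~ x)) i0 j0.
Proof.
move=> us vs cc U; apply: unlink_homologyC; apply: (@unlink_homology_pass _ _ (chord c) _ (inn c x)).
- exact: wf_chords_sites.
- by apply: map_f.
- by rewrite /chord; case: x U; rewrite !eqxx ?orbT.
- exact: unlink_homologyC.
Qed.

Lemma eq_degrees chi cs g h i0 j0 i1 j1 : i0 = i1 -> j0 = j1 ->
  unlink chi cs g h i0 j0 -> unlink chi cs g h i1 j1.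
Proof. by move=> -> ->. Qed.

Lemma unlinkC chi cs g h i0 j0 : unlink chi cs g h i0 j0 -> unlink chi cs h g i0 j0.
Proof. exact: unlink_homologyC. Qed.

Lemma swap_chord chi c x cs g h i0 j0 :
  unlink_homology (smoothed chi) ((inn c x, inn c (~~ x)) :: chords cs) g h i0 j0 ->
  unlink chi (c :: cs) g h i0 j0.
Proof. by case: x => //; apply: unlink_homology_swap. Qed.

Lemma toggle_slots chi c x : valid_site c ->
  toggle (inn c x, inn c (~~ x)) (smoothed chi) = smoothed (resmooth c (~~ chi c) chi).
Proof. by case: x => vc; rewrite -toggle_smoothed // toggle_swap. Qed.

Lemma wf_slots c x cs : uniq (c :: cs) -> all valid_site (c :: cs) ->
  wf_chords ((inn c x, inn c (~~ x)) :: chords cs).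
Proof.
move=> us vs; have := wf_chords_sites us vs; case: x => //=.
by rewrite !all_disjoint_chords /= eq_sym => /and3P[-> /andP[-> ->] ->].
Qed.

Section Curl.

Variables (P : pred E) (g h : E) (cs : seq site) (i0 j0 : int).
Hypotheses (Pg : ~~ P g) (Ph : ~~ P h).
Hypothesis Pcs : all (fun c => ~~ P (inn c false) && ~~ P (inn c true)) cs.

(* A curl is undone by the smoothing [true], its loop being cut off by the
   smoothing [false]; [chi c] tells which of the two is the 0-smoothing. *)
Lemma unlink_curl chi c x i1 j1 : uniq (c :: cs) -> all valid_site (c :: cs) ->
  ~~ P (inn c x) -> P (inn c (~~ x)) -> closed_in (resmooth c false chi) P ->
  i1 = i0 + (chi c)%:Z -> j1 = j0 + (if chi c then 2 else - 1) ->
  unlink (resmooth c true chi) cs g h i0 j0 -> unlink chi (c :: cs) g h i1 j1.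
Proof.
move=> us vs Px Px' cP -> ->; have /andP[vc _] := vs.
have Pcs' : all (fun c : E * E => ~~ P c.1 && ~~ P c.2) (chords cs) by rewrite all_map.
have cP' := fun y => @closed_smoothed _ _ y cP.
case ec: (chi c); move=> U; apply: (@swap_chord _ _ x).
  apply: (unlink_homology_split_kink Pg Ph Pcs' (wf_slots _ us vs) Px Px').
    by rewrite toggle_slots // ec.
  by apply: eq_unlink U => d _; rewrite /resmooth; case: eqP => // ->.
rewrite [i0 + _]addr0; apply: (unlink_homology_merge_kink Pg Ph Pcs' (wf_slots _ us vs) Px Px').
  rewrite (@eq_smoothed chi (resmooth c false chi)) // => d _.
  by rewrite /resmooth; case: eqP => // ->.
by rewrite toggle_slots // ec.
Qed.

(* [c1] and [c2] are the two crossings of a bigon, whose boundary is the circle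
   that appears when only [c2] is 1-smoothed. *)
Lemma unlink_bigon chi c1 c2 x1 x2 i1 j1 :
  uniq [:: c1, c2 & cs] -> all valid_site [:: c1, c2 & cs] ->
  ~~ P (inn c1 x1) -> ~~ P (inn c2 x2) -> P (inn c2 (~~ x2)) ->
  ~~ chi c1 -> ~~ chi c2 -> closed_in (resmooth c2 true chi) P ->
  inn c1 (~~ x1) \in porbit (smoothed (resmooth c2 true chi)) (inn c2 (~~ x2)) ->
  i1 = i0 + 1 -> j1 = j0 + 1 ->
  unlink (resmooth c1 true chi) cs g h i0 j0 -> unlink chi [:: c1, c2 & cs] g h i1 j1.
Proof.
move=> us vs P1 P2 P2' n1 n2 cP O -> -> U; have /and3P[v1 v2 vs'] := vs.
have Pcs' : all (fun c : E * E => ~~ P c.1 && ~~ P c.2) (chords cs) by rewrite all_map.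
have cP' := fun y => @closed_smoothed _ _ y cP.
move: (us) => /= /andP[]; rewrite inE negb_or => /andP[n12 nc1] us2.
have n12i y z : inn c1 y == inn c2 z = false by apply/eqP => /inn_inj [] // e; rewrite e eqxx in n12.
have nii y : inn c1 y != inn c1 (~~ y) by apply/eqP => /inn_inj [] // _; case: y.
have wf y z : wf_chords [:: (inn c1 y, inn c1 (~~ y)), (inn c2 z, inn c2 (~~ z)) & chords cs].
  have /= -> : wf_chords ((inn c2 z, inn c2 (~~ z)) :: chords cs).
    by apply: wf_slots => //=; rewrite v2.
  rewrite andbT nii /= all_disjoint_chords !endpoint_chord // !site_innK // nc1 andbT.
  by rewrite /disjoint_chords /= !n12i.
have flip2 (A B : E * E) L : perm_eq [:: A, B & L] [:: B, A & L].
  by rewrite -[[:: A, B & L]]/([:: A] ++ [:: B] ++ L) perm_catCA.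
have U' : unlink_homology (smoothed chi)
    [:: (inn c1 x1, inn c1 (~~ x1)), (inn c2 x2, inn c2 (~~ x2)) & chords cs] g h (i0 + 1) (j0 + 1).
  apply: (unlink_homology_bigon Pg Ph Pcs' (wf _ _) P1 P2 P2').
  - by rewrite toggle_slots // n2.
  - by rewrite toggle_slots // n2.
  - by rewrite toggle_slots // n1.
apply: (@swap_chord _ _ x1); case: x2 U' {P2 P2' O} => // U'.
apply: (unlink_homology_perm _ (flip2 _ _ _)).
  by rewrite (perm_wf_chords (flip2 _ _ _)) (wf x1 false).
apply: unlink_homology_swap; exact: unlink_homology_perm U'.
Qed.

End Curl.

End ChordDiagram.

Arguments bc M N s k : simpl never.
Arguments ab M N s k : simpl never.

(* The first four bits are the smoothings at a, b, c, d, the next four those at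
   their mirror images. *)
Definition smoothings (a b c d a' b' c' d' : bool) (u v : nat -> bool) (x : site) : bool :=
  match x with
  | Fa s => if s then a' else a | Fb s => if s then b' else b
  | Fc s => if s then c' else c | Fd s => if s then d' else d
  | Tbc k => u k | Tab k => v k
  end.

Section Regions.

Variables M N : nat.
Local Notation E := (kedge M N).

(** The loops of curls and the boundaries of bigons are all described in this form: a list of fixed
    edges, and a condition on side and index for the edges of each twist region. *)
Definition region (l : seq E) (pb pa : bool -> nat -> bool) (z : E) : bool :=
  match z with BC s k => pb s k | ABo s k => pa s k | _ => z \in l end.

Lemma region_bc l pb pa s k : (k <= M)%N -> region l pb pa (bc M N s k) = pb s k.
Proof. by move=> kM; rewrite /= inordK. Qed.

Lemma region_ab l pb pa s k : (k <= N)%N -> region l pb pa (ab M N s k) = pa s k.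
Proof. by move=> kN; rewrite /= inordK. Qed.

End Regions.

Arguments region M N l pb pa z : simpl never.

(* Locked, so that simplification does not unfold the list. *)
Definition twist_sites b m a n :=
  locked ([seq Tbc k | k <- iota b m] ++ [seq Tab k | k <- iota a n]).

Lemma twist_sitesE b m a n :
  twist_sites b m a n = [seq Tbc k | k <- iota b m] ++ [seq Tab k | k <- iota a n].
Proof. by rewrite /twist_sites -lock. Qed.

Definition fixed_site c := match c with Tbc _ => false | Tab _ => false | _ => true end.

Lemma fixed_twist c b m a n : fixed_site c -> (c \in twist_sites b m a n) = false.
Proof.
by move=> fc; rewrite twist_sitesE mem_cat; apply/norP; split; apply/mapP => -[k _ ec]; rewrite ec in fc.
Qed.

Lemma Tbc_twist k b m a n : (Tbc k \in twist_sites b m a n) = (b <= k < b + m)%N.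
Proof.
rewrite twist_sitesE mem_cat mem_map => [|? ? []//]; rewrite mem_iota orbC.
by case: mapP => //= -[].
Qed.

Lemma Tab_twist k b m a n : (Tab k \in twist_sites b m a n) = (a <= k < a + n)%N.
Proof.
rewrite twist_sitesE mem_cat [X in _ || X]mem_map => [|? ? []//]; rewrite mem_iota.
by case: mapP => //= -[].
Qed.

Lemma uniq_twist_sites b m a n : uniq (twist_sites b m a n).
Proof.
rewrite twist_sitesE cat_uniq !map_inj_uniq ?iota_uniq => [|? ? []//|? ? []//]; rewrite andbT.
by apply/hasPn => _ /mapP[k _ ->]; apply/mapP => -[].
Qed.

Lemma eq_Tbc k l : (Tbc k == Tbc l) = (k == l).
Proof. by apply/eqP/eqP => [[]|->]. Qed.

Lemma eq_Tab k l : (Tab k == Tab l) = (k == l).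
Proof. by apply/eqP/eqP => [[]|->]. Qed.

Lemma all_twist_sites b m a n (P : pred site) :
  (forall k, (b <= k < b + m)%N -> P (Tbc k)) -> (forall k, (a <= k < a + n)%N -> P (Tab k)) ->
  all P (twist_sites b m a n).
Proof.
move=> Pb Pa; rewrite twist_sitesE all_cat !all_map; apply/andP; split; apply/allP => k;
  by rewrite mem_iota => kl; first [exact: Pb | exact: Pa].
Qed.

Lemma valid_twist_sites M N b m a n : (b + m <= M)%N -> (a + n <= N)%N ->
  all (valid_site M N) (twist_sites b m a n).
Proof.
by move=> mM nN; apply: all_twist_sites => k /andP[_ kl]; apply: leq_trans kl _.
Qed.

Lemma perm_Tab_first b m a n :
  perm_eq (twist_sites b m a n.+1) (Tab a :: twist_sites b m a.+1 n).
Proof. by rewrite !twist_sitesE /= perm_sym (perm_catCA [:: _]). Qed.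

Lemma perm_Tbc_first b m a n :
  perm_eq (twist_sites b m.+1 a n) (Tbc b :: twist_sites b.+1 m a n).
Proof. by rewrite !twist_sitesE. Qed.

Lemma perm_Tab_last b m a n :
  perm_eq (twist_sites b m a n.+1) (Tab (a + n)%N :: twist_sites b m a n).
Proof.
by rewrite !twist_sitesE -addn1 iotaD map_cat catA perm_catC.
Qed.

Ltac clear_sites := rewrite /= ?inE ?(Tbc_twist, Tab_twist) ?fixed_twist ?uniq_twist_sites
  ?valid_twist_sites ?ltnn //=; try lia.

Ltac in_region := rewrite /=;
  repeat match goal with
  | |- context [region _ _ _ (bc ?M _ _ ?k)] =>
      let H := fresh in (have H : (k <= M)%N by lia); rewrite (region_bc _ _ _ _ H) {H}
  | |- context [region _ _ _ (ab _ ?N _ ?k)] =>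
      let H := fresh in (have H : (k <= N)%N by lia); rewrite (region_ab _ _ _ _ H) {H}
  end; rewrite ?/region //=.

Ltac case_if :=
  match goal with |- context [if ?b then _ else _] => case: (boolP b) end.

Ltac close_region :=
  let vc := fresh "vc" in let k' := fresh "k" in
  case=> [[]|[]|[]|[]|k'|k'] [] vc; rewrite /resmooth /=; rewrite /= in vc;
  rewrite ?eq_Tbc ?eq_Tab;
  try (match goal with |- context [if (?a == ?b) then _ else _] => case: (eqVneq a b) end);
  try case_if; in_region; move: vc; try lia.

Ltac split_andb := repeat match goal with |- is_true (_ && _) => apply/andP; split end.

Ltac avoid_region :=
  rewrite /=; split_andb;
  first [let k' := fresh "k" in let kl := fresh in
         apply: all_twist_sites => k' kl; split_andb | idtac];
  in_region; try lia.

Ltac region_side :=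
  lazymatch goal with
  | |- closed_in _ _ => close_region
  | |- is_true (uniq _) => clear_sites
  | |- is_true (_ \in porbit _ _) => idtac
  | |- is_true (all (valid_site _ _) _) => clear_sites
  | |- is_true (_ \notin _) => clear_sites
  | |- is_true (_ \in _) => clear_sites
  | |- _ = _ :> int => rewrite /= ?ltnn; try lia
  | |- unlink _ _ _ _ _ _ => idtac
  | |- _ => avoid_region
  end.

Ltac walk c0 x0 := refine (porbit_site (c := c0) (x := x0) _ _); [by rewrite /=; try lia | rewrite /resmooth /=].

Ltac move_mark c0 x0 := refine (unlink_move (c := c0) (x := x0) _ _ _ _);
  [by clear_sites | by clear_sites; try lia | by clear_sites | rewrite /= ].

Ltac pass_mark c0 x0 := refine (unlink_pass (c := c0) (x := x0) _ _ _ _);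
  [by clear_sites | by clear_sites | by clear_sites | rewrite /= ].

Ltac restate S := refine (@eq_unlink _ _ S _ _ _ _ _ _ _ _);
  [by case=> [[]|[]|[]|[]|k|k] _; rewrite /resmooth /= | ].

(** * The unlink obtained from the last [bc] twist *)

Section LastBC.

Variables (m n : nat) (x y : bool).
Local Notation M := m.+1.
Local Notation N := n.
Local Notation E := (kedge M N).
Local Notation bc := (bc M N).
Local Notation ab := (ab M N).

Local Notation u := (fun k => (k < m)%N && x).

Local Notation state a b c d a' b' c' d' := (smoothings a b c d a' b' c' d' u (fun=> y)).

Lemma last_bc_bigons i j :
  unlink (M := M) (N := N) (state false true true true true false false false) (twist_sites 0 m 0 n)
    (bc false m) (ab true N) i j ->
  unlink (M := M) (N := N) (state false false false false false false false false)
    ([:: Fc false; Fc true; Fd false; Fd true; Fa true; Fa false; Fb false; Fb true] ++ twist_sites 0 m 0 n)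
    (bc false m) (bc false M) (i + 4) (j + 4).
Proof.
move=> U; have uc : u m = false by rewrite ltnn.
move_mark (Tbc m) false; rewrite uc /=.
pass_mark (Fc true) false.
apply: (@unlink_bigon _ _ (region [:: CAc] (fun _ k => k == M) (fun _ _ => false))
  _ _ _ (i + 3) (j + 3) _ _ _ _ (Fc false) (Fc true) false false); region_side.
  by walk (Fc true) true; apply: porbit_id.
restate (state false false true false false false false false).
move_mark (Fc true) false; move_mark (Fc false) true; pass_mark (Fd false) true.
apply: (@unlink_bigon _ _ (region [:: CD1 false; CD2 false; CD2 true; CD1 true; CAc]
    (fun _ k => k == M) (fun _ _ => false))
  _ _ _ (i + 2) (j + 2) _ _ _ _ (Fd false) (Fd true) true true); region_side.
  walk (Fd true) false; walk (Fc true) false; walk (Fc false) true; exact: porbit_id.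
restate (state false false true true false false false false).
move_mark (Fd false) true; move_mark (Fc false) false; move_mark (Tbc m) false; rewrite uc /=.
move_mark (Fc true) true; move_mark (Fd true) false.
apply: (@unlink_bigon _ _ (region [:: AD false; CAa; AD true; CD1 true; CAc; CD1 false]
    (fun _ k => false) (fun _ _ => false))
  _ _ _ (i + 1) (j + 1) _ _ _ _ (Fa true) (Fa false) true false); region_side.
  by walk (Fa false) true; exact: porbit_id.
restate (state false false true true true false false false).
pass_mark (Fb true) true.
apply: (@unlink_bigon _ _ (region [:: AB false; BD false; CD2 false; CD2 true; BD true; AB true;
      AD true; CD1 true; CAc; CD1 false; AD false] (fun _ k => k == M) (fun _ _ => false))
  _ _ _ i j _ _ _ _ (Fb false) (Fb true) true true); region_side.
  walk (Fb true) false; walk (Fa true) true; walk (Fd true) true; walk (Fc true) false.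
  by walk (Fc false) true; walk (Fd false) false; walk (Fa false) true; exact: porbit_id.
restate (state false true true true true false false false); exact: U.
Qed.

Local Notation end_state u v := (smoothings false true true true true false false false u v).

(** From the top down, each [ab] twist is a curl whose loop passes through [CAa] and the sites
    above, already smoothed vertically. A positive crossing shifts by (0,-1), a negative one by
    (1,2). *)
Lemma last_bc_ab_curls i j :
  unlink (M := M) (N := N) (end_state u (fun=> true)) (twist_sites 0 m 0 0)
    (bc false m) (ab true N) i j ->
  unlink (M := M) (N := N) (end_state u (fun=> y)) (twist_sites 0 m 0 n) (bc false m) (ab true N)
    (i + (if y then n%:Z else 0)) (j + (if y then 2 * n%:Z else - n%:Z)).
Proof.
(* Sites before [k] are already smoothed vertically; the [l] sites from [k] on are still
   crossings. *)
move=> U; suff H l k i1 j1 : (k + l)%N = n ->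
    i1 = i + (if y then l%:Z else 0) -> j1 = j + (if y then 2 * l%:Z else - l%:Z) ->
    unlink (M := M) (N := N) (end_state u (fun j => (j < k)%N || y))
      (twist_sites 0 m k l) (bc false m) (ab true N) i1 j1.
  by apply: eq_unlink (H n 0%N _ _ (add0n n) (erefl _) (erefl _)); case.
elim: l k i1 j1 => [|l IH] k i1 j1 kl ei ej.
  have -> : i1 = i by rewrite ei if_same addr0.
  rewrite (_ : twist_sites _ _ _ _ = twist_sites 0 m 0 0); last by rewrite !twist_sitesE.
  have -> : j1 = j by rewrite ej mulr0 oppr0 if_same addr0.
  by apply: eq_unlink U => -[] //= k'; lia.
apply: (unlink_perm _ _ (perm_Tab_first _ _ _ _)); [by clear_sites|by clear_sites|].
apply: (@unlink_curl _ _ (region [:: CAa] (fun _ _ => false) (fun _ j => (j <= k)%N))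
  _ _ _ (i + (if y then l%:Z else 0)) (j + (if y then 2 * l%:Z else - l%:Z)) _ _ _ _ (Tab k) false).
all: region_side.
- by rewrite ltnn /= ei; clear; case: y; lia.
- by rewrite ltnn /= ej; clear; case: y; lia.
- apply: eq_unlink (IH k.+1 _ _ _ (erefl _) (erefl _)); last by lia.
  by case=> //= k' _; rewrite /resmooth eq_Tab /=; case: eqP => /=; lia.
Qed.

(** Again from the top; the loop now goes through [BD] and [CD2] on both sides and through the edges
    below the horizontal smoothing. *)
Lemma last_bc_bc_curls i j :
  unlink (M := M) (N := N) (end_state (fun k => (k < m)%N) (fun=> true)) [::]
    (bc false m) (ab true N) i j ->
  unlink (M := M) (N := N) (end_state u (fun=> true)) (twist_sites 0 m 0 0)
    (bc false m) (ab true N)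
    (i + (if x then m%:Z else 0)) (j + (if x then 2 * m%:Z else - m%:Z)).
Proof.
move=> U; suff H l k i1 j1 : (k + l)%N = m ->
    i1 = i + (if x then l%:Z else 0) -> j1 = j + (if x then 2 * l%:Z else - l%:Z) ->
    unlink (M := M) (N := N) (end_state (fun j => (j < m)%N && ((j < k)%N || x)) (fun=> true))
      (twist_sites k l 0 0) (bc false m) (ab true N) i1 j1.
  by apply: eq_unlink (H m 0%N _ _ (add0n m) (erefl _) (erefl _)); case.
elim: l k i1 j1 => [|l IH] k i1 j1 kl ei ej.
  have -> : i1 = i by rewrite ei if_same addr0.
  rewrite twist_sitesE.
  have -> : j1 = j by rewrite ej mulr0 oppr0 if_same addr0.
  by apply: eq_unlink U => -[] //= k'; lia.
have km : (k < m)%N by lia.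
apply: (unlink_perm _ _ (perm_Tbc_first _ _ _ _)); [by clear_sites|by clear_sites|].
apply: (@unlink_curl _ _ (region [:: BD false; CD2 false; CD2 true; BD true]
    (fun _ j => (j <= k)%N || (j == M)) (fun _ _ => false))
  _ _ _ (i + (if x then l%:Z else 0)) (j + (if x then 2 * l%:Z else - l%:Z)) _ _ _ _ (Tbc k) false).
all: region_side.
- by rewrite ?ltnn km /= ei; clear; case: x; lia.
- by rewrite ?ltnn km /= ej; clear; case: x; lia.
- apply: eq_unlink (IH k.+1 _ _ _ (erefl _) (erefl _)); last by lia.
  by case=> //= k' _; rewrite /resmooth eq_Tbc /=; case: eqP => /=; lia.
Qed.

Lemma last_bc_circles :
  unlink (M := M) (N := N) (end_state (fun k => (k < m)%N) (fun=> true)) [::]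
    (bc false m) (ab true N) 0 2.
Proof.
apply: unlink_homology_two_circles.
set s := smoothed _ _ _.
pose P := region (M := M) (N := N) [:: BD false; CD2 false; CD2 true; BD true] (fun _ _ => true) (fun _ _ => false).
have cP : closed_in (end_state (fun k => (k < m)%N) (fun=> true)) P.
  by close_region.
apply: (two_circles cP).
- by rewrite /P; in_region.
- by rewrite /P; in_region.
- have lad := @ladder_bc M N (end_state (fun k => (k < m)%N) (fun=> true)) (bc false m) 0 m.
  have r1 k : (k <= m)%N -> bc false m \in porbit s (bc true k).
    move=> km; have [] // := lad _ (leqnSn m) k.
    by move=> _; apply; walk (Tbc m) true; rewrite ltnn; exact: porbit_id.
  have rB' : bc false m \in porbit s (BD true) by walk (Fb true) false; apply: r1.
  have rC' : bc false m \in porbit s (CD2 true) by walk (Fd true) false.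
  have rt : bc false m \in porbit s (bc true M) by walk (Fc true) true.
  have rf : bc false m \in porbit s (bc false M) by walk (Tbc m) false; rewrite ltnn.
  have rC : bc false m \in porbit s (CD2 false) by walk (Fc false) false.
  have rB : bc false m \in porbit s (BD false) by walk (Fd false) true.
  have r2 k : (k <= m)%N -> bc false m \in porbit s (bc false k).
    move=> km; have [] // := lad _ (leqnSn m) k.
    by move=> + _; apply; walk (Fb false) true.
  case=> [||[]|[]|[]|[]|[]|b k|b k] //= _; rewrite bcE.
  have := ltn_ord k; rewrite ltnS leq_eqVlt => /orP[/eqP->|km]; first by case: b.
  by case: b; [apply: r1|apply: r2].
- have lad := @ladder_ab M N (end_state (fun k => (k < m)%N) (fun=> true)) (ab true n) 0 n.
  have r1 k : (k <= n)%N -> ab true n \in porbit s (ab true k).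
    by move=> kn; have [] // := lad _ (leqnn n) k; move=> _; apply; exact: porbit_id.
  have rAa : ab true n \in porbit s CAa by walk (Fa true) false; apply: r1.
  have r0 : ab true n \in porbit s (ab false 0) by walk (Fa false) false.
  have r2 k : (k <= n)%N -> ab true n \in porbit s (ab false k).
    by move=> kn; have [] // := lad _ (leqnn n) k; move=> + _; apply.
  have rA : ab true n \in porbit s (AB false) by walk (Fb false) false; apply: r2.
  have rD : ab true n \in porbit s (AD false) by walk (Fa false) true.
  have rC : ab true n \in porbit s (CD1 false) by walk (Fd false) false.
  have rc : ab true n \in porbit s CAc by walk (Fc false) true.
  have rC' : ab true n \in porbit s (CD1 true) by walk (Fc true) false.
  have rD' : ab true n \in porbit s (AD true) by walk (Fd true) true.
  have rA' : ab true n \in porbit s (AB true) by walk (Fa true) true.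
  case=> [||[]|[]|[]|[]|[]|b k|b k] //= _; rewrite abE.
  by have := ltn_ord k; rewrite ltnS; case: b; [apply: r1|apply: r2].
Qed.

(** Two circles give (0,2) and the four bigons (4,4); the remaining terms come from the curls. *)
Lemma unlink_last_bc :
  unlink (M := M) (N := N) (state false false false false false false false false)
    ([:: Fc false; Fc true; Fd false; Fd true; Fa true; Fa false; Fb false; Fb true] ++ twist_sites 0 m 0 n)
    (bc false m) (bc false M)
    (4 + (if x then m%:Z else 0) + (if y then n%:Z else 0))
    (6 + (if x then 2 * m%:Z else - m%:Z) + (if y then 2 * n%:Z else - n%:Z)).
Proof.
apply: eq_degrees (last_bc_bigons (last_bc_ab_curls (last_bc_bc_curls last_bc_circles))).
  by clear; case: x; case: y; lia.
by clear; case: x; case: y; lia.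
Qed.

End LastBC.

(** * The unlink obtained from the last [ab] twist *)

Section LastAB.

Variables (m n : nat) (x y : bool).
Local Notation M := m.
Local Notation N := n.+1.
Local Notation E := (kedge M N).
Local Notation bc := (bc M N).
Local Notation ab := (ab M N).
Local Notation state a b c d a' b' c' d' :=
  (smoothings a b c d a' b' c' d' (fun=> x) (fun k => (k < n)%N)).
Local Notation start v := (smoothings false false false false false false false false (fun=> x) v).
Local Notation fixed_sites :=
  [:: Fa false; Fa true; Fb true; Fb false; Fd false; Fd true; Fc false; Fc true].

(** Here the curls are undone from the bottom, their loops closing up at the horizontal smoothing of
    [Tab n]. The mark [ab false n] lies on each of these loops; it leaves by passing the crossing
    and returns to its place once the crossing is smoothed. *)
Lemma last_ab_ab_curls i j :
  unlink (M := M) (N := N) (start (fun k => (k < n)%N)) (fixed_sites ++ twist_sites 0 m 0 0)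
    (BD true) (ab false n) i j ->
  unlink (M := M) (N := N) (start (fun k => (k < n)%N && y)) (fixed_sites ++ twist_sites 0 m 0 n)
    (BD true) (ab false n) (i + (if y then n%:Z else 0)) (j + (if y then 2 * n%:Z else - n%:Z)).
Proof.
move=> U; suff H l i1 j1 : (l <= n)%N ->
    i1 = i + (if y then l%:Z else 0) -> j1 = j + (if y then 2 * l%:Z else - l%:Z) ->
    unlink (M := M) (N := N) (start (fun j => (j < n)%N && ((l <= j)%N || y)))
      (fixed_sites ++ twist_sites 0 m 0 l) (BD true) (ab false n) i1 j1.
  apply: eq_unlink (H n _ _ (leqnn n) (erefl _) (erefl _)).
  by case=> //= k _; case: ltnP.
elim: l i1 j1 => [|l IH] i1 j1 ln ei ej.
  have -> : i1 = i by rewrite ei if_same addr0.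
  have -> : j1 = j by rewrite ej mulr0 oppr0 if_same addr0.
  by apply: eq_unlink U => -[] //= k'; lia.
apply: (unlink_ladder_left _ _ _ (a := l.+1)); [|by []|by clear_sites|by []|].
  by move=> k; clear_sites.
pass_mark (Tab l) true.
have p : perm_eq (fixed_sites ++ twist_sites 0 m 0 l.+1) (Tab l :: fixed_sites ++ twist_sites 0 m 0 l).
  by rewrite -[Tab l :: _]cat1s perm_sym perm_catCA perm_cat2l perm_sym perm_Tab_last.
apply: (unlink_perm _ _ p); [by clear_sites|by clear_sites|].
apply: (@unlink_curl _ _ (region [::] (fun _ _ => false) (fun _ j => (l < j <= n)%N))
  _ _ _ (i + (if y then l%:Z else 0)) (j + (if y then 2 * l%:Z else - l%:Z)) _ _ _ _ (Tab l) true).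
all: region_side.
- by rewrite ln ltnn /= ei; clear; case: y; lia.
- by rewrite ln ltnn /= ej; clear; case: y; lia.
refine (@eq_unlink _ _ (start (fun j => (j < n)%N && ((l <= j)%N || y))) _ _ _ _ _ _ _ _).
  by case=> //= k _; rewrite /resmooth eq_Tab /=; case: eqP => /=; lia.
apply: (unlink_ladder_right _ _ _ (b := n) (l := n - l)); [|by []|by clear_sites|lia|].
  by move=> k; clear_sites.
move_mark (Tab n) true; rewrite ltnn /=.
exact: IH (ltnW ln) (erefl _) (erefl _).
Qed.

(** The horizontal smoothing of [Tab n] joins the two [ab] strands into one, which runs down on the
    right and up on the left. *)
Lemma porbit_strand chi z : (forall k, chi (Tab k) = (k < n)%N) ->
  z \in porbit (smoothed M N chi) (ab false 0) -> z \in porbit (smoothed M N chi) (ab true 0).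
Proof.
move=> ev zk; have lad := @ladder_ab M N chi z 0 n _ (leqnSn n).
have [||_] // := lad _ 0%N; first by move=> k /andP[_ kn]; rewrite ev.
apply; refine (porbit_site (c := Tab n) (x := true) (ltnSn n) _); rewrite ev ltnn /=.
by have [||+ _] // := lad _ n; [move=> k /andP[_ kn]; rewrite ev | rewrite leqnn | apply].
Qed.

Lemma unlink_strand chi cs g i j : (forall k, chi (Tab k) = (k < n)%N) ->
  (forall k, Tab k \notin cs) -> all (valid_site M N) cs ->
  unlink (M := M) (N := N) chi cs g (ab false 0) i j -> unlink chi cs g (ab true 0) i j.
Proof.
move=> ev nc vs U.
apply: (unlink_ladder_right _ _ _ (b := n) (l := n)) => //; first by move=> k /= kn; rewrite ev kn nc.
refine (unlink_move (c := Tab n) (x := true) (ltnSn n) (nc n) vs _); rewrite ev ltnn /=.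
by apply: (unlink_ladder_left _ _ _ (a := 0)) => // k /= kn; rewrite ev kn nc.
Qed.

(** The pairs cancel in the order a, b, d, c, beginning at the strand that turns round at [Tab n].
    Both marks have to be moved in the course of it, hence the exchanges by [unlinkC]. *)
Lemma last_ab_bigons i j :
  unlink (M := M) (N := N) (state true false true true false true false false)
    (twist_sites 0 m 0 0) (bc true M) CAc i j ->
  unlink (M := M) (N := N) (start (fun k => (k < n)%N)) (fixed_sites ++ twist_sites 0 m 0 0)
    (BD true) (ab false n) (i + 4) (j + 4).
Proof.
move=> U.
apply: (unlink_ladder_left _ _ _ (a := 0)); [|by []|by clear_sites|by []|].
  by move=> k; clear_sites.
pass_mark (Fa false) true.
apply: (@unlink_bigon _ _ (region [:: CAa] (fun _ _ => false) (fun _ j => (j <= n)%N))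
  _ _ _ (i + 3) (j + 3) _ _ _ _ (Fa false) (Fa true) true true); region_side.
  by walk (Fa true) false; apply: porbit_strand => //; exact: porbit_id.
restate (state true false false false false false false false).
move_mark (Fa false) true; move_mark (Fa true) false.
apply: (@unlink_bigon _ _ (region [:: AB false; AB true] (fun _ _ => false) (fun _ _ => true))
  _ _ _ (i + 2) (j + 2) _ _ _ _ (Fb true) (Fb false) false true); region_side.
  by walk (Fb false) false; walk (Tab n) false; rewrite ltnn; exact: porbit_id.
restate (state true false false false false true false false).
pass_mark (Fd true) false; apply: unlinkC.
move_mark (Fb true) false; move_mark (Fa true) true.
apply: unlink_strand => //; [by move=> k; clear_sites | by clear_sites | ].
move_mark (Fa false) false; move_mark (Fb false) false; pass_mark (Fd false) false.
apply: (@unlink_bigon _ _ (region [:: BD false; AD false; CAa; AD true; BD true; AB true; AB false]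
    (fun _ _ => false) (fun _ j => (j <= n)%N))
  _ _ _ (i + 1) (j + 1) _ _ _ _ (Fd false) (Fd true) false false); region_side.
  walk (Fd true) true; walk (Fb true) false; walk (Fa true) true; apply: porbit_strand => //.
  by walk (Fa false) false; walk (Fb false) false; exact: porbit_id.
restate (state true false false true false true false false).
move_mark (Fd false) false; move_mark (Fa false) true; move_mark (Fa true) false.
move_mark (Fd true) true; pass_mark (Fc true) true; apply: unlinkC.
move_mark (Fd true) false; move_mark (Fb true) false; move_mark (Fa true) true.
apply: unlink_strand => //; [by move=> k; clear_sites | by clear_sites | ].
move_mark (Fa false) false; move_mark (Fb false) false; move_mark (Fd false) true.
pass_mark (Fc false) true.
apply: (@unlink_bigon _ _ (region [:: CD2 false; CD1 false; AD false; CAa; AD true; CD1 true;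
      CD2 true; BD true; AB true; AB false; BD false] (fun _ _ => false) (fun _ j => (j <= n)%N))
  _ _ _ i j _ _ _ _ (Fc false) (Fc true) true true); region_side.
  walk (Fc true) false; walk (Fd true) false; walk (Fb true) false; walk (Fa true) true.
  apply: porbit_strand => //.
  by walk (Fa false) false; walk (Fb false) false; walk (Fd false) true; exact: porbit_id.
restate (state true false true true false true false false). exact: U.
Qed.

Local Notation end_state u := (smoothings true false true true false true false false u (fun k => (k < n)%N)).

Lemma last_ab_bc_curls i j :
  unlink (M := M) (N := N) (end_state (fun=> true)) [::] (bc true M) CAc i j ->
  unlink (M := M) (N := N) (end_state (fun=> x)) (twist_sites 0 m 0 0) (bc true M) CAc
    (i + (if x then m%:Z else 0)) (j + (if x then 2 * m%:Z else - m%:Z)).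
Proof.
move=> U; suff H l k i1 j1 : (k + l)%N = m ->
    i1 = i + (if x then l%:Z else 0) -> j1 = j + (if x then 2 * l%:Z else - l%:Z) ->
    unlink (M := M) (N := N) (end_state (fun j => (j < k)%N || x))
      (twist_sites k l 0 0) (bc true M) CAc i1 j1.
  by apply: eq_unlink (H m 0%N _ _ (add0n m) (erefl _) (erefl _)); case.
elim: l k i1 j1 => [|l IH] k i1 j1 kl ei ej.
  have -> : i1 = i by rewrite ei if_same addr0.
  have -> : j1 = j by rewrite ej mulr0 oppr0 if_same addr0.
  by rewrite twist_sitesE; apply: eq_unlink U => -[] //= k'; lia.
apply: (unlink_perm _ _ (perm_Tbc_first _ _ _ _)); [by clear_sites|by clear_sites|].
apply: (@unlink_curl _ _ (region [::] (fun _ j => (j <= k)%N) (fun _ j => (j == N)))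
  _ _ _ (i + (if x then l%:Z else 0)) (j + (if x then 2 * l%:Z else - l%:Z)) _ _ _ _ (Tbc k) false).
all: region_side.
- by rewrite ltnn /= ei; clear; case: x; lia.
- by rewrite ltnn /= ej; clear; case: x; lia.
- apply: eq_unlink (IH k.+1 _ _ _ (erefl _) (erefl _)); last by lia.
  by case=> //= k' _; rewrite /resmooth eq_Tbc /=; case: eqP => /=; lia.
Qed.

Lemma last_ab_circles :
  unlink (M := M) (N := N) (end_state (fun=> true)) [::] (bc true M) CAc 0 2.
Proof.
apply: unlinkC; apply: unlink_homology_two_circles.
set s := smoothed _ _ _.
pose P := region (M := M) (N := N) [:: CAc; CD1 false; AD false; CAa; AD true; CD1 true]
  (fun _ _ => false) (fun _ _ => false).
have cP : closed_in (end_state (fun=> true)) P by close_region.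
apply: (two_circles cP).
- by rewrite /P; in_region.
- by rewrite /P; in_region.
- have r1 : CAc \in porbit s (CD1 true) by walk (Fc true) false; exact: porbit_id.
  have r2 : CAc \in porbit s (AD true) by walk (Fd true) true.
  have r3 : CAc \in porbit s CAa by walk (Fa true) false.
  have r4 : CAc \in porbit s (AD false) by walk (Fa false) true.
  have r5 : CAc \in porbit s (CD1 false) by walk (Fd false) false.
  by case=> [||[]|[]|[]|[]|[]|b k|b k] //= _; exact: porbit_id.
- have lb := @ladder_bc M N (end_state (fun=> true)) (bc true M) 0 m (fun _ _ => isT) (leqnn m).
  have r1 k : (k <= m)%N -> bc true M \in porbit s (bc true k).
    by move=> km; have [] // := lb k; move=> _; apply; exact: porbit_id.
  have r2 : bc true M \in porbit s (ab true N) by walk (Fb true) true; apply: r1.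
  have r3 : bc true M \in porbit s (ab false N) by walk (Tab n) false; rewrite ltnn.
  have r4 k : (k <= m)%N -> bc true M \in porbit s (bc false k).
    by move=> km; have [] // := lb k; move=> + _; apply; walk (Fb false) true.
  have r5 : bc true M \in porbit s (CD2 false) by walk (Fc false) false; apply: r4.
  have r6 : bc true M \in porbit s (BD false) by walk (Fd false) true.
  have r7 : bc true M \in porbit s (AB false) by walk (Fb false) false.
  have r8 : bc true M \in porbit s (ab false 0) by walk (Fa false) false.
  have lad := @ladder_ab M N (end_state (fun=> true)) (bc true M) 0 n (fun _ kn => kn) (leqnSn n).
  have r9 k : (k <= n)%N -> bc true M \in porbit s (ab false k).
    by move=> kn; have [] // := lad k; move=> + _; apply.
  have r10 k : (k <= n)%N -> bc true M \in porbit s (ab true k).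
    move=> kn; have [] // := lad k; move=> _; apply.
    by walk (Tab n) true; rewrite ltnn; apply: r9.
  have r11 : bc true M \in porbit s (AB true) by walk (Fa true) true; apply: r10.
  have r12 : bc true M \in porbit s (BD true) by walk (Fb true) false.
  have r13 : bc true M \in porbit s (CD2 true) by walk (Fd true) false.
  case=> [||[]|[]|[]|[]|[]|b k|b k] //= _; rewrite ?bcE ?abE.
    by have := ltn_ord k; rewrite ltnS; case: b; [apply: r1|apply: r4].
  have := ltn_ord k; rewrite ltnS leq_eqVlt => /orP[/eqP->|kn]; first by case: b.
  by case: b; [apply: r10|apply: r9].
Qed.

Lemma unlink_last_ab :
  unlink (M := M) (N := N) (start (fun k => (k < n)%N && y)) (fixed_sites ++ twist_sites 0 m 0 n)
    (ab false n) (ab false N)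
    (4 + (if x then m%:Z else 0) + (if y then n%:Z else 0))
    (6 + (if x then 2 * m%:Z else - m%:Z) + (if y then 2 * n%:Z else - n%:Z)).
Proof.
move_mark (Tab n) false; rewrite ltnn /=; pass_mark (Fb true) false; apply: unlinkC.
apply: eq_degrees (last_ab_ab_curls (last_ab_bigons (last_ab_bc_curls last_ab_circles))).
  by clear; case: x; case: y; lia.
by clear; case: x; case: y; lia.
Qed.

End LastAB.

(** * Recurrences in the numbers of twists *)

Section BettiPerm.

Variables (E : finType) (D D' : seq (E * E)).
Hypotheses (wf : wf_chords D) (pD : perm_eq D D').

Lemma betti_perm (s : {perm E}) i j : betti s D i j = betti s D' i j.
Proof.
have [T [T' iT]] := perm_cube_iso wf pD.
pose Tl : {linear cube D -> cube D'} := HB.pack T (GRing.isLinear.Build _ _ _ _ T (iso_linear iT)).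
pose f := linfun Tl; have fE w : f w = T w by rewrite lfunE.
have kf : lker f == 0%VS by apply/lker0P => v w; rewrite !fE => /(can_inj (iso_can iT)).
have dimT (U : {vspace cube D}) (U' : {vspace cube D'}) :
    (forall w, (T w \in U') = (w \in U)) -> \dim U = \dim U'.
  move=> TU; rewrite -(limg_dim_eq (f := f)); last by rewrite (eqP kf) capv0.
  congr (\dim _); apply/vspaceP => w'; apply/memv_imgP/idP => [[w wU ->]|w'U].
    by rewrite fE TU.
  by exists (T' w'); rewrite ?fE ?(iso_can' iT) // -TU (iso_can' iT).
have dimC i' : \dim (chains s D i' j) = \dim (chains s D' i' j).
  by apply: dimT => w; apply: (iso_chains iT).
have dimZ i' : \dim (cycle_space s D i' j) = \dim (cycle_space s D' i' j).
  apply: dimT => w; apply/cycle_spaceP/cycle_spaceP; rewrite (iso_chains iT) (iso_dif iT).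
    case=> wC Tw; split=> //; apply: (can_inj (iso_can iT)).
    by rewrite Tw -!fE linear0.
  by case=> wC ->; rewrite -fE linear0.
by rewrite /betti !dim_boundary !dimC !dimZ.
Qed.

End BettiPerm.

(* Smoothing the twist crossing [c] vertically deletes it, and smoothing it
   horizontally leaves a diagram of the unlink. *)
Section LastTwist.

Variables (M N : nat).
Local Notation chords cs := [seq chord M N c | c <- cs].
Variables (chi : site -> bool) (cs : seq site) (c : site) (i0 j0 : int).
Hypotheses (us : uniq (c :: cs)) (vs : all (valid_site M N) (c :: cs)).
Hypothesis unl : unlink (resmooth c false chi) cs (out M N c true) (inn M N c false) i0 j0.

Let vc : valid_site M N c. Proof. by case/andP: vs. Qed.
Let nc : c \notin cs. Proof. by case/andP: us. Qed.
Let vcs : all (valid_site M N) cs. Proof. by case/andP: vs. Qed.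

(** For [b] true this identifies the actions of the two marks on the vertical smoothing; for [b]
    false it turns the sum over the ends of the chord into the sum over the marks. *)
Lemma cube_mul_site b x i j w : w \in chains (smoothed M N (resmooth c b chi)) (chords cs) i j ->
  cube_mul (out M N c (x (+) b)) w = cube_mul (inn M N c x) w.
Proof.
have e : out M N c (x (+) b) = smoothed M N (resmooth c b chi) (inn M N c x).
  by rewrite smoothed_inn // /resmooth eqxx.
by move=> wC; rewrite e (cube_mul_succ _ wC) //; apply: avoids_site; rewrite ?site_innK.
Qed.

Lemma betti_last_positive i j : chi c = false ->
  betti (smoothed M N chi) (chords (c :: cs)) i j =
  betti (smoothed M N (resmooth c true chi)) (chords cs) (i - 1) (j - 1)
  + (nat_of_bool ((i == i0) && ((j == j0 - 2) || (j == j0 - 4))))%:Z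
  - (nat_of_bool ((i == i0 + 1) && ((j == j0) || (j == j0 - 2))))%:Z.
Proof.
move=> ec; have es : smoothed M N chi = smoothed M N (resmooth c false chi).
  by apply: eq_smoothed => d _; rewrite /resmooth; case: eqP => [->|].
have et : toggle (chord M N c) (smoothed M N chi) = smoothed M N (resmooth c true chi).
  by rewrite toggle_smoothed // ec.
have [z gz] := unlink_homology_generates unl; rewrite -es in gz.
rewrite -et; apply: (betti_unlink_source _ gz).
- exact: (wf_chords_sites us vs).
- by rewrite et => i' j' w wC; rewrite (cube_mul_site false wC).
- by rewrite es => i' j' w wC; rewrite /= -(cube_mul_site true wC) /= addrC.
Qed.

Lemma betti_last_negative i j : chi c = true ->
  betti (smoothed M N chi) (chords (c :: cs)) i j =
  betti (smoothed M N chi) (chords cs) i j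
  + (nat_of_bool ((i == i0 + 1) && ((j == j0 + 1) || (j == j0 - 1))))%:Z
  - (nat_of_bool ((i == i0) && ((j == j0 - 1) || (j == j0 - 3))))%:Z.
Proof.
move=> ec; have es : smoothed M N chi = smoothed M N (resmooth c true chi).
  by apply: eq_smoothed => d _; rewrite /resmooth; case: eqP => [->|].
have et : toggle (chord M N c) (smoothed M N chi) = smoothed M N (resmooth c false chi).
  by rewrite toggle_smoothed // ec.
have [z gz] := unlink_homology_generates unl; rewrite -et in gz.
apply: (betti_unlink_target _ gz).
- exact: (wf_chords_sites us vs).
- by rewrite es => i' j' w wC; rewrite (cube_mul_site false wC).
- by rewrite et => i' j' w wC; rewrite /= -(cube_mul_site true wC) /= addrC.
Qed.

End LastTwist.

Definition kanenobu_sites m n :=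
  [:: Fa false; Fb false; Fc false; Fd false; Fa true; Fb true; Fc true; Fd true]
  ++ twist_sites 0 m 0 n.

(* The 0-smoothings of the diagram with [m] and [n] twists, positive or, if [x]
   resp. [y], negative; further twist sites carry no crossing and are smoothed
   vertically. *)
Definition kanenobu_smoothing m n (x y : bool) :=
  smoothings false false false false false false false false
    (fun k => if (k < m)%N then x else true) (fun k => if (k < n)%N then y else true).

(** [M] and [N] determine the edges, [m] and [n] the crossings: the diagrams with and without the
    last twist have to live over the same edges. *)
Definition kanenobu_betti M N m n x y i j :=
  betti (smoothed M N (kanenobu_smoothing m n x y))
    [seq chord M N c | c <- kanenobu_sites m n] i j.

Lemma kanenobu_sites_uniq m n : uniq (kanenobu_sites m n).
Proof. by rewrite /kanenobu_sites; clear_sites. Qed.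

Lemma kanenobu_sites_valid M N m n : (m <= M)%N -> (n <= N)%N ->
  all (valid_site M N) (kanenobu_sites m n).
Proof. by move=> mM nN; rewrite /kanenobu_sites; clear_sites. Qed.

Lemma perm_Tbc_last b m a n :
  perm_eq (twist_sites b m.+1 a n) (Tbc (b + m)%N :: twist_sites b m a n).
Proof.
rewrite !twist_sitesE -addn1 iotaD map_cat -catA perm_sym -[Tbc _ :: _]cat1s perm_catCA.
by [].
Qed.

Lemma kanenobu_sites_bc m n : perm_eq (kanenobu_sites m.+1 n) (Tbc m :: kanenobu_sites m n).
Proof.
rewrite /kanenobu_sites -[Tbc m :: _]cat1s perm_sym perm_catCA perm_cat2l perm_sym.
exact: perm_Tbc_last.
Qed.

Lemma kanenobu_sites_ab m n : perm_eq (kanenobu_sites m n.+1) (Tab n :: kanenobu_sites m n).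
Proof.
rewrite /kanenobu_sites -[Tab n :: _]cat1s perm_sym perm_catCA perm_cat2l perm_sym.
exact: perm_Tab_last.
Qed.

Lemma kanenobu_betti_last M N m n m' n' x y c i j : (m <= M)%N -> (n <= N)%N ->
  perm_eq (kanenobu_sites m n) (c :: kanenobu_sites m' n') ->
  kanenobu_betti M N m n x y i j = betti (smoothed M N (kanenobu_smoothing m n x y))
    [seq chord M N c | c <- c :: kanenobu_sites m' n'] i j.
Proof.
move=> mM nN p; apply: betti_perm; last exact: perm_map.
by apply: wf_chords_sites; [apply: kanenobu_sites_uniq | apply: kanenobu_sites_valid].
Qed.

Section Recurrences.

Variables (m n : nat) (x y : bool).
Let i0 : int := 4 + (if x then m%:Z else 0) + (if y then n%:Z else 0).
Let j0 : int := 6 + (if x then 2 * m%:Z else - m%:Z) + (if y then 2 * n%:Z else - n%:Z).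

Lemma unlink_bc : unlink (M := m.+1) (N := n)
  (resmooth (Tbc m) false (kanenobu_smoothing m.+1 n x y)) (kanenobu_sites m n)
  (out m.+1 n (Tbc m) true) (inn m.+1 n (Tbc m) false) i0 j0.
Proof.
apply: (@unlink_perm _ _ _
  ([:: Fc false; Fc true; Fd false; Fd true; Fa true; Fa false; Fb false; Fb true] ++ twist_sites 0 m 0 n)).
- exact: kanenobu_sites_uniq.
- by apply: kanenobu_sites_valid.
- by rewrite perm_cat2r.
apply: eq_unlink (unlink_last_bc m n x y).
case=> [[]|[]|[]|[]|k|k] //= vk; rewrite /resmooth ?eq_Tbc /= vk //.
by move: vk; rewrite ltnS leq_eqVlt; case: eqP => [->|_ /= ->] //; rewrite ltnn.
Qed.

Lemma unlink_ab : unlink (M := m) (N := n.+1)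
  (resmooth (Tab n) false (kanenobu_smoothing m n.+1 x y)) (kanenobu_sites m n)
  (out m n.+1 (Tab n) true) (inn m n.+1 (Tab n) false) i0 j0.
Proof.
apply: (@unlink_perm _ _ _
  ([:: Fa false; Fa true; Fb true; Fb false; Fd false; Fd true; Fc false; Fc true] ++ twist_sites 0 m 0 n)).
- exact: kanenobu_sites_uniq.
- by apply: kanenobu_sites_valid.
- by rewrite perm_cat2r.
apply: eq_unlink (unlink_last_ab m n x y).
case=> [[]|[]|[]|[]|k|k] //= vk; rewrite /resmooth ?eq_Tab /= vk //.
by move: vk; rewrite ltnS leq_eqVlt; case: eqP => [->|_ /= ->] //; rewrite ltnn.
Qed.

Lemma smoothed_bc : smoothed m.+1 n (resmooth (Tbc m) true (kanenobu_smoothing m.+1 n x y)) =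
  smoothed m.+1 n (kanenobu_smoothing m n x y).
Proof.
apply: eq_smoothed; case=> [[]|[]|[]|[]|k|k] //= vk; rewrite /resmooth ?eq_Tbc /=.
by rewrite vk; move: vk; rewrite ltnS leq_eqVlt; case: eqP => [->|_ /= ->] //; rewrite ltnn.
Qed.

Lemma smoothed_ab : smoothed m n.+1 (resmooth (Tab n) true (kanenobu_smoothing m n.+1 x y)) =
  smoothed m n.+1 (kanenobu_smoothing m n x y).
Proof.
apply: eq_smoothed; case=> [[]|[]|[]|[]|k|k] //= vk; rewrite /resmooth ?eq_Tab /=.
by rewrite vk; move: vk; rewrite ltnS leq_eqVlt; case: eqP => [->|_ /= ->] //; rewrite ltnn.
Qed.

Let positive_last b i j : int := b (i - 1) (j - 1)
  + (nat_of_bool ((i == i0) && ((j == j0 - 2) || (j == j0 - 4))))%:Z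
  - (nat_of_bool ((i == i0 + 1) && ((j == j0) || (j == j0 - 2))))%:Z.

Let negative_last b i j : int := b i j
  + (nat_of_bool ((i == i0 + 1) && ((j == j0 + 1) || (j == j0 - 1))))%:Z
  - (nat_of_bool ((i == i0) && ((j == j0 - 1) || (j == j0 - 3))))%:Z.

Lemma kanenobu_betti_bc i j : kanenobu_betti m.+1 n m.+1 n x y i j =
  (if x then negative_last else positive_last) (kanenobu_betti m.+1 n m n x y) i j.
Proof.
rewrite (kanenobu_betti_last _ _ _ _ _ _ (kanenobu_sites_bc m n)) //.
have us : uniq (Tbc m :: kanenobu_sites m n).
  by rewrite -(perm_uniq (kanenobu_sites_bc m n)) kanenobu_sites_uniq.
have vs : all (valid_site m.+1 n) (Tbc m :: kanenobu_sites m n).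
  by rewrite -(perm_all _ (kanenobu_sites_bc m n)) kanenobu_sites_valid.
have U := unlink_bc; have sE := smoothed_bc; case ex: x U sE => U sE.
  rewrite (betti_last_negative us vs U) /=; last by rewrite ltnSn.
  rewrite /negative_last /kanenobu_betti -sE.
  rewrite (@eq_smoothed _ _ (resmooth (Tbc m) true _) (kanenobu_smoothing m.+1 n true y)) //.
  by move=> d _; rewrite /resmooth; case: eqP => // ->; rewrite /= ltnSn.
rewrite (betti_last_positive us vs U) /=; last by rewrite ltnSn.
by rewrite sE /positive_last /kanenobu_betti.
Qed.

Lemma kanenobu_betti_ab i j : kanenobu_betti m n.+1 m n.+1 x y i j =
  (if y then negative_last else positive_last) (kanenobu_betti m n.+1 m n x y) i j.
Proof.
rewrite (kanenobu_betti_last _ _ _ _ _ _ (kanenobu_sites_ab m n)) //.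
have us : uniq (Tab n :: kanenobu_sites m n).
  by rewrite -(perm_uniq (kanenobu_sites_ab m n)) kanenobu_sites_uniq.
have vs : all (valid_site m n.+1) (Tab n :: kanenobu_sites m n).
  by rewrite -(perm_all _ (kanenobu_sites_ab m n)) kanenobu_sites_valid.
have U := unlink_ab; have sE := smoothed_ab; case ey: y U sE => U sE.
  rewrite (betti_last_negative us vs U) /=; last by rewrite ltnSn.
  rewrite /negative_last /kanenobu_betti -sE.
  rewrite (@eq_smoothed _ _ (resmooth (Tab n) true _) (kanenobu_smoothing m n.+1 x true)) //.
  by move=> d _; rewrite /resmooth; case: eqP => // ->; rewrite /= ltnSn.
rewrite (betti_last_positive us vs U) /=; last by rewrite ltnSn.
by rewrite sE /positive_last /kanenobu_betti.
Qed.

End Recurrences.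

(** * From the Kanenobu diagrams to chord diagrams *)

Section StateSmoothing.

Variables (M N : nat).
Local Notation chords cs := [seq chord M N c | c <- cs].
Implicit Types (chi : site -> bool) (cs : seq site).

Definition state_smoothing chi cs (b : seq bool) (c : site) :=
  chi c (+) (c \in cs) && nth false b (index c cs).

Lemma state_permE chi cs b : uniq cs -> all (valid_site M N) cs ->
  state_perm (smoothed M N chi) (chords cs) b = smoothed M N (state_smoothing chi cs b).
Proof.
elim: cs chi b => [|c cs IH] chi b /=.
  by move=> _ _; apply: eq_smoothed => d _; rewrite /state_smoothing addbF.
move=> /andP[nc us] /andP[vc vs].
have -> : (if head false b then toggle (chord M N c) (smoothed M N chi) else smoothed M N chi)
    = smoothed M N (resmooth c (chi c (+) head false b) chi).
  case: head; first by rewrite toggle_smoothed // addbT.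
  by apply: eq_smoothed => d _; rewrite /resmooth addbF; case: eqP => // ->.
rewrite IH //; apply: eq_smoothed => d _; rewrite /state_smoothing /resmooth inE.
have [->|nd] := eqVneq d c; first by rewrite /= (negPf nc) eqxx addbF nth0.
by rewrite /= eq_sym (negPf nd) nth_behead.
Qed.

End StateSmoothing.

Lemma all2_nth (S T : Type) (r : S -> T -> bool) s t x0 y0 : all2 r s t ->
  forall k, (k < size s)%N -> r (nth x0 s k) (nth y0 t k).
Proof.
elim: s t => [|x s IH] [|y t] //= /andP[rxy rst] [|k] //= ks; exact: IH.
Qed.

Lemma all2_size (S T : Type) (r : S -> T -> bool) s t : all2 r s t -> size s = size t.
Proof. by elim: s t => [|x s IH] [|y t] //= /andP[_ /IH ->]. Qed.

(** * Diagrams inside a chord diagram with surplus twist sites *)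

Section Embedding.

Variables (M N m n : nat).
Hypotheses (mM : (m <= M)%N) (nN : (n <= N)%N).
Local Notation E1 := (kedge m n).
Local Notation E2 := (kedge M N).

Definition extend (e : E1) : E2 :=
  match e with
  | CAa => CAa | CAc => CAc | AB s => AB s | AD s => AD s | BD s => BD s
  | CD1 s => CD1 s | CD2 s => CD2 s | BC s k => bc M N s k | ABo s k => ab M N s k
  end.

(* The twist sites below the last crossing are smoothed vertically: all the
   edges along them belong to one edge of the diagram. *)
Definition collapse (z : E2) : E1 :=
  match z with
  | CAa => CAa | CAc => CAc | AB s => AB s | AD s => AD s | BD s => BD s
  | CD1 s => CD1 s | CD2 s => CD2 s
  | BC s k => bc m n s (minn k m) | ABo s k => ab m n s (minn k n)
  end.

Lemma collapse_bc s k : (k <= M)%N -> collapse (bc M N s k) = bc m n s (minn k m).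
Proof. by move=> kM; rewrite /= inordK. Qed.

Lemma collapse_ab s k : (k <= N)%N -> collapse (ab M N s k) = ab m n s (minn k n).
Proof. by move=> kN; rewrite /= inordK. Qed.

Lemma extendK : cancel extend collapse.
Proof.
case=> // s k; have := ltn_ord k; rewrite ltnS => kl.
  by rewrite collapse_bc ?(leq_trans kl) // (minn_idPl kl) -bcE.
by rewrite collapse_ab ?(leq_trans kl) // (minn_idPl kl) -abE.
Qed.

Implicit Types chi : site -> bool.

Definition surplus_vertical chi :=
  (forall k, (m <= k < M)%N -> chi (Tbc k)) /\ (forall k, (n <= k < N)%N -> chi (Tab k)).

(** Only surplus sites separate the two edges, and these are smoothed vertically. *)
Lemma extend_collapse chi z : surplus_vertical chi ->
  extend (collapse z) \in porbit (smoothed M N chi) z.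
Proof.
case=> Vb Va; case: z => [||s|s|s|s|s|s k|s k]; rewrite ?porbit_id //=; rewrite inordK ?ltnS ?geq_minr //.
  rewrite bcE; have := ltn_ord k; rewrite ltnS => kM; case: (leqP k m) => [km|/ltnW mk].
    exact: porbit_id.
  have lad z k' := @ladder_bc M N chi z m M Vb (leqnn M) k'.
  case: s; last by have [|+ _] := lad (bc M N false m) k; [rewrite mk | apply; exact: porbit_id].
  have [|_ l1] := lad (bc M N true M) k; first by rewrite mk.
  have [|_ l2] := lad (bc M N true M) m; first by rewrite leqnn.
  by apply: porbit_trans (l1 (porbit_id _ _)); rewrite porbit_sym; apply: l2; exact: porbit_id.
rewrite abE; have := ltn_ord k; rewrite ltnS => kN; case: (leqP k n) => [kn|/ltnW nk].
  exact: porbit_id.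
have lad z k' := @ladder_ab M N chi z n N Va (leqnn N) k'.
case: s; last by have [|+ _] := lad (ab M N false n) k; [rewrite nk | apply; exact: porbit_id].
have [|_ l1] := lad (ab M N true N) k; first by rewrite nk.
have [|_ l2] := lad (ab M N true N) n; first by rewrite leqnn.
by apply: porbit_trans (l1 (porbit_id _ _)); rewrite porbit_sym; apply: l2; exact: porbit_id.
Qed.

(* The edges [e0] and [e2] are the two entering edges of the site if [r] is
   false and the two leaving ones otherwise. *)
Definition aligned chi (X : crossing E1) c (r t : bool) :=
  let a x := collapse (inn M N c x) in let b x := collapse (out M N c (x (+) chi c)) in
  if r then [&& e1 X == a t, e3 X == a (~~ t), e0 X == b t & e2 X == b (~~ t)]
  else [&& e0 X == a t, e2 X == a (~~ t), e1 X == b t & e3 X == b (~~ t)].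

Definition matches chi (X : crossing E1) c := [exists r, exists t, aligned chi X c r t].

End Embedding.

Section DiagramBridge.

Variables (M N m n : nat) (D1 : seq (crossing (kedge m n))) (cs : seq site) (chi : site -> bool).
Hypotheses (mM : (m <= M)%N) (nN : (n <= N)%N).
Hypotheses (us : uniq cs) (vs : all (valid_site M N) cs).
Hypothesis csP : forall c, valid_site M N c -> (c \in cs) = valid_site m n c.
Hypothesis chi_surplus : forall c, ~~ valid_site m n c -> chi c.
Hypothesis mD : all2 (@matches M N m n chi) D1 cs.

Local Notation chords := [seq chord M N c | c <- cs].
Local Notation s0 := (smoothed M N chi).
Local Notation pi := (@extend M N m n).
Local Notation rho := (@collapse M N m n).
Local Notation circ := (circles_of chords s0).
Local Notation stc s := (state_smoothing chi cs (state_bits s)).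
Implicit Type s : state D1.

Lemma bridge_size : size chords = size D1.
Proof. by rewrite size_map -(all2_size mD). Qed.

Lemma circ_smoothed s : circ s = smoothed M N (stc s).
Proof. exact: state_permE. Qed.

Lemma collapse_step s z : site_of z \notin cs -> rho (circ s z) = rho z.
Proof.
move=> nz; have vz := site_of_valid z.
rewrite circ_smoothed -{1 2}(inn_site z) smoothed_inn // /state_smoothing (negPf nz) /= addbF.
have := nz; rewrite csP // => nvz; rewrite chi_surplus //.
move: nvz vz {nz}; case: (site_of z) => //= k; rewrite -leqNgt => mk kM.
  by case: (slot_of z); rewrite !collapse_bc ?(ltnW kM) //; rewrite !(minn_idPr _) ?(leq_trans mk).
by case: (slot_of z); rewrite !collapse_ab ?(ltnW kM) //; rewrite !(minn_idPr _) ?(leq_trans mk).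
Qed.

Lemma crossing_site s (k : 'I_(size D1)) : exists c r t,
  [/\ c \in cs, c = nth (Fa false) cs k, stc s c = chi c (+) s k
    & aligned M N chi (xing k) c r t].
Proof.
have ks : (k < size cs)%N by rewrite -(all2_size mD).
pose c := nth (Fa false) cs k; have cc : c \in cs by apply: mem_nth.
have st : stc s c = chi c (+) s k.
  by rewrite /state_smoothing cc index_uniq // nth_state_bits.
have := all2_nth (xing k) (Fa false) mD (ltn_ord k).
rewrite -/c -(tnth_nth _ (in_tuple D1)) -/(xing k) => /existsP[r /existsP[t al]].
by exists c, r, t.
Qed.

Lemma smoothing_circle s k e f : (e, f) \in smoothing (s k) (xing k) ->
  exists z, (e = rho z /\ f = rho (circ s z)) \/ (f = rho z /\ e = rho (circ s z)).
Proof.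
have [c [r [t [cc _ st al]]]] := crossing_site s k.
have vc : valid_site M N c by move/allP: vs; apply.
have stp x : circ s (inn M N c x) = out M N c (x (+) (chi c (+) s k)).
  by rewrite circ_smoothed smoothed_inn // st.
rewrite /smoothing; case: r al => /and4P[/eqP-> /eqP-> /eqP-> /eqP->];
  case: (s k) stp => stp; rewrite !inE => /orP[]/eqP[-> ->].
- by exists (inn M N c (~~ t)); right; rewrite stp addbT addbN addNb negbK.
- by exists (inn M N c t); left; rewrite stp addbT addbN addNb.
- by exists (inn M N c t); right; rewrite stp addbF.
- by exists (inn M N c (~~ t)); right; rewrite stp addbF.
- by exists (inn M N c t); left; rewrite stp addbT addbN addNb.
- by exists (inn M N c (~~ t)); right; rewrite stp addbT addbN addNb negbK.
- by exists (inn M N c t); left; rewrite stp addbF.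
- by exists (inn M N c (~~ t)); left; rewrite stp addbF.
Qed.

Lemma circle_smoothing s z : same_circle s (rho z) (rho (circ s z)).
Proof.
case: (boolP (site_of z \in cs)) => [cc|nc]; last by rewrite collapse_step //; apply: connect0.
have ks : (index (site_of z) cs < size D1)%N by rewrite (all2_size mD) index_mem.
pose k := Ordinal ks; have [c [r [t [_ ec st al]]]] := crossing_site s k.
rewrite /= nth_index // in ec; subst c.
apply: connect1; apply/existsP; exists k.
have rz : rho z = rho (inn M N (site_of z) (slot_of z)) by rewrite inn_site.
have rs : rho (circ s z) = rho (out M N (site_of z) ((slot_of z (+) s k) (+) chi (site_of z))).
  rewrite circ_smoothed -{1}(inn_site z) smoothed_inn ?site_of_valid // st.
  by rewrite -addbA [s k (+) _]addbC.
rewrite rz rs /smoothing; case: r al => /and4P[/eqP-> /eqP-> /eqP-> /eqP->]; case: (s k);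
  by rewrite !inE; case: (slot_of z); case: (t); rewrite !xpair_eqE /= !eqxx ?orbT.
Qed.

Lemma surplus_state s : surplus_vertical M N m n (stc s).
Proof.
split=> k /andP[mk kM]; rewrite /state_smoothing csP //= ltnNge mk /= addbF;
  by apply: chi_surplus; rewrite /= -leqNgt.
Qed.

(** Each arc of a smoothed crossing is a step of the permutation, and steps at surplus sites
    collapse to a single edge. *)
Lemma bridge_circles s e f : same_circle s e f = (pi f \in porbit (circ s) (pi e)).
Proof.
have ec z : pi (rho z) \in porbit (circ s) z.
  by rewrite circ_smoothed; apply: extend_collapse => //; exact: surplus_state.
apply/idP/idP => [/connectP[p pth ->]|pf].
  elim: p e pth => [|g p IH] e /=; first by rewrite porbit_id.
  case/andP=> eg /IH{}IH; apply: (porbit_trans IH).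
  suff H a b k : (a, b) \in smoothing (s k) (xing k) -> pi a \in porbit (circ s) (pi b).
    by case/existsP: eg => k /orP[/H|/H]; rewrite // porbit_sym.
  case/smoothing_circle=> z; have z1 := porbit_step (porbit_id (circ s) z).
  have e1 := porbit_trans (ec (circ s z)) z1; have e0 := ec z.
  case=> -[-> ->]; first by rewrite porbit_sym in e1; exact: porbit_trans e0 e1.
  by rewrite porbit_sym in e0; exact: porbit_trans e1 e0.
rewrite -{1}(extendK mM nN e) -(extendK mM nN f).
apply: (@porbit_ind _ (circ s) (fun z => same_circle s (rho (pi e)) (rho z))) pf.
  exact: connect0.
by move=> z ez; apply: connect_trans ez (circle_smoothing s z).
Qed.

Lemma bridge_meets s : meets_circles pi (circ s).
Proof.
move=> z; exists (rho z); rewrite porbit_sym circ_smoothed.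
by apply: extend_collapse => //; exact: surplus_state.
Qed.

Lemma bridge_ends s (k : 'I_(size D1)) :
  let c := nth (chord M N (Fa false)) chords k in
  let a := pi (e0 (xing k)) in let b := pi (e2 (xing k)) in
  ((c.1 \in porbit (circ s) a) && (c.2 \in porbit (circ s) b))
  || ((c.2 \in porbit (circ s) a) && (c.1 \in porbit (circ s) b)).
Proof.
cbv zeta; have [c [r [t [cc ec st al]]]] := crossing_site s k.
have vc : valid_site M N c by move/allP: vs; apply.
have ks : (k < size cs)%N by rewrite -(all2_size mD).
rewrite (nth_map (Fa false)) // -ec /=.
have er z : z \in porbit (circ s) (pi (rho z)).
  by rewrite porbit_sym circ_smoothed; apply: extend_collapse => //; exact: surplus_state.
have stp x : inn M N c x \in porbit (circ s) (pi (rho (out M N c (x (+) (chi c (+) s k))))).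
  apply: porbit_trans (er _); rewrite porbit_sym circ_smoothed -st -smoothed_inn //.
  exact/porbit_step/porbit_id.
case: r al => /and4P[/eqP h1 /eqP h2 /eqP h3 /eqP h4]; last first.
  by rewrite h1 h2; case: t {h1 h2 h3 h4}; rewrite !er ?orbT.
rewrite h3 h4; have := stp false; have := stp true.
case: (s k) t {h1 h2 h3 h4} => -[]; rewrite ?addbT ?addbF ?addTb ?addFb ?negbK => /= h5 h6; by rewrite h5 h6 ?orbT.
Qed.

Lemma diagram_betti i j :
  (\dim (cycles D1 i j))%:Z - (\dim (boundaries D1 i j))%:Z
  = betti s0 chords (i + (nneg D1)%:Z) (j - (npos D1)%:Z + (nneg D1)%:Z *+ 2).
Proof.
exact: (khovanov_betti bridge_size (wf_chords_sites us vs) bridge_circles bridge_meets bridge_ends).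
Qed.

Lemma diagram_boundaries i j : (boundaries D1 i j <= cycles D1 i j)%VS.
Proof.
exact: (boundaries_cycles bridge_size (wf_chords_sites us vs) bridge_circles bridge_meets bridge_ends).
Qed.

End DiagramBridge.

Section KanenobuBridge.

Variables (p q : int) (M N : nat).
Local Notation m := `|p|%N.
Local Notation n := `|q|%N.
Hypotheses (mM : (m <= M)%N) (nN : (n <= N)%N).
Local Notation chi := (kanenobu_smoothing m n (p < 0) (q < 0)).
Local Notation matches := (@matches M N m n chi).

Lemma all2_map_iota (S T : Type) (r : S -> T -> bool) f g a k :
  (forall x, (a <= x < a + k)%N -> r (f x) (g x)) -> all2 r (map f (iota a k)) (map g (iota a k)).
Proof.
elim: k a => //= k IH a rfg; rewrite rfg ?leqnn ?addnS ?ltnS ?leq_addr //=.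
by apply: IH => x /andP[ax xk]; apply: rfg; lia.
Qed.

Lemma all2_cat2 (S T : Type) (r : S -> T -> bool) s1 s2 t1 t2 :
  all2 r s1 t1 -> all2 r s2 t2 -> all2 r (s1 ++ s2) (t1 ++ t2).
Proof. by elim: s1 t1 => [|x s1 IH] [|y t1] //= /andP[-> /IH]. Qed.

(** Reversing the under-strand turns the code by half a turn, which changes [t]; reversing the
    over-strand changes only the sign, which [aligned] does not see. *)
Lemma matches_reorient u o X c : matches X c -> matches (reorient u o X) c.
Proof.
case/existsP=> r /existsP[t al]; apply/existsP; exists r; apply/existsP; exists (u (+) t).
by move: al; rewrite /aligned; case: u; case: o; case: r; case: t => /and4P[h1 h2 h3 h4];
  apply/and4P; split.
Qed.

Lemma matches_reflect_reorient u o X c : matches (reflect_reverse (@reflect_edge p q) X) c ->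
  matches (reflect_reverse (@reflect_edge p q) (reorient u o X)) c.
Proof.
case/existsP=> r /existsP[t al]; apply/existsP; exists r; apply/existsP; exists (u (+) t).
by move: al; rewrite /aligned; case: u; case: o; case: r; case: t => /and4P[h1 h2 h3 h4];
  apply/and4P; split.
Qed.

Lemma all2_4 (S T : Type) (r : S -> T -> bool) a b c d a' b' c' d' :
  r a a' -> r b b' -> r c c' -> r d d' -> all2 r [:: a; b; c; d] [:: a'; b'; c'; d'].
Proof. by move=> /= -> -> -> ->. Qed.

Lemma matchesI r t X c : aligned M N chi X c r t -> matches X c.
Proof. by move=> al; apply/existsP; exists r; apply/existsP; exists t. Qed.

Lemma matches_twist (pos dir : bool) (l r l' r' : kedge m n) c :
  l' = collapse m n (inn M N c false) -> r = collapse m n (inn M N c true) ->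
  l = collapse m n (out M N c true) -> r' = collapse m n (out M N c false) ->
  chi c = ~~ pos ->
  matches (if pos then if dir then Crossing true l' r' r l else Crossing true r l l' r'
           else if dir then Crossing false l l' r' r else Crossing false r' r l l') c.
Proof.
move=> -> -> -> -> ec; case: pos ec => ec; case: dir; [apply: (@matchesI false false)|
  apply: (@matchesI false true)|apply: (@matchesI true false)|apply: (@matchesI true true)];
  by rewrite /aligned ec !eqxx.
Qed.

Lemma kanenobu_matches : all2 matches (kanenobu p q) (kanenobu_sites m n).
Proof.
have c0 : collapse m n (ab M N false 0) = ab m n false 0 by rewrite collapse_ab // min0n.
have c0' : collapse m n (ab M N true 0) = ab m n true 0 by rewrite collapse_ab // min0n.
have cN s : collapse m n (ab M N s N) = ab m n s n by rewrite collapse_ab // (minn_idPr nN).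
have b0 s : collapse m n (bc M N s 0) = bc m n s 0 by rewrite collapse_bc // min0n.
have bM s : collapse m n (bc M N s M) = bc m n s m by rewrite collapse_bc // (minn_idPr mM).
have -> : kanenobu_sites m n = [:: Fa false; Fb false; Fc false; Fd false]
  ++ [:: Fa true; Fb true; Fc true; Fd true] ++ twist_sites 0 m 0 n by [].
rewrite /kanenobu; apply: all2_cat2; last apply: all2_cat2.
- apply: all2_4; apply: matches_reorient.
  + by apply: (@matchesI false false); apply/and4P; split; apply/eqP;
    [exact: esym c0|exact: erefl|exact: erefl|exact: erefl].
  + by apply: (@matchesI false false); apply/and4P; split; apply/eqP;
    [exact: erefl|exact: esym (b0 false)|exact: erefl|exact: esym (cN false)].
  + by apply: (@matchesI false false); apply/and4P; split; apply/eqP;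
    [exact: erefl|exact: erefl|exact: erefl|exact: esym (bM false)].
  + by apply: (@matchesI false false); apply/and4P; split; apply/eqP;
    [exact: erefl|exact: erefl|exact: erefl|exact: erefl].
- apply: all2_4; apply: matches_reflect_reorient.
  + by apply: (@matchesI true false); apply/and4P; split; apply/eqP;
    [exact: erefl|exact: erefl|exact: erefl|exact: esym c0'].
  + by apply: (@matchesI true false); apply/and4P; split; apply/eqP;
    [exact: erefl|exact: esym (cN true)|exact: esym (b0 true)|exact: erefl].
  + by apply: (@matchesI true false); apply/and4P; split; apply/eqP;
    [exact: erefl|exact: esym (bM true)|exact: erefl|exact: erefl].
  + by apply: (@matchesI true false); apply/and4P; split; apply/eqP;
    [exact: erefl|exact: erefl|exact: erefl|exact: erefl].
rewrite twist_sitesE; apply: all2_cat2; apply: all2_map_iota => k; rewrite add0n => /andP[_ kl].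
  have bk s l : (l <= m)%N -> bc m n s l = collapse m n (bc M N s l).
    by move=> lm; rewrite collapse_bc ?(leq_trans lm) // (minn_idPl lm).
  have [h0 h1] := (fun s => bk s k (ltnW kl), fun s => bk s k.+1 kl).
  apply: (@matches_twist _ _ _ _ _ _ (Tbc k) (h1 false) (h0 true) (h0 false) (h1 true));
    rewrite /= kl; case: (boolP (0 < p)); lia.
have ak s l : (l <= n)%N -> ab m n s l = collapse m n (ab M N s l).
  by move=> ln; rewrite collapse_ab ?(leq_trans ln) // (minn_idPl ln).
have [h0 h1] := (fun s => ak s k (ltnW kl), fun s => ak s k.+1 kl).
by apply: (@matches_twist _ _ _ _ _ _ (Tab k) (h1 false) (h0 true) (h0 false) (h1 true));
    rewrite /= kl; case: (boolP (0 < q)); lia.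
Qed.

Lemma kanenobu_sitesE c : valid_site M N c -> (c \in kanenobu_sites m n) = valid_site m n c.
Proof. by case: c => [[]|[]|[]|[]|k|k] vc; rewrite /kanenobu_sites; clear_sites. Qed.

Lemma kanenobu_smoothing_surplus c : ~~ valid_site m n c -> chi c.
Proof. by case: c => //= k /negPf ->. Qed.

End KanenobuBridge.

Lemma kanenobu_boundaries p q i j :
  (boundaries (kanenobu p q) i j <= cycles (kanenobu p q) i j)%VS.
Proof.
apply: (diagram_boundaries (leqnn _) (leqnn _) (kanenobu_sites_uniq _ _)
  (kanenobu_sites_valid (leqnn _) (leqnn _)) _ _ (kanenobu_matches (leqnn _) (leqnn _))).
  exact: kanenobu_sitesE.
exact: kanenobu_smoothing_surplus.
Qed.

(** * Dimensions relative to the unknot *)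

Definition khovanov_dim p q i j : int :=
  (\dim (cycles (kanenobu p q) i j))%:Z - (\dim (boundaries (kanenobu p q) i j))%:Z.

Definition negative_part (p : int) : nat := if p < 0 then `|p|%N else 0.
Definition positive_part (p : int) : nat := if p < 0 then 0 else `|p|%N.

Lemma count_twists (E : Type) pos down (L R : nat -> E) h :
  count (@positive E) (twists pos down L R h) = if pos then h else 0%N.
Proof.
rewrite /twists count_map (eq_count (a2 := fun=> pos)).
  by case: pos; rewrite ?count_predT ?count_pred0 ?size_iota.
by move=> k /=; case: ifP; case: ifP.
Qed.

(** A crossing and its mirror image have opposite signs, so each pair contains one positive
    crossing. *)
Lemma count_mirrored p q s :
  count (@positive (kanenobu_edge p q))
    (s ++ [seq reflect_reverse (@reflect_edge p q) c | c <- s]) = size s.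
Proof. by rewrite count_cat count_map -(count_predC (@positive _) s). Qed.

Lemma npos_kanenobu p q : npos (kanenobu p q) = (4 + positive_part p + positive_part q)%N.
Proof.
rewrite /npos /kanenobu catA count_cat count_mirrored count_cat !count_twists addnA.
rewrite /positive_part; congr (_ + _ + _)%N; case: ifP; case: ifP; lia.
Qed.

Lemma nneg_kanenobu p q : nneg (kanenobu p q) = (4 + negative_part p + negative_part q)%N.
Proof.
have := count_predC (@positive _) (kanenobu p q).
have -> : count (predC (@positive _)) (kanenobu p q) = nneg (kanenobu p q) by [].
have -> : count (@positive _) (kanenobu p q) = npos (kanenobu p q) by [].
rewrite npos_kanenobu /kanenobu !size_cat !size_map !size_iota /=.
by rewrite /positive_part /negative_part; case: (p < 0); case: (q < 0); lia.
Qed.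

(** The freedom in [M] and [N] allows consecutive numbers of twists to be compared over one set of
    edges. *)
Lemma khovanov_dimE p q M N i j : (`|p| <= M)%N -> (`|q| <= N)%N ->
  khovanov_dim p q i j = kanenobu_betti M N `|p| `|q| (p < 0) (q < 0)
    (i + (4 + negative_part p + negative_part q)%:Z)
    (j - (4 + positive_part p + positive_part q)%:Z
       + (4 + negative_part p + negative_part q)%:Z *+ 2).
Proof.
move=> pM qN; rewrite -npos_kanenobu -nneg_kanenobu.
apply: (diagram_betti pM qN (kanenobu_sites_uniq _ _)
  (kanenobu_sites_valid pM qN) _ _ (kanenobu_matches pM qN)).
  exact: kanenobu_sitesE.
exact: kanenobu_smoothing_surplus.
Qed.

Definition unknot_part (i j : int) : int := (nat_of_bool ((i == 0) && ((j == 1) || (j == -1))))%:Z.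

(** In normalised degrees a further twist shifts the dimension and adds [unknot_part] minus its
    shift; the difference is merely shifted. *)
Definition reduced_dim p q i j := khovanov_dim p q i j - unknot_part i j.

Lemma reduced_dim_step (K : int -> int -> int) i1 j1 i2 j2 (b1 b2 u1 u2 : int) :
  i1 = i2 -> j1 = j2 -> b1 - b2 - u1 = - u2 -> K i1 j1 + b1 - b2 - u1 = K i2 j2 - u2.
Proof. by move=> -> -> <-; rewrite !addrA. Qed.

(** The cone contributes (1,1) to the shift, and the additional positive crossing (0,1). *)
Lemma reduced_dim_succ_l p q i j : 0 <= p ->
  reduced_dim (p + 1) q i j = reduced_dim p q (i - 1) (j - 2).
Proof.
case: p => // m _; rewrite (_ : m%:Z + 1 = m.+1%:Z); last by rewrite -addn1.
rewrite /reduced_dim (@khovanov_dimE m.+1 q m.+1 `|q|) // (@khovanov_dimE m q m.+1 `|q|) //=.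
rewrite kanenobu_betti_bc /= /positive_part /negative_part /unknot_part /=.
apply: (@reduced_dim_step (kanenobu_betti m.+1 `|q| m `|q| false (q < 0))); clear;
  set n := `|q|%N; case: (q < 0); clearbody n; lia.
Qed.

Lemma reduced_dim_succ_r p q i j : 0 <= q ->
  reduced_dim p (q + 1) i j = reduced_dim p q (i - 1) (j - 2).
Proof.
case: q => // n _; rewrite (_ : n%:Z + 1 = n.+1%:Z); last by rewrite -addn1.
rewrite /reduced_dim (@khovanov_dimE p n.+1 `|p| n.+1) // (@khovanov_dimE p n `|p| n.+1) //=.
rewrite kanenobu_betti_ab /= /positive_part /negative_part /unknot_part /=.
apply: (@reduced_dim_step (kanenobu_betti `|p| n.+1 `|p| n (p < 0) false)); clear;
  set m := `|p|%N; case: (p < 0); clearbody m; lia.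
Qed.

(** The vertical smoothing is now the 0-smoothing and stays in place; the shift comes from
    normalising with one more negative crossing. *)
Lemma reduced_dim_pred_l p q i j : p <= 0 ->
  reduced_dim (p - 1) q i j = reduced_dim p q (i + 1) (j + 2).
Proof.
move=> p0; have [m ->] : exists m : nat, p = - m%:Z by exists `|p|%N; lia.
rewrite (_ : - m%:Z - 1 = - m.+1%:Z); last by lia.
have am k : `|- k%:Z|%N = k by rewrite abszN.
rewrite /reduced_dim (@khovanov_dimE (- m.+1%:Z) q m.+1 `|q|) ?am //.
rewrite (@khovanov_dimE (- m%:Z) q m.+1 `|q|) ?am //.
(* For [m] = 0 the flag is false, but an empty twist region has the same smoothing for either
   flag. *)
have -> : kanenobu_betti m.+1 `|q| m `|q| (- m%:Z < 0) (q < 0)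
    = kanenobu_betti m.+1 `|q| m `|q| true (q < 0) by case: (m).
rewrite (_ : - m.+1%:Z < 0 = true) //.
rewrite kanenobu_betti_bc /= /positive_part /negative_part /unknot_part ?am /=.
have -> : (if - m%:Z < 0 then m else 0%N) = m by case: (m).
have -> : (if - m%:Z < 0 then 0%N else m) = 0%N by case: (m).
apply: (@reduced_dim_step (kanenobu_betti m.+1 `|q| m `|q| true (q < 0))); clear;
  set n := `|q|%N; case: (q < 0); clearbody n; lia.
Qed.

Lemma reduced_dim_pred_r p q i j : q <= 0 ->
  reduced_dim p (q - 1) i j = reduced_dim p q (i + 1) (j + 2).
Proof.
move=> q0; have [n ->] : exists n : nat, q = - n%:Z by exists `|q|%N; lia.
rewrite (_ : - n%:Z - 1 = - n.+1%:Z); last by lia.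
have am k : `|- k%:Z|%N = k by rewrite abszN.
rewrite /reduced_dim (@khovanov_dimE p (- n.+1%:Z) `|p| n.+1) ?am //.
rewrite (@khovanov_dimE p (- n%:Z) `|p| n.+1) ?am //.
have -> : kanenobu_betti `|p| n.+1 `|p| n (p < 0) (- n%:Z < 0)
    = kanenobu_betti `|p| n.+1 `|p| n (p < 0) true by case: (n).
rewrite (_ : - n.+1%:Z < 0 = true) //.
rewrite kanenobu_betti_ab /= /positive_part /negative_part /unknot_part ?am /=.
have -> : (if - n%:Z < 0 then n else 0%N) = n by case: (n).
have -> : (if - n%:Z < 0 then 0%N else n) = 0%N by case: (n).
apply: (@reduced_dim_step (kanenobu_betti `|p| n.+1 `|p| n (p < 0) true)); clear;
  set m := `|p|%N; case: (p < 0); clearbody m; lia.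
Qed.

(** Only steps away from 0 are at hand, so the induction runs outwards on either side. *)
Lemma shift_int (F : int -> int -> int -> int) :
  (forall p i j, 0 <= p -> F (p + 1) i j = F p (i - 1) (j - 2)) ->
  (forall p i j, p <= 0 -> F (p - 1) i j = F p (i + 1) (j + 2)) ->
  forall p i j, F p i j = F 0 (i - p) (j - 2 * p).
Proof.
move=> Fs Fp p; have [m [->|->]] : exists m : nat, p = m%:Z \/ p = - m%:Z by exists `|p|%N; lia.
  elim: m => [|m IH] i j; first by rewrite mulr0 !subr0.
  have -> : m.+1%:Z = m%:Z + 1 by lia.
  by rewrite Fs // IH; congr F; lia.
elim: m => [|m IH] i j; first by rewrite mulr0 !subr0.
have -> : - m.+1%:Z = - m%:Z - 1 by lia.
by rewrite Fp ?IH; [congr F; lia | lia].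
Qed.

Lemma khovanov_dim_add p q i j : khovanov_dim p q i j = khovanov_dim (p + q) 0 i j.
Proof.
suff H : reduced_dim p q i j = reduced_dim (p + q) 0 i j.
  by apply: (addIr (- unknot_part i j)).
(* [L] removes the twists of the first region and [R] those of the second; both sides become K(0,0)
   shifted by p + q and 2 (p + q). *)
have L p' q' := @shift_int (fun p => reduced_dim p q') (fun p i j => @reduced_dim_succ_l p q' i j)
  (fun p i j => @reduced_dim_pred_l p q' i j) p'.
have R := @shift_int (reduced_dim 0) (fun q i j => @reduced_dim_succ_r 0 q i j)
  (fun q i j => @reduced_dim_pred_r 0 q i j).
by rewrite L R (L (p + q)); congr reduced_dim; lia.
Qed.

Theorem proposition4p9 (p q i j : int) :
  exists f : {linear khovanov (kanenobu p q) i j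
                     -> khovanov (kanenobu (p + q) 0) i j},
    bijective f.
Proof.
apply: khovanov_iso; [exact: kanenobu_boundaries | exact: kanenobu_boundaries |].
exact: khovanov_dim_add.
Qed.
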